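(* Let $n\in\mathbb{N}$, $0\le p\le n$, let $A_\lambda,B_\lambda$ be holomorphic functions of $\lambda\in\mathbb{C}$, and set $$C_\lambda:=(\lambda+p)A_\lambda-pB_\lambda,\qquad D_\lambda:=-(n-p)A_\lambda+(\lambda+n-p)B_\lambda .$$ Define the second-order differential operator on $p$-forms $$D_2(\lambda;n,p):=C_\lambda D_{\lambda+2}\,\delta d+D_\lambda C_{\lambda+2}\,d\delta .$$ Then the Riesz distribution for differential forms satisfies, as an identity of meromorphic families in $\lambda\in\mathbb{C}$ of tempered $\mathrm{End}(\Lambda^p(\mathbb{R}^n)^* )$-valued distributions on $\mathbb{R}^n$, $$D_2(\lambda;n,p)\,R^{\lambda+2}_{A_{\lambda+2},B_{\lambda+2}}(x)=-\lambda(\lambda+n)\,C_{\lambda+2}D_{\lambda+2}\,R^{\lambda}_{A_\lambda,B_\lambda}(x).$$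
   Context: On $\mathbb{R}^n$ with standard orthonormal basis $e_1,\dots,e_n$ (vectors and covectors identified via the Euclidean scalar product), for $x\in\mathbb{R}^n$ and a $p$-form $\omega$ put $i_x\omega:=\sum_k x_k\, i_{e_k}\omega$ and $\varepsilon_x\omega:=\sum_k x_k\, e_k\wedge\omega$. Let $r(x)=(x_1^2+\cdots+x_n^2)^{1/2}$. The operator $d$ is the exterior differential and $\delta$ is its formal $L^2$-adjoint, so $\delta d+d\delta=-\sum_k\partial_k^2$. For $\Re(\lambda)>-n$ the Riesz distribution for differential forms is the $\mathrm{End}(\Lambda^p(\mathbb{R}^n)^* )$-valued tempered distribution $$R^{\lambda}_{A_\lambda,B_\lambda}(x):=r^{\lambda-2}(x)\,(A_\lambda\, i_x\varepsilon_x+B_\lambda\,\varepsilon_x i_x),$$ extended meromorphically to $\lambda\in\mathbb{C}$. A differential operator $D$ on $p$-forms acts on an $\mathrm{End}(\Lambda^p(\mathbb{R}^n)^* )$-valued distribution $R$ by $(DR)\beta:=D(R\beta)$ for every constant $p$-form $\beta$. *)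

(* Defs.v *)
From HB Require Import structures.
From mathcomp Require Import all_boot all_order all_algebra.
From mathcomp Require Import all_classical all_reals all_analysis.
From mathcomp Require Export complex.

Set Implicit Arguments.
Unset Strict Implicit.
Unset Printing Implicit Defensive.

Import Order.TTheory GRing.Theory Num.Theory.
Import numFieldNormedType.Exports.

Local Open Scope classical_set_scope.
Local Open Scope ring_scope.

Section lebesgue_Rn.
Context (R : realType).

Section step.
Variables (n : nat)
  (mu : {sigma_finite_measure set (n.-tuple (measurableTypeR R)) -> \bar R}).

Definition tuple_cons (x : measurableTypeR R * n.-tuple (measurableTypeR R)) :
  n.+1.-tuple (measurableTypeR R) := [tuple of x.1 :: x.2].

Lemma measurable_tuple_cons : measurable_fun [set: _] tuple_cons.
Proof.
exact: (measurable_cons (T2 := measurableTypeR R) measurable_fst measurable_snd).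
Qed.

Definition lebesgue_step :=
  pushforward (lebesgue_measure \x mu)%E tuple_cons.

Let step0 : lebesgue_step set0 = 0%E.
Proof. by rewrite /lebesgue_step /pushforward preimage_set0 measure0. Qed.

Let step_ge0 A : (0 <= lebesgue_step A)%E.
Proof. exact: (measure_ge0 (lebesgue_measure \x mu)%E). Qed.

Let step_sigma_additive : semi_sigma_additive lebesgue_step.
Proof.
move=> F mF tF mUF; rewrite /lebesgue_step /pushforward preimage_bigcup.
apply: measure_semi_sigma_additive.
- by move=> k; rewrite -[X in measurable X]setTI; exact: measurable_tuple_cons.
- apply/trivIsetP => /= i j _ _ ij; rewrite -preimage_setI.
  by move/trivIsetP : tF => /(_ _ _ _ _ ij) ->//; rewrite preimage_set0.
- by rewrite -preimage_bigcup -[X in measurable X]setTI;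
    exact: measurable_tuple_cons.
Qed.

HB.instance Definition _ := isMeasure.Build _ _ _ lebesgue_step
  step0 step_ge0 step_sigma_additive.

Let tuple_uncons (t : n.+1.-tuple (measurableTypeR R)) :
  measurableTypeR R * n.-tuple (measurableTypeR R) :=
  (thead t, [tuple of behead t]).

Let measurable_uncons : measurable_fun [set: _] tuple_uncons.
Proof.
by apply/measurable_fun_pairP; split;
  [exact: measurable_tnth | exact: measurable_behead].
Qed.

Let tuple_consK : cancel tuple_cons tuple_uncons.
Proof.
by case=> x t; rewrite /tuple_uncons /=; congr pair; apply/val_inj.
Qed.

Let step_sigma_finite : sigma_finite setT lebesgue_step.
Proof.
have /sigma_finiteP[F [TF ndF Foo]] := sigma_finiteT (@lebesgue_measure R).
have /sigma_finiteP[G [TG ndG Goo]] := sigma_finiteT mu.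
exists (fun k => tuple_uncons @^-1` (F k `*` G k)).
  rewrite -preimage_bigcup (_ : \bigcup_k _ = setT) ?preimage_setT//.
  apply/seteqP; split=> // -[x t] _.
  have [i _ Fix] : (\bigcup_k F k) x by rewrite -TF.
  have [j _ Gjt] : (\bigcup_k G k) t by rewrite -TG.
  exists (maxn i j) => //; split=> /=.
    by move: x Fix; exact/subsetPset/ndF/leq_maxl.
  by move: t Gjt; exact/subsetPset/ndG/leq_maxr.
move=> k; have [mF Fk] := Foo k; have [mG Gk] := Goo k; split.
  by rewrite -[X in measurable X]setTI; apply: measurable_uncons => //;
    exact: measurableX.
rewrite /lebesgue_step /pushforward -comp_preimage.
rewrite (_ : tuple_uncons \o tuple_cons = id)/=; last exact/funext.
by rewrite product_measure1E// lte_mul_pinfty// ge0_fin_numE.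
Qed.

HB.instance Definition _ := Measure_isSigmaFinite.Build _ _ _ lebesgue_step
  step_sigma_finite.

Definition lebesgue_succ :
  {sigma_finite_measure set (n.+1.-tuple (measurableTypeR R)) -> \bar R} :=
  lebesgue_step.

End step.

Definition lebesgue_zero :
  {sigma_finite_measure set (0.-tuple (measurableTypeR R)) -> \bar R} :=
  \d_([tuple] : 0.-tuple (measurableTypeR R)).

(* The n-fold product of the Lebesgue measure of R, on n-tuples since the
   library has no measurable structure on 'rV[R]_n. *)
Fixpoint lebesgue_tuple (n : nat) :
  {sigma_finite_measure set (n.-tuple (measurableTypeR R)) -> \bar R} :=
  if n is m.+1 then lebesgue_succ (lebesgue_tuple m) else lebesgue_zero.

End lebesgue_Rn.

Section definitions.
Context (R : realType) (n : nat).
Local Notation C := (R[i]).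
Local Notation Rn := ('rV[R]_n).

Definition euclid (x : Rn) : R := Num.sqrt (\sum_k x ord0 k ^+ 2).

Definition cintegral (f : Rn -> C) : C :=
  Complex
    (\int[lebesgue_tuple R n]_t complex.Re (f (\row_k tnth t k)))
    (\int[lebesgue_tuple R n]_t complex.Im (f (\row_k tnth t k))).

Definition basis_vec (k : 'I_n) : Rn := delta_mx ord0 k.

Definition partial (k : 'I_n) (f : Rn -> C) (x : Rn) : C :=
  Complex ('D_(basis_vec k) (fun y => complex.Re (f y) : R^o) x)
          ('D_(basis_vec k) (fun y => complex.Im (f y) : R^o) x).

Definition partials (s : seq 'I_n) (f : Rn -> C) : Rn -> C := foldr partial f s.

Definition smooth (f : Rn -> C) : Prop := forall (s : seq 'I_n) (x : Rn),
  differentiable (fun y => complex.Re (partials s f y) : R^o) x /\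
  differentiable (fun y => complex.Im (partials s f y) : R^o) x.

(* [schwartz_weight N s f x] = (1 + |x|)^N |d^s f(x)|, a nonnegative real seen
   in C, the codomain of the norm of C in the library. *)
Definition schwartz_weight (N : nat) (s : seq 'I_n) (f : Rn -> C) (x : Rn) : C :=
  ((1 + euclid x) ^+ N)%:C%C * `|partials s f x|.

Definition schwartz (f : Rn -> C) : Prop := smooth f /\
  forall (N : nat) (s : seq 'I_n), exists M : C,
    forall x, schwartz_weight N s f x <= M.

(* A distribution is a function on all f : R^n -> C of which only the values at
   Schwartz functions are meaningful. *)
Definition tempered (u : (Rn -> C) -> C) : Prop :=
  (forall (a : C) f g, schwartz f -> schwartz g ->
     u (fun x => a * f x + g x) = a * u f + u g) /\
  exists (N : nat) (M : C), forall f (b : C), schwartz f ->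
    (forall s x, (size s <= N)%N -> schwartz_weight N s f x <= b) ->
    `|u f| <= M * b.

(* [w I] is the coefficient of w at e_{i_1} /\ ... /\ e_{i_p} for
   I = {i_1 < ... < i_p}; p-forms are the elements supported on #|I| = p. *)
Definition dform := {ffun {set 'I_n} -> C^o}.

Definition pform (p : nat) (w : dform) : Prop :=
  forall I : {set 'I_n}, #|I| != p -> w I = 0.

Definition basis_sign (k : 'I_n) (I : {set 'I_n}) : C :=
  (-1) ^+ #|[set i in I | (i < k)%N]|.

(* e_k /\ w *)
Definition wedge_e (k : 'I_n) (w : dform) : dform :=
  [ffun I : {set 'I_n} =>
     if k \in I then basis_sign k I * w (I :\ k) else 0].

(* i_{e_k} w *)
Definition contract_e (k : 'I_n) (w : dform) : dform :=
  [ffun I : {set 'I_n} =>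
     if k \notin I then basis_sign k I * w (k |: I) else 0].

Definition eps_vec (x : Rn) (w : dform) : dform :=
  \sum_k (x ord0 k)%:C%C *: wedge_e k w.

Definition iota_vec (x : Rn) (w : dform) : dform :=
  \sum_k (x ord0 k)%:C%C *: contract_e k w.

Definition fdistr := (Rn -> C) -> dform.

Definition dpartial (k : 'I_n) (T : fdistr) : fdistr :=
  fun f => - T (partial k f).

Definition ext_d (T : fdistr) : fdistr :=
  fun f => \sum_k wedge_e k (dpartial k T f).

Definition ext_d_form (w : Rn -> dform) : Rn -> dform := fun x =>
  \sum_k wedge_e k [ffun J : {set 'I_n} => partial k (fun y => w y J) x].

Definition form_at (I : {set 'I_n}) (f : Rn -> C) : Rn -> dform := fun x =>
  [ffun J : {set 'I_n} => if J == I then f x else 0].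

Definition pairing (T : fdistr) (w : Rn -> dform) : C :=
  \sum_(J : {set 'I_n}) T (fun x => w x J) J.

(* [codiff] is the formal adjoint of [ext_d_form]:
   <delta T, f e_I> = <T, d (f e_I)> for all I and f, where <T, w> is [pairing]. *)
Definition codiff (T : fdistr) : fdistr := fun f =>
  [ffun I : {set 'I_n} => pairing T (ext_d_form (form_at I f))].

Definition edistr := (Rn -> C) -> dform -> dform.

Definition apply_form (T : edistr) (w : dform) : fdistr := fun f => T f w.

Definition tempered_End (p : nat) (T : edistr) : Prop :=
  [/\ forall f w, schwartz f -> pform p w -> pform p (T f w),
      forall f (a : C) v w, schwartz f -> pform p v -> pform p w ->
        T f (a *: v + w) = a *: T f v + T f w
    & forall w I, pform p w -> tempered (fun f => T f w I)].

Definition holomorphic_at (g : C -> C) (z : C) : Prop :=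
  derivable (g : C^o -> C^o) z 1.

Definition entire (g : C -> C) : Prop := forall z, holomorphic_at g z.

(* [P] contains the poles of the family, whose values there are irrelevant.
   The order [N] of a pole is uniform with respect to the test data. *)
Definition meromorphic_family (p : nat) (P : set C) (T : C -> edistr) : Prop :=
  [/\ forall a : C^o, \forall z \near a^', ~ P z,
      forall z, ~ P z -> tempered_End p (T z),
      forall f w I z, schwartz f -> pform p w -> ~ P z ->
        holomorphic_at (fun z => T z f w I) z
    & forall a : C^o, P a -> exists N : nat,
        forall f w I, schwartz f -> pform p w ->
        exists g : C -> C, (\forall z \near a, holomorphic_at g z) /\
          \forall z \near a^', T z f w I = g z / (z - a) ^+ N].

(* t^z = exp (z ln t) for t > 0; the library has no complex exponential. At
   t = 0 the value is immaterial: it only multiplies iota_vec 0 and eps_vec 0. *)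
Definition rcpow (t : R) (z : C) : C :=
  (t `^ complex.Re z)%:C%C *
  Complex (cos (complex.Im z * ln t)) (sin (complex.Im z * ln t)).

Section riesz.
Variables (p : nat) (A B : C -> C).

Definition riesz_density (lam : C) (x : Rn) (w : dform) : dform :=
  rcpow (euclid x) (lam - 2) *:
    (A lam *: iota_vec x (eps_vec x w) + B lam *: eps_vec x (iota_vec x w)).

(* [T] is the meromorphic extension, with poles in [P], of the family given on
   Re lam > -n by the locally integrable [riesz_density]. *)
Definition riesz_distribution (P : set C) (T : C -> edistr) : Prop :=
  meromorphic_family p P T /\
  forall lam, - n%:R < complex.Re lam -> ~ P lam /\
    forall f w I, schwartz f -> pform p w ->
      T lam f w I = cintegral (fun x => f x * riesz_density lam x w I).

Definition Ccoef (lam : C) : C := (lam + p%:R) * A lam - p%:R * B lam.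

Definition Dcoef (lam : C) : C :=
  - (n%:R - p%:R) * A lam + (lam + n%:R - p%:R) * B lam.

Definition D2 (lam : C) (T : fdistr) : fdistr := fun f =>
  (Ccoef lam * Dcoef (lam + 2)) *: codiff (ext_d T) f +
  (Dcoef lam * Ccoef (lam + 2)) *: ext_d (codiff T) f.

End riesz.

End definitions.

(* Main.v *)
(* For Re lam large the density r^lam (A i_x eps_x + B eps_x i_x) beta is twice
   continuously differentiable with polynomial growth, so integration by parts
   against Schwartz functions lets d and delta act on it pointwise. With
   i_x eps_x + eps_x i_x = r^2 one finds
     d R^(lam+2) beta = C_(lam+2) r^lam eps_x beta,
     delta R^(lam+2) beta = - D_(lam+2) r^lam i_x beta,
   and a second derivative of each gives the identity there. Both sides are
   meromorphic in lam once tested against a Schwartz function, so the identity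
   theorem propagates the equality. Complex differentiability is the only
   available hypothesis on these functions, so the identity theorem rests on
   Goursat's argument: on circles around c, the mean of a holomorphic function k
   does not depend on the radius, hence k(c) is bounded by the maximum of k on
   the circle, and this bound applied to k(z) / (z - b)^m kills k near a point b
   around which it vanishes. *)
Require Import Defs.
From mathcomp Require Import all_boot all_order all_algebra.
From mathcomp Require Import all_classical all_reals all_analysis.
From mathcomp Require Import measurable_realfun complex ring lra.

Set Implicit Arguments.
Unset Strict Implicit.
Unset Printing Implicit Defensive.

Import Order.TTheory GRing.Theory Num.Theory.
Import numFieldNormedType.Exports.

Local Open Scope classical_set_scope.
Local Open Scope ring_scope.

(** * The identity theorem for complex differentiable functions *)

(** Circles are handled in the logarithmic coordinate w, with z = c + exp(w): concentric circles
    become vertical segments of length 2 pi, and the period 2 pi i cancels the horizontal sides of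
    the rectangle between two of them. Goursat's bisection is then needed only for rectangles, with
    mixed differences of real antiderivatives in place of contour integrals. Equality of means
    enters only through the mean value theorem: each small circle carries a point where Re k takes a
    value that it also takes on the large circle. Vanishing is propagated as a property of punctured
    neighbourhoods, so a straight ray may run through poles. All integrands are dominated by
    multiples of the product of the 1 / (1 + x_k^2), a weight that splits under Fubini and is
    integrated by arctan; a Schwartz function times a density of polynomial growth falls under it.
    The factor lam (lam + n) is a determinant: (A, B) -> (C, D) is given by a 2 x 2 matrix with this
    determinant, and the combination of delta d and d delta applies its adjugate. *)

Section goursat.
Context {R : realType}.
Implicit Types (S : R -> R -> R) (a b c d h l : R).

(** Stands in for a contour integral around the rectangle [a, b] x [c, d]: it is additive under
    subdivision of the rectangle. *)
Definition double_diff S a b c d := S b d - S b c - S a d + S a c.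

(** A bad quarter is chosen again and again; the lower ends of the nested intervals increase, and
    their supremum lies in all of the intervals. *)
Lemma bisection_bad_box (Bad : R -> R -> R -> R -> Prop) a c h l :
  0 < h -> 0 < l -> Bad a c h l ->
  (forall a c h l, Bad a c h l -> exists i j : bool,
    Bad (a + i%:R * (h / 2)) (c + j%:R * (l / 2)) (h / 2) (l / 2)) ->
  exists x y : R, [/\ x \in `[a, a + h], y \in `[c, c + l] &
    forall e, 0 < e -> exists (a' c' : R) (N : nat),
      [/\ a' <= x <= a' + h / 2 ^+ N, c' <= y <= c' + l / 2 ^+ N,
        a <= a' /\ a' + h / 2 ^+ N <= a + h, c <= c' /\ c' + l / 2 ^+ N <= c + l
        & Bad a' c' (h / 2 ^+ N) (l / 2 ^+ N) /\ (h + l) / 2 ^+ N < e]].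
Proof.
move=> h0 l0 bad0 step.
pose st (p : R * R) N := Bad p.1 p.2 (h / 2 ^+ N) (l / 2 ^+ N).
(* The corner [p] is returned unchanged when its box is not bad, so that a choice function exists on
   all pairs. *)
have ex_next p N : exists q : R * R, st p N ->
    [/\ st q N.+1, p.1 <= q.1 <= p.1 + h / 2 ^+ N.+1 &
        p.2 <= q.2 <= p.2 + l / 2 ^+ N.+1].
  have [spN|nsp] := pselect (st p N); last by exists p.
  have [i [j bij]] := step _ _ _ _ spN.
  exists (p.1 + i%:R * (h / 2 ^+ N / 2), p.2 + j%:R * (l / 2 ^+ N / 2)) => _.
  have E (z : R) : z / 2 ^+ N.+1 = z / 2 ^+ N / 2 by rewrite exprSr invfM mulrA.
  have hN : 0 < h / 2 ^+ N / 2 by rewrite !divr_gt0// exprn_gt0.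
  have lN : 0 < l / 2 ^+ N / 2 by rewrite !divr_gt0// exprn_gt0.
  split => /=.
  - by rewrite /st !E.
  - by rewrite !E; case: (i); rewrite ?mul1r ?mul0r; lra.
  - by rewrite !E; case: (j); rewrite ?mul1r ?mul0r; lra.
pose nxt N p := projT1 (cid (ex_next p N)).
have nxtP p N : st p N ->
    [/\ st (nxt N p) N.+1, p.1 <= (nxt N p).1 <= p.1 + h / 2 ^+ N.+1 &
        p.2 <= (nxt N p).2 <= p.2 + l / 2 ^+ N.+1].
  by rewrite /nxt; case: cid.
pose q := fix q N := if N is M.+1 then nxt M (q M) else (a, c).
have stq N : st (q N) N.
  elim: N => [|N IH] /=; first by rewrite /st /= !expr0 !divr1.
  by have [] := nxtP _ _ IH.
have nest k (pr : R * R -> R) (w : R) : 0 < w ->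
    (forall N, pr (q N) <= pr (q N.+1) <= pr (q N) + w / 2 ^+ N.+1) ->
    forall N, pr (q N) <= pr (q (N + k)%N) /\
      pr (q (N + k)%N) + w / 2 ^+ (N + k) <= pr (q N) + w / 2 ^+ N.
  move=> w0 H N; elim: k => [|k [IH1 IH2]]; first by rewrite addn0.
  rewrite addnS; have /andP[H1 H2] := H (N + k)%N; split; first lra.
  have E : w / 2 ^+ (N + k).+1 = w / 2 ^+ (N + k) / 2 by rewrite exprSr invfM mulrA.
  by rewrite E in H2 *; lra.
have limit (pr : R * R -> R) (w : R) : 0 < w ->
    (forall N, pr (q N) <= pr (q N.+1) <= pr (q N) + w / 2 ^+ N.+1) ->
    exists x, forall N, pr (q N) <= x <= pr (q N) + w / 2 ^+ N.
  move=> w0 H; pose A := [set pr (q N) | N in [set: nat]].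
  have ubA N : ubound A (pr (q N) + w / 2 ^+ N).
    move=> _ [M _ <-]; have wp k : 0 < w / 2 ^+ k by rewrite divr_gt0// exprn_gt0.
    have [le|le] := leqP M N.
      have [+ _] := nest (N - M)%N pr w w0 H M; rewrite subnKC//.
      by have := wp N; lra.
    have [_] := nest (M - N)%N pr w w0 H N; rewrite subnKC ?(ltnW le)//.
    by have := wp M; lra.
  have A0 : A !=set0 by exists (pr (q 0)); exists 0%N.
  exists (sup A) => N; apply/andP; split.
    by apply: ub_le_sup; [exists (pr (q 0) + w / 2 ^+ 0); exact: ubA|exists N].
  exact: ge_sup (ubA N).
have s1 N : (q N).1 <= (q N.+1).1 <= (q N).1 + h / 2 ^+ N.+1.
  by have [] := nxtP _ _ (stq N).
have s2 N : (q N).2 <= (q N.+1).2 <= (q N).2 + l / 2 ^+ N.+1.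
  by have [] := nxtP _ _ (stq N).
have [x Hx] := limit (fun p => p.1) h h0 s1.
have [y Hy] := limit (fun p => p.2) l l0 s2.
have Hx0 := Hx 0%N; have Hy0 := Hy 0%N.
rewrite /= in Hx0 Hy0.
exists x, y; split => [||e e0].
- by rewrite in_itv /= expr0 divr1 in Hx0 *.
- by rewrite in_itv /= expr0 divr1 in Hy0 *.
(* Since (h + l) / e < N < 2 ^ N, this many halvings bring the size below [e]. *)
pose N := Num.bound ((h + l) / e).
exists (q N).1, (q N).2, N; split => //.
- have := nest N (fun p => p.1) h h0 s1 0%N; rewrite add0n /= expr0 divr1. by [].
- by have := nest N (fun p => p.2) l l0 s2 0%N; rewrite add0n /= expr0 divr1.
- split; first exact: stq.
  rewrite ltr_pdivrMr ?exprn_gt0// mulrC -ltr_pdivrMr//.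
  have : (h + l) / e < N%:R by apply: archi_boundP; rewrite divr_ge0//; lra.
  move/lt_trans; apply.
  by rewrite -natrX ltr_nat ltn_expl.
Qed.

(** Goursat's argument. The ratio of the double difference to (h + l) ^ 2 does not decrease on a
    well-chosen quarter: some quarter keeps at least a fourth of the former, and the latter is
    divided by exactly four. At the limit point the local bound with half that ratio is
    contradicted. *)
Lemma double_diff_flat S a b c d : a < b -> c < d ->
  (forall x y, x \in `[a, b] -> y \in `[c, d] ->
    forall e, 0 < e -> exists2 r, 0 < r &
    forall a' h c' l, 0 < h -> 0 < l -> a <= a' -> a' + h <= b ->
      c <= c' -> c' + l <= d ->
      a' <= x <= a' + h -> c' <= y <= c' + l -> h + l < r ->
      `|double_diff S a' (a' + h) c' (c' + l)| <= e * (h + l) ^+ 2) ->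
  double_diff S a b c d = 0.
Proof.
move=> ab cd loc; apply/eqP; apply: contraT => nz.
pose h := b - a; pose l := d - c.
have h0 : 0 < h by rewrite subr_gt0.
have l0 : 0 < l by rewrite subr_gt0.
pose K := `|double_diff S a b c d| / (h + l) ^+ 2.
have hl0 : 0 < (h + l) ^+ 2 by rewrite exprn_gt0// addr_gt0.
have K0 : 0 < K by rewrite divr_gt0// normr_gt0.
pose Bad a' c' h' l' := K * (h' + l') ^+ 2 <= `|double_diff S a' (a' + h') c' (c' + l')|.
have bad0 : Bad a c h l.
  by rewrite /Bad /K divfK ?gt_eqF// /h /l !(addrC _ (_ - _)) !subrK.
have step a' c' h' l' : Bad a' c' h' l' -> exists i j : bool,
    Bad (a' + i%:R * (h' / 2)) (c' + j%:R * (l' / 2)) (h' / 2) (l' / 2).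
  move=> bad; apply: contrapT => nbad.
  have H (i j : bool) : `|double_diff S (a' + i%:R * (h' / 2)) (a' + i%:R * (h' / 2) + h' / 2)
      (c' + j%:R * (l' / 2)) (c' + j%:R * (l' / 2) + l' / 2)| < K * (h' / 2 + l' / 2) ^+ 2.
    by rewrite ltNge; apply/negP => b1; apply: nbad; exists i, j.
  move: (H false false) (H false true) (H true false) (H true true) bad.
  rewrite /Bad !mul0r !mul1r !addr0.
  rewrite -!(addrA a' (h' / 2)) -!(addrA c' (l' / 2)) -!splitr -mulrDl expr_div_n.
  set u1 := double_diff _ _ _ _ _; set u2 := double_diff _ _ _ _ _.
  set u3 := double_diff _ _ _ _ _; set u4 := double_diff _ _ _ _ _.
  have -> : double_diff S a' (a' + h') c' (c' + l') = u1 + u2 + u3 + u4.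
    by rewrite /u1 /u2 /u3 /u4 /double_diff; ring.
  move=> H1 H2 H3 H4.
  have := ler_normD (u1 + u2 + u3) u4; have := ler_normD (u1 + u2) u3.
  by have := ler_normD u1 u2; lra.
have [x [y [xab ycd fin]]] := bisection_bad_box h0 l0 bad0 step.
rewrite /h addrC subrK in xab; rewrite /l addrC subrK in ycd.
have [r r0 Hr] := loc x y xab ycd (K / 2) (divr_gt0 K0 (ltr0Sn _ 1)).
have [a' [c' [N [ax cy [aa' a'b] [cc' c'd] [bad small]]]]] := fin r r0.
have hN0 : 0 < h / 2 ^+ N by rewrite divr_gt0// exprn_gt0.
have lN0 : 0 < l / 2 ^+ N by rewrite divr_gt0// exprn_gt0.
have := Hr a' (h / 2 ^+ N) c' (l / 2 ^+ N) hN0 lN0 aa' _ cc' _ ax cy.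
rewrite -mulrDl => /(_ _ _ small); rewrite {2}/h {2}/l in a'b c'd.
have a'b' : a' + h / 2 ^+ N <= b by lra.
have c'd' : c' + l / 2 ^+ N <= d by lra.
move=> /(_ a'b' c'd').
rewrite /Bad -mulrDl in bad => le1; have := le_trans bad le1.
have : 0 < ((h + l) / 2 ^+ N) ^+ 2 by rewrite exprn_gt0// mulrDl addr_gt0.
by move=> q0; rewrite ler_pM2r// => ?; lra.
Qed.
End goursat.

(** * Real modulus of complex numbers *)

Section cmod.
Context {R : realType}.
Implicit Types z w : R[i].

(** The norm of [R[i]] is itself an element of [R[i]]; its real part lets estimates and limits take
    place in [R]. *)
Definition cmod z : R := complex.Re `|z|.

Lemma cmodE z : `|z| = (cmod z)%:C%C.
Proof. by rewrite /cmod normc_def. Qed.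

Lemma cmod_sqrt z :
  cmod z = Num.sqrt (complex.Re z ^+ 2 + complex.Im z ^+ 2).
Proof. by rewrite /cmod normc_def. Qed.

Lemma le_realC (a b : R) : (a%:C%C <= b%:C%C) = (a <= b).
Proof. by rewrite lecE /= eqxx. Qed.

Lemma lt_realC (a b : R) : (a%:C%C < b%:C%C) = (a < b).
Proof. by rewrite ltcE /= eqxx. Qed.

Lemma cmod_ge0 z : 0 <= cmod z.
Proof. by rewrite cmod_sqrt sqrtr_ge0. Qed.

Lemma cmodD z w : cmod (z + w) <= cmod z + cmod w.
Proof. by rewrite -le_realC rmorphD -!cmodE ler_normD. Qed.

Lemma cmodM z w : cmod (z * w) = cmod z * cmod w.
Proof. by apply: complexI; rewrite rmorphM -!cmodE normrM. Qed.

Lemma cmodX z n : cmod (z ^+ n) = cmod z ^+ n.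
Proof. by apply: complexI; rewrite rmorphXn -!cmodE normrX. Qed.

Lemma cmodV z : cmod z^-1 = (cmod z)^-1.
Proof. by apply: complexI; rewrite fmorphV -!cmodE normfV. Qed.

Lemma cmodN z : cmod (- z) = cmod z.
Proof. by rewrite /cmod normrN. Qed.

Lemma cmodBC z w : cmod (z - w) = cmod (w - z).
Proof. by rewrite /cmod distrC. Qed.

Lemma cmod_real (a : R) : cmod a%:C%C = `|a|.
Proof. by rewrite cmod_sqrt /= expr0n /= addr0 sqrtr_sqr. Qed.

Lemma cmod0 : cmod 0 = 0.
Proof. by rewrite /cmod normr0. Qed.

Lemma cmod_eq0 z : (cmod z == 0) = (z == 0).
Proof. by rewrite -[RHS]normr_eq0 cmodE -(inj_eq (@complexI R)). Qed.

Lemma cmod_gt0 z : (0 < cmod z) = (z != 0).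
Proof. by rewrite lt_def cmod_eq0 cmod_ge0 andbT. Qed.

Lemma Re_le_cmod z : `|complex.Re z| <= cmod z.
Proof. by rewrite -le_realC -cmodE normc_ge_Re. Qed.

Lemma Im_le_cmod z : `|complex.Im z| <= cmod z.
Proof. by rewrite cmod_sqrt -sqrtr_sqr ler_wsqrtr// lerDr sqr_ge0. Qed.

Lemma cmod_i : cmod 'i%C = 1.
Proof. by rewrite cmod_sqrt /= expr0n expr1n add0r sqrtr1. Qed.

Lemma cmod_le_ReIm z : cmod z <= `|complex.Re z| + `|complex.Im z|.
Proof.
rewrite {1}(complexE z) (le_trans (cmodD _ _))//.
by rewrite cmodM cmod_i mul1r !cmod_real.
Qed.

End cmod.

(** * Complex differentiability as a first-order estimate *)

Section complex_derivable.
Context {R : realType}.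
Implicit Types (k : R[i] -> R[i]) (z : R[i]).

Lemma gt0_realC z : 0 < z -> z = (complex.Re z)%:C%C.
Proof. by case: z => a b; rewrite ltcE => /andP[/eqP /= -> _]. Qed.

Lemma near_cmodP z (Q : set R[i]) : (\forall w \near (z : R[i]^o), Q w) <->
  exists2 r : R, 0 < r & forall w, cmod (w - z) < r -> Q w.
Proof.
split.
  move=> /nbhs_ballP[e /= e0 H]; exists (complex.Re e).
    by move: e0; rewrite ltcE => /andP[].
  move=> w wz; apply: H; rewrite -ball_normE /ball_ /= distrC cmodE.
  by rewrite (gt0_realC e0) lt_realC.
move=> [r r0 H]; apply/nbhs_ballP; exists r%:C%C => /=.
  by rewrite (_ : 0 = (0 : R)%:C%C)// lt_realC.
move=> w; rewrite -ball_normE /ball_ /= distrC cmodE lt_realC; exact: H.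
Qed.

Lemma dnbhs_cmodP z (Q : set R[i]) : (\forall w \near (z : R[i]^o)^', Q w) <->
  exists2 r : R, 0 < r & forall w, w != z -> cmod (w - z) < r -> Q w.
Proof.
rewrite (_ : (\forall w \near (z : R[i]^o)^', Q w) <->
             (\forall w \near (z : R[i]^o), w != z -> Q w)); last first.
  by split; rewrite near_withinE.
rewrite near_cmodP; split=> -[r r0 H]; exists r => // w; auto.
Qed.

(** The division-free form of the derivative, in which the increment [h = 0] needs no exclusion and
    both sides of the estimate are real. *)
Lemma holomorphic_atP k z : holomorphic_at k z <->
  exists k' : R[i], forall e : R, 0 < e -> exists2 r : R, 0 < r &
    forall h, cmod h < r -> cmod (k (z + h) - k z - k' * h) <= e * cmod h.
Proof.
split.
- move=> /cvg_ex[k' /cvgr_dist_le H]; exists k' => e e0.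
  have ee : 0 < e%:C%C :> R[i] by rewrite (_ : 0 = (0 : R)%:C%C)// lt_realC.
  have /dnbhs_cmodP[r r0 {}H] := H _ ee; exists r => // h hr.
  have [->|h0] := eqVneq h 0; first by rewrite addr0 mulr0 subrr subr0 cmod0 mulr0.
  have := H h h0; rewrite subr0 => /(_ hr).
  rewrite scaler1 distrC cmodE le_realC => le1.
  have hp : 0 < cmod h by rewrite cmod_gt0.
  rewrite -ler_pdivrMr// -cmodV -cmodM.
  suff -> : (k (z + h) - k z - k' * h) / h = h^-1 *: (k (h + z) - k z : R[i]^o) - k' by [].
  by rewrite /GRing.scale /= (addrC h); field.
- move=> [k' H]; apply/cvg_ex; exists k'; apply/cvgrPdist_le => /= e e0.
  have eE := gt0_realC e0.
  have e0' : 0 < complex.Re e by move: e0; rewrite ltcE => /andP[].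
  have [r r0 {}H] := H _ e0'.
  apply/dnbhs_cmodP; exists r => // h h0; rewrite subr0 => hr.
  rewrite scaler1 distrC cmodE eE le_realC.
  have hp : 0 < cmod h by rewrite cmod_gt0.
  have := H h hr; rewrite -ler_pdivrMr// -cmodV -cmodM.
  suff -> : (k (z + h) - k z - k' * h) / h = h^-1 *: (k (h + z) - k z : R[i]^o) - k' by [].
  by rewrite /GRing.scale /= (addrC h); field.
Qed.

End complex_derivable.

(** * Goursat's theorem on a periodic strip *)

Section strip_mean.
Context {R : realType}.

Lemma exists_antiderivative (f : R -> R) (a b : R) : a < b -> continuous f ->
  exists F : R -> R, forall x, x \in `]a, b[ -> is_derive x 1 F (f x).
Proof.
move=> ab cf; exists (fun x => \int[lebesgue_measure]_(t in `[a, x]) f t) => x.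
rewrite in_itv /= => /andP[ax xb].
have int : lebesgue_measure.-integrable `[a, b] (EFin \o f).
  apply: continuous_compact_integrable; first exact: segment_compact.
  by apply: continuous_subspaceT => ?; exact: cf.
have [df Ef] := continuous_FTC1_closed xb int ax (cf x).
apply: DeriveDef; first exact: df.
by rewrite -derive1E; exact: Ef.
Qed.

Lemma MVT_closed (f df : R -> R) (c d : R) : c < d ->
  (forall z, c <= z <= d -> is_derive z 1 f (df z)) ->
  exists2 z, c <= z <= d & f d - f c = df z * (d - c).
Proof.
move=> cd der.
have [z zcd||z zcd E] := @MVT _ f df c d cd.
- by apply: der; have := subset_itv_oo_cc zcd; rewrite in_itv.
- apply: derivable_within_continuous => z; rewrite in_itv => zcd.
  exact: (@ex_derive _ _ _ _ _ _ _ (der z zcd)).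
- by exists z => //; have := subset_itv_oo_cc zcd; rewrite in_itv.
Qed.

(** The first-order estimate at tolerance 1 bounds the increments of [k] near [g t] by [cmod k' + 1]
    times those of [g]. *)
Lemma continuous_Re_Im (k : R[i] -> R[i]) (g : R -> R[i]) (t : R) :
  holomorphic_at k (g t) ->
  (forall e, 0 < e -> \forall s \near t, cmod (g s - g t) < e) ->
  {for t, continuous (fun s => complex.Re (k (g s)))} /\
  {for t, continuous (fun s => complex.Im (k (g s)))}.
Proof.
move=> /holomorphic_atP[k' H] cg.
have Hk e : 0 < e -> \forall s \near t, cmod (k (g s) - k (g t)) < e.
  move=> e0; have [r r0 Hr] := H 1 ltr01.
  have kp : 0 < cmod k' + 1 + 1 by have := cmod_ge0 k'; lra.
  have e1 : 0 < Num.min r (e / (cmod k' + 1 + 1)) by rewrite lt_min r0 divr_gt0.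
  near=> s.
  have : cmod (g s - g t) < Num.min r (e / (cmod k' + 1 + 1)) by near: s; exact: cg.
  rewrite lt_min => /andP[hr he].
  have := Hr _ hr; rewrite (_ : g t + (g s - g t) = g s) ?mul1r => [h1|]; last by ring.
  rewrite -(subrK (k' * (g s - g t)) (k (g s) - k (g t))).
  rewrite (le_lt_trans (cmodD _ _))// cmodM.
  move: he; rewrite ltr_pdivlMr//.
  have := cmod_ge0 (g s - g t); have := cmod_ge0 k'.
  by move=> p q; nra.
split; apply/cvgrPdist_lt => e e0; have {}Hk := Hk e e0; near=> s;
  have Hs : cmod (k (g s) - k (g t)) < e by near: s.
- apply: le_lt_trans Hs; rewrite cmodBC; apply: le_trans (Re_le_cmod _).
  by rewrite raddfB.
- apply: le_lt_trans Hs; rewrite cmodBC; apply: le_trans (Im_le_cmod _).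
  by rewrite raddfB.
Unshelve. all: by end_near. Qed.

(* The difference of antiderivatives of [Re F] along y and of [Im F] along x
   has double differences equal to the contour integrals of [F]; they are
   additive and second order small, which is Goursat's argument. *)
Lemma holomorphic_strip_Re (F : R[i] -> R[i]) (a b T : R) : a < b -> 0 < T ->
  (forall x y, a - 1 < x -> x < b + 1 -> holomorphic_at F (x +i* y)%C) ->
  (forall x, F (x +i* T)%C = F (x +i* 0)%C) ->
  exists2 t, 0 <= t <= T & exists2 t', 0 <= t' <= T &
    complex.Re (F (a +i* t)%C) = complex.Re (F (b +i* t')%C).
Proof.
move=> ab T0 holF perF.
pose P x y := complex.Re (F (x +i* y)%C).
(* Clamping the abscissa inside the strip makes [Q y] below continuous on all of [R], as
   [exists_antiderivative] requires, while nothing changes on [a, b]. *)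
pose cl x := Num.max (a - 2^-1) (Num.min x (b + 2^-1)).
have cl_in x : a - 1 < cl x /\ cl x < b + 1.
  by rewrite /cl lt_max gt_max gt_min; split; [apply/orP; left; lra|
    apply/andP; split; [lra|apply/orP; right; lra]].
have clE x : a - 2^-1 <= x -> x <= b + 2^-1 -> cl x = x.
  by move=> h1 h2; rewrite /cl (min_idPl h2) (max_idPr h1).
have cl_cont : continuous cl.
  move=> x; apply: (@continuous_max _ _ (fun _ => a - 2^-1) (fun x => Num.min x (b + 2^-1))).
    exact: cvg_cst.
  by apply: (@continuous_min _ _ id (fun _ => b + 2^-1)); [exact: cvg_id|exact: cvg_cst].
pose Q y x := complex.Im (F (cl x +i* y)%C).
have cP x : a - 1 < x -> x < b + 1 -> continuous (P x).
  move=> ax xb y; have [] // := @continuous_Re_Im F (fun y => (x +i* y)%C) y (holF _ _ ax xb).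
  move=> e e0; near=> s; rewrite (le_lt_trans (cmod_le_ReIm _))//= subrr normr0 add0r distrC.
  by near: s; move: e e0; apply/cvgrPdist_lt; exact: cvg_id.
have cQ y : continuous (Q y).
  move=> x; have [ax xb] := cl_in x.
  have [] // := @continuous_Re_Im F (fun x => (cl x +i* y)%C) x (holF _ _ ax xb).
  move=> e e0; near=> s; rewrite (le_lt_trans (cmod_le_ReIm _))//= subrr normr0 addr0 distrC.
  by near: s; move: e e0; apply/cvgrPdist_lt; exact: cl_cont.
have exP x : exists p : R -> R, a - 1 < x -> x < b + 1 ->
    forall y, y \in `]-1, (T + 1)[ -> is_derive y 1 p (P x y).
  have [ax|] := boolP (a - 1 < x); last by exists idfun.
  have [xb|] := boolP (x < b + 1); last by exists idfun.
  have T1 : -1 < T + 1 by lra.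
  have [p Hp] := exists_antiderivative T1 (cP x ax xb).
  by exists p.
have exQ y : exists q : R -> R, forall x, x \in `](a - 1), (b + 1)[ -> is_derive x 1 q (Q y x).
  by apply: exists_antiderivative; [lra|exact: cQ].
pose PP x := projT1 (cid (exP x)).
have dP x y : a - 1 < x -> x < b + 1 -> y \in `]-1, (T + 1)[ -> is_derive y 1 (PP x) (P x y).
  by move=> h1 h2 h3; rewrite /PP; case: cid => p /= H; exact: H.
pose QQ y := projT1 (cid (exQ y)).
have dQ y x : x \in `](a - 1), (b + 1)[ -> is_derive x 1 (QQ y) (Q y x).
  by move=> h; rewrite /QQ; case: cid => p /= H; exact: H.
(* The mean value theorem is applied to a difference of antiderivatives, so that one intermediate
   height serves both sides of the box; otherwise the first-order terms could not be compared. *)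
have mvtP x x' c d : a <= x <= b -> a <= x' <= b -> c < d -> 0 <= c -> d <= T ->
    exists2 y, c <= y <= d & PP x' d - PP x d - (PP x' c - PP x c) = (P x' y - P x y) * (d - c).
  move=> /andP[ax xb] /andP[ax' x'b] cd c0 dT.
  apply: (@MVT_closed (fun z => PP x' z - PP x z) (fun z => P x' z - P x z)) => // z.
  move=> /andP[cz zd].
  have zin : z \in `]-1, (T + 1)[ by rewrite in_itv /=; apply/andP; split; lra.
  by apply: is_deriveB; apply: dP => //; lra.
have mvtQ y y' c d : a <= c -> d <= b -> c < d ->
    exists2 x, c <= x <= d & QQ y' d - QQ y d - (QQ y' c - QQ y c) = (Q y' x - Q y x) * (d - c).
  move=> ac db cd.
  apply: (@MVT_closed (fun z => QQ y' z - QQ y z) (fun z => Q y' z - Q y z)) => // z.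
  move=> /andP[cz zd].
  have zin : z \in `](a - 1), (b + 1)[ by rewrite in_itv /=; apply/andP; split; lra.
  by apply: is_deriveB; apply: dQ => //; lra.
pose S x y := PP x y - QQ y x.
have S0 : double_diff S a b 0 T = 0.
  apply: double_diff_flat => // x y; rewrite !in_itv /= => /andP[ax xb] /andP[y0 yT] e e0.
  have ax1 : a - 1 < x by lra.
  have xb1 : x < b + 1 by lra.
  have /holomorphic_atP[k' Hk'] := holF x y ax1 xb1.
  have [r r0 Hr] := Hk' (e / 2) (divr_gt0 e0 (ltr0Sn _ 1)).
  exists r => // a' h c' l h0 l0 aa' a'b cc' c'd /andP[a'x xa'] /andP[c'y yc'] hlr.
  have [eta /andP[et1 et2] E1] : exists2 eta, c' <= eta <= c' + l &
      PP (a' + h) (c' + l) - PP a' (c' + l) - (PP (a' + h) c' - PP a' c') =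
      (P (a' + h) eta - P a' eta) * (c' + l - c').
    by apply: mvtP; rewrite ?ltrDl//; lra.
  have [xi /andP[xi1 xi2] E2] : exists2 xi, a' <= xi <= a' + h &
      QQ (c' + l) (a' + h) - QQ c' (a' + h) - (QQ (c' + l) a' - QQ c' a') =
      (Q (c' + l) xi - Q c' xi) * (a' + h - a').
    by apply: mvtQ; rewrite ?ltrDl//; lra.
  have est u v : a' <= u -> u <= a' + h -> c' <= v -> v <= c' + l ->
      cmod (F (u +i* v)%C - F (x +i* y)%C - k' * ((u - x) +i* (v - y))%C) <= e / 2 * (h + l).
    move=> u1 u2 v1 v2.
    have le1 : cmod ((u - x) +i* (v - y))%C <= h + l.
      rewrite (le_trans (cmod_le_ReIm _))//= lerD// ler_norml; apply/andP; split; lra.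
    have := Hr ((u - x) +i* (v - y))%C (le_lt_trans le1 hlr).
    rewrite (_ : (x +i* y)%C + ((u - x) +i* (v - y))%C = (u +i* v)%C) =>
      [/le_trans|]; last by rewrite /GRing.add /= !(addrC x) !(addrC y) !subrK.
    apply.
    by rewrite ler_pM2l// divr_gt0.
  have Re_est u v : a' <= u -> u <= a' + h -> c' <= v -> v <= c' + l ->
      `|P u v - P x y - (complex.Re k' * (u - x) - complex.Im k' * (v - y))| <= e / 2 * (h + l).
    move=> u1 u2 v1 v2; have := le_trans (Re_le_cmod _) (est u v u1 u2 v1 v2).
    by rewrite /P; case: (F _) => ? ?; case: (F _) => ? ?; case: (k') => ? ? /=.
  have Im_est u v : a' <= u -> u <= a' + h -> c' <= v -> v <= c' + l ->
      `|Q v u - complex.Im (F (x +i* y)%C) -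
        (complex.Re k' * (v - y) + complex.Im k' * (u - x))| <= e / 2 * (h + l).
    move=> u1 u2 v1 v2; have := le_trans (Im_le_cmod _) (est u v u1 u2 v1 v2).
    rewrite /Q clE; [|lra|lra].
    by case: (F _) => ? ?; case: (F _) => ? ?; case: (k') => ? ? /=.
  have -> : double_diff S a' (a' + h) c' (c' + l) =
      (PP (a' + h) (c' + l) - PP a' (c' + l) - (PP (a' + h) c' - PP a' c')) -
      (QQ (c' + l) (a' + h) - QQ c' (a' + h) - (QQ (c' + l) a' - QQ c' a')).
    by rewrite /double_diff /S; ring.
  rewrite {}E1 {}E2 !(addrC _ l) !(addrC _ h) !addrK.
  have := Re_est (a' + h) eta _ _ et1 et2; have := Re_est a' eta _ _ et1 et2.
  have := Im_est xi (c' + l) xi1 xi2; have := Im_est xi c' xi1 xi2.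
  rewrite !lexx !lerDl !(ltW h0) !(ltW l0).
  move=> /(_ isT isT) I1 /(_ isT isT) I2 /(_ isT isT) R1 /(_ isT isT) R2.
  rewrite !(addrC h) !(addrC l).
  set p1 := P _ _ in R2 *; set p2 := P _ _ in R1 *.
  set q1 := Q _ _ in I2 *; set q2 := Q _ _ in I1 *.
  set kr := complex.Re k' in I1 I2 R1 R2; set ki := complex.Im k' in I1 I2 R1 R2.
  set A1 := (X in `|X| <= _) in R1; set A2 := (X in `|X| <= _) in R2.
  set B1 := (X in `|X| <= _) in I1; set B2 := (X in `|X| <= _) in I2.
  (* By Cauchy-Riemann the affine parts of both products equal [kr * h * l] and cancel; only the
     errors of the first-order expansion remain. *)
  have -> : (p1 - p2) * l - (q1 - q2) * h = l * (A2 - A1) - h * (B2 - B1).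
    by rewrite /A1 /A2 /B1 /B2; ring.
  have n1 : `|A2 - A1| <= e * (h + l).
    by rewrite (le_trans (ler_normB _ _))//; lra.
  have n2 : `|B2 - B1| <= e * (h + l).
    by rewrite (le_trans (ler_normB _ _))//; lra.
  rewrite (le_trans (ler_normB _ _))// !normrM (gtr0_norm h0) (gtr0_norm l0).
  rewrite expr2; move: n1 n2; nra.
(* Periodicity makes the bottom and top sides cancel, so the integrals of Re F over the two vertical
   sides agree. *)
have [x _ EQ] := mvtQ 0 T a b (lexx _) (lexx _) ab.
have EQ0 : Q T x - Q 0 x = 0 by rewrite /Q perF subrr.
have eqab : PP a T - PP a 0 = PP b T - PP b 0.
  by move: S0 EQ; rewrite EQ0 mul0r /double_diff /S; lra.
(* Both vertical sides have length [T], so equal integrals turn into equal values of Re F at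
   suitable heights. *)
have der s : a <= s <= b -> exists2 t, 0 <= t <= T & PP s T - PP s 0 = P s t * T.
  move=> /andP[as1 sb].
  have [z /andP[cz zd]|z zT e1] := @MVT_closed (PP s) (P s) 0 T T0.
    by apply: dP; [lra|lra|rewrite in_itv /=; apply/andP; split; lra].
  by exists z => //; rewrite e1 subr0.
have [|t1 t1T Et1] := der a; first by rewrite lexx ltW.
have [|t2 t2T Et2] := der b; first by rewrite lexx ltW.
exists t1 => //; exists t2 => //; move: eqab; rewrite Et1 Et2 => /mulIf; apply; rewrite gt_eqF//.
Unshelve. all: by end_near. Qed.

End strip_mean.

(** * The complex exponential *)

Section complex_exp.
Context {R : realType}.
Implicit Types z w : R[i].

Definition cexp z : R[i] :=
  ((expR (complex.Re z) * cos (complex.Im z)) +i*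
   (expR (complex.Re z) * sin (complex.Im z)))%C.

Lemma cexpD z w : cexp (z + w) = cexp z * cexp w.
Proof.
case: z w => a b [c d]; rewrite /cexp /= expRD cosD sinD.
by apply/eqP; rewrite eq_complex /=; apply/andP; split; apply/eqP; ring.
Qed.

Lemma cmod_cexp z : cmod (cexp z) = expR (complex.Re z).
Proof.
rewrite cmod_sqrt /= !exprMn -mulrDr cos2Dsin2 mulr1 sqrtr_sqr.
by rewrite ger0_norm ?expR_ge0.
Qed.

Lemma cexp_neq0 z : cexp z != 0.
Proof. by rewrite -cmod_gt0 cmod_cexp expR_gt0. Qed.

Lemma cexp_2pi a : cexp (a +i* (2 * pi))%C = cexp (a +i* 0)%C.
Proof. by rewrite /cexp /= mulr_natl cos2pi sin2pi cos0 sin0. Qed.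

Lemma is_derive_estimate (f : R -> R) (x df : R) : is_derive x 1 f df ->
  forall e, 0 < e -> exists2 r, 0 < r & forall h, `|h| < r ->
    `|f (x + h) - f x - df * h| <= e * `|h|.
Proof.
move=> [dfx <-] e e0.
have /cvgrPdist_le /(_ e e0) := dfx.
rewrite near_withinE => /nbhs_ballP[r /= r0 H]; exists r => // h hr.
have [->|h0] := eqVneq h 0; first by rewrite addr0 mulr0 subrr subr0 normr0 mulr0.
have := H h; rewrite -ball_normE /= sub0r normrN => /(_ hr h0).
rewrite /derive /= distrC -ler_pdivrMr ?normr_gt0// -normfV -normrM.
suff -> : (f (x + h) - f x - 'D_1 f x * h) / h = h^-1 *: (f (h *: 1 + x) - f x) - 'D_1 f x by [].
by rewrite /GRing.scale /= mulr1 (addrC h); field.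
Qed.

(** The functional equation moves the question to 0, where the real derivatives of exp, cos and sin
    suffice. *)
Lemma holomorphic_cexp z : holomorphic_at cexp z.
Proof.
apply/holomorphic_atP; exists (cexp z) => e e0.
have cz0 : 0 < cmod (cexp z) by rewrite cmod_gt0 cexp_neq0.
(* The 6 is 3 for the real part plus 3 for the imaginary part of the error; the cap at 1 keeps the
   increment of exp below 2 * [cmod h]. *)
pose e' := Num.min 1 (e / cmod (cexp z) / 6).
have e'0 : 0 < e' by rewrite lt_min ltr01 /= !divr_gt0.
have [r1 r10 H1] := is_derive_estimate (@is_derive_expR R 0) e'0.
have [r2 r20 H2] := is_derive_estimate (@is_derive_cos R 0) e'0.
have [r3 r30 H3] := is_derive_estimate (@is_derive_sin R 0) e'0.
exists (Num.min (Num.min r1 r2) (Num.min r3 (e' / 2))).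
  by rewrite !lt_min r10 r20 r30 /= divr_gt0.
move=> h; rewrite !lt_min => /andP[/andP[h1 h2] /andP[h3 h4]].
rewrite cexpD (_ : _ - _ - _ = cexp z * (cexp h - 1 - h)); last by ring.
rewrite cmodM.
suff H : cmod (cexp h - 1 - h) <= e' * 6 * cmod h.
  have le6 : e' * 6 <= e / cmod (cexp z).
    by rewrite -ler_pdivlMr// /e' ge_min lexx orbT.
  rewrite mulrC -ler_pdivlMr// mulrAC; apply: le_trans H _.
  by rewrite ler_wpM2r// cmod_ge0.
have hx := Re_le_cmod h; have hy := Im_le_cmod h.
have := H1 _ (le_lt_trans hx h1); have := H2 _ (le_lt_trans hy h2).
have := H3 _ (le_lt_trans hy h3).
rewrite !add0r expR0 cos0 sin0 oppr0 !mul0r !mul1r ?subr0 ?addr0 => S Co E.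
apply: le_trans (cmod_le_ReIm _) _.
case: h h1 h2 h3 h4 hx hy S Co E => x y; set m := cmod _ => h1 h2 h3 h4 /= hx hy S Co E.
rewrite /= !subr0.
have m0 : 0 <= m := cmod_ge0 _.
have e1 : e' <= 1 by rewrite /e' ge_min lexx.
have E1 : `|expR x - 1| <= 2 * m.
  rewrite -(subrK x (expR x - 1)) (le_trans (ler_normD _ _))//.
  have : e' * `|x| <= m by rewrite -[leRHS]mul1r ler_pM// ltW.
  by lra.
have E2 : `|expR x| <= 2.
  rewrite -(subrK 1 (expR x)) (le_trans (ler_normD _ _))// normr1.
  by lra.
have b1 : e' * `|x| <= e' * m by rewrite ler_pM2l.
have b2 : e' * `|y| <= e' * m by rewrite ler_pM2l.
have A1 : `|expR x * cos y - 1 - x| <= 3 * (e' * m).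
  rewrite (_ : _ - _ - _ = (expR x - 1 - x) + expR x * (cos y - 1)); last by ring.
  rewrite (le_trans (ler_normD _ _))// normrM.
  have : `|expR x| * `|cos y - 1| <= 2 * (e' * m) by rewrite ler_pM// (le_trans Co).
  by lra.
have A2 : `|expR x * sin y - y| <= 3 * (e' * m).
  rewrite (_ : _ - _ = expR x * (sin y - y) + (expR x - 1) * y); last by ring.
  rewrite (le_trans (ler_normD _ _))// !normrM.
  have c1 : `|expR x| * `|sin y - y| <= 2 * (e' * m) by rewrite ler_pM// (le_trans S).
  have c2 : `|expR x - 1| * `|y| <= 2 * m * m by rewrite ler_pM.
  have : 2 * m * m <= e' * m by rewrite ler_wpM2r//; lra.
  by lra.
by rewrite -/m; lra.
Qed.

End complex_exp.

(** * Closure properties of complex differentiability *)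

Section holomorphic_calculus.
Context {R : realType}.
Implicit Types (f g k : R[i] -> R[i]) (z : R[i]).

Lemma holomorphic_at_comp f g z : holomorphic_at f z -> holomorphic_at g (f z) ->
  holomorphic_at (fun w => g (f w)) z.
Proof.
move=> /derivable1_diffP df /derivable1_diffP dg; apply/derivable1_diffP.
exact: (differentiable_comp df dg).
Qed.

Lemma holomorphic_at_cst (c : R[i]) z : holomorphic_at (fun=> c) z.
Proof. exact: derivable_cst. Qed.

Lemma holomorphic_at_id z : holomorphic_at id z.
Proof. exact: derivable_id. Qed.

Lemma holomorphic_atD f g z : holomorphic_at f z -> holomorphic_at g z ->
  holomorphic_at (fun w => f w + g w) z.
Proof. by move=> df dg; exact: (derivableD df dg). Qed.

Lemma holomorphic_atM f g z : holomorphic_at f z -> holomorphic_at g z ->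
  holomorphic_at (fun w => f w * g w) z.
Proof. by move=> df dg; exact: (derivableM df dg). Qed.

Lemma holomorphic_atX f n z : holomorphic_at f z ->
  holomorphic_at (fun w => f w ^+ n) z.
Proof.
move=> df; elim: n => [|n IH].
  by rewrite (_ : (fun _ => _) = fun=> 1); [exact: holomorphic_at_cst|apply/funext => w].
rewrite (_ : (fun _ => _) = fun w => f w * f w ^+ n); last by apply/funext => w; rewrite exprS.
exact: holomorphic_atM.
Qed.

Lemma holomorphic_atV f z : f z != 0 -> holomorphic_at f z ->
  holomorphic_at (fun w => (f w)^-1) z.
Proof. by move=> f0 df; exact: (@derivableV _ R[i]^o f). Qed.

Lemma holomorphic_at_near f g z : (\forall w \near (z : R[i]^o), f w = g w) ->
  holomorphic_at f z -> holomorphic_at g z.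
Proof. by move=> fg; apply: (@near_eq_derivable _ R[i]^o R[i]^o f g); exact: fg. Qed.

Lemma holomorphic_at_shift f (c : R[i]) z : holomorphic_at f (z + c) ->
  holomorphic_at (fun w => f (w + c)) z.
Proof.
have sh : holomorphic_at (fun w => w + c) z.
  exact: (holomorphic_atD (@holomorphic_at_id z) (@holomorphic_at_cst c z)).
exact: (holomorphic_at_comp sh).
Qed.

End holomorphic_calculus.

(** * Maximum bound on circles and the identity theorem on a disc *)

Section identity_theorem.
Context {R : realType}.
Implicit Types (k h g : R[i] -> R[i]) (a b c z : R[i]).

Local Notation E := (expR 1 : R).
Let E2 : 2 <= E.
Proof. by rewrite /E (le_trans _ (expR_ge1Dx 1)). Qed.

(** Written through [cexp] so that a circle about [c] is the image of the vertical line of abscissa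
    [ln r]. *)
Let on_circle (c : R[i]) (r t : R) := c + cexp (ln r +i* t)%C.

Let on_circleP c r t : 0 < r -> cmod (on_circle c r t - c) = r.
Proof. by move=> r0; rewrite /on_circle addrC addKr cmod_cexp lnK. Qed.

(** The strip lemma asks for a margin of width 1 beyond [ln r], which after exponentiation is the
    factor [E] on the radius. *)
Let holo_on_circle k c r : 0 < r ->
  (forall z, cmod (z - c) < r * E -> holomorphic_at k z) ->
  forall x y, x < ln r + 1 ->
  holomorphic_at (fun w => k (c + cexp w)) (x +i* y)%C.
Proof.
move=> r0 hk x y xb.
have inner := holomorphic_atD (@holomorphic_at_cst R c _) (@holomorphic_cexp R (x +i* y)%C).
apply: (holomorphic_at_comp inner).
apply: hk; rewrite addrC addKr cmod_cexp /=.
by rewrite -[X in X * _]lnK// -expRD ltr_expR.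
Qed.

(** The two circles are the vertical sides of a rectangle of height 2 pi for the periodic function w
    -> k (c + exp w), to which [holomorphic_strip_Re] applies. *)
Lemma circle_Re k c (r' r : R) : 0 < r' -> r' < r ->
  (forall z, cmod (z - c) < r * E -> holomorphic_at k z) ->
  exists2 z, cmod (z - c) = r' & exists2 t, 0 <= t <= 2 * pi &
    complex.Re (k z) = complex.Re (k (on_circle c r t)).
Proof.
move=> r'0 r'r hk; have r0 : 0 < r by exact: lt_trans r'r.
have [||x y _ xb|x|t _ [t' t'T]] := @holomorphic_strip_Re R
    (fun w => k (c + cexp w)) (ln r') (ln r) (2 * pi).
- by rewrite ltr_ln ?posrE.
- by rewrite mulr_gt0// pi_gt0.
- by apply: (holo_on_circle r0 hk).
- by rewrite cexp_2pi.
by exists (on_circle c r' t); [exact: on_circleP|exists t'].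
Qed.

Lemma circle_bound k c (r : R) : 0 < r ->
  (forall z, cmod (z - c) < r * E -> holomorphic_at k z) ->
  exists2 M, 0 <= M & forall t, 0 <= t <= 2 * pi -> cmod (k (on_circle c r t)) <= M.
Proof.
move=> r0 hk; pose F w := k (c + cexp w).
have T0 : 0 <= 2 * pi :> R by rewrite mulr_ge0// pi_ge0.
have cont t : {for t, continuous (fun s => complex.Re (F (ln r +i* s)%C))} /\
    {for t, continuous (fun s => complex.Im (F (ln r +i* s)%C))}.
  apply: continuous_Re_Im; first by apply: (holo_on_circle r0 hk); rewrite ltrDl.
  move=> e e0; near=> s; rewrite (le_lt_trans (cmod_le_ReIm _))//= subrr normr0 add0r distrC.
  by near: s; move: e e0; apply/cvgrPdist_lt; exact: cvg_id.
have bnd (f : R -> R) : continuous f -> exists2 M, 0 <= M &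
    forall t, 0 <= t <= 2 * pi -> `|f t| <= M.
  move=> cf; have [|c0 _ Hc] := @EVT_max R (fun t => `|f t|) 0 (2 * pi) T0.
    by apply: continuous_subspaceT => t; apply: continuous_comp; [exact: cf|exact: norm_continuous].
  by exists `|f c0| => // t tT; apply: Hc; rewrite in_itv.
have [M1 M10 H1] := bnd _ (fun t => (cont t).1).
have [M2 M20 H2] := bnd _ (fun t => (cont t).2).
exists (M1 + M2); first exact: addr_ge0.
move=> t tT; rewrite (le_trans (cmod_le_ReIm _))// lerD//; [exact: H1|exact: H2].
Unshelve. all: by end_near. Qed.

(** Arbitrarily small circles about [c] contain a point where Re k is a value from the large circle;
    continuity at [c] does the rest. *)
Lemma mean_Re_le k c (r M : R) : 0 < r ->
  (forall z, cmod (z - c) < r * E -> holomorphic_at k z) ->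
  (forall t, 0 <= t <= 2 * pi -> cmod (k (on_circle c r t)) <= M) ->
  `|complex.Re (k c)| <= M.
Proof.
move=> r0 hk HM; apply/ler_addgt0Pr => e e0.
have [|k' Hk] := (holomorphic_atP k c).1.
  by apply: hk; rewrite subrr cmod0 mulr_gt0// expR_gt0.
have [d d0 Hd] := Hk 1 ltr01.
pose K := cmod k' + 1.
have K0 : 0 < K by rewrite /K ltr_wpDl// cmod_ge0.
(* Three demands: a circle inside the given one, validity of the derivative estimate, and
   [K * r' <= e] for the increment of [k]. *)
pose r' := Num.min (r / 2) (Num.min (d / 2) (e / K)).
have r'0 : 0 < r' by rewrite !lt_min !divr_gt0.
have r'r : r' < r by rewrite gt_min ltr_pdivrMr// mulr_natr mulr2n ltrDl r0.
have r'd : r' < d by rewrite !gt_min (_ : d / 2 < d) ?orbT// ltr_pdivrMr// mulr_natr mulr2n ltrDl.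
have r'e : r' <= e / K by rewrite !ge_min lexx !orbT.
have [z zc [t tT Et]] := circle_Re r'0 r'r hk.
have := HM t tT; move/(le_trans (Re_le_cmod _)); rewrite -Et => kz.
have := Hd (z - c); rewrite zc => /(_ r'd); rewrite mul1r subrKC => est.
have : cmod (k c - k z) <= e.
  rewrite cmodBC -(subrK (k' * (z - c)) (k z - k c)).
  rewrite (le_trans (cmodD _ _))// cmodM zc.
  rewrite ler_pdivlMr// /K in r'e; lra.
move/(le_trans (Re_le_cmod _)); rewrite raddfB => le2.
rewrite -(subrK (complex.Re (k z)) (complex.Re (k c))) addrC.
by rewrite (le_trans (ler_normD _ _))//; lra.
Qed.

(** The imaginary part is bounded by applying [mean_Re_le] to [k] times i. The resulting constant 2
    is harmless, because the bound is later used with a factor that tends to 0. *)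
Lemma mean_cmod_le k c (r M : R) : 0 < r ->
  (forall z, cmod (z - c) < r * E -> holomorphic_at k z) ->
  (forall t, 0 <= t <= 2 * pi -> cmod (k (on_circle c r t)) <= M) ->
  cmod (k c) <= 2 * M.
Proof.
move=> r0 hk HM; have h1 := mean_Re_le r0 hk HM.
have := @mean_Re_le (fun z => k z * 'i%C) c r M r0 _ _.
rewrite ReiNIm normrN => h2.
rewrite (le_trans (cmod_le_ReIm _))// mulr_natl mulr2n lerD//; apply: h2.
  by move=> z zr; apply: holomorphic_atM; [exact: hk|exact: holomorphic_at_cst].
by move=> t tT; rewrite cmodM cmod_i mulr1; exact: HM.
Qed.

(* [k / (z - b) ^+ m] is holomorphic and vanishes near [b]; comparing its value
   at [c] with its values on a circle around [c] on which [b] is further away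
   than [c], and letting [m] grow, kills [k c]. *)
Lemma identity_near k b (rho eta : R) : 0 < eta ->
  (forall z, cmod (z - b) < rho -> holomorphic_at k z) ->
  (forall z, cmod (z - b) < eta -> k z = 0) ->
  forall c, cmod (c - b) < rho / (8 * E) -> k c = 0.
Proof.
move=> eta0 hk k0 c cb.
have E0 : 0 < E by exact: expR_gt0.
(* Then r * E = rho / 2, and since [d < r / 4] the disc of radius r * E about [c] stays in the disc
   of radius [rho] about [b]. *)
pose r := rho / (2 * E); pose d := cmod (c - b).
have d0 : 0 <= d := cmod_ge0 _.
have E8 : rho / (8 * E) = r / 4.
  by rewrite /r; field; rewrite gt_eqF.
rewrite E8 -/d in cb.
have r0 : 0 < r by lra.
have Er : r * E = rho / 2 by rewrite /r; field; rewrite gt_eqF.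
have rho_r : 4 * r <= rho.
  have : r * E >= r * 2 by rewrite ler_pM2l. by rewrite Er; lra.
have [db0|dn0] := eqVneq d 0.
  by apply: k0; rewrite -/d db0.
have dp : 0 < d by rewrite lt_def dn0 d0.
have hkc z : cmod (z - c) < r * E -> cmod (z - b) < rho.
  move=> zc; rewrite (_ : z - b = (z - c) + (c - b)); last by ring.
  by rewrite (le_lt_trans (cmodD _ _))// -/d; lra.
have [M M0 HM] := circle_bound r0 (fun z zc => hk z (hkc z zc)).
have rd : 0 < r - d by lra.
have bound m : cmod (k c) <= 2 * M * (d / (r - d)) ^+ m.
  pose km z := k z / (z - b) ^+ m.
  have hkm z : cmod (z - c) < r * E -> holomorphic_at km z.
    (* At [b] no cancellation of the denominator is required: the numerator vanishes identically
       around [b], hence so does the quotient. *)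
    move=> zc; have [->|zb] := eqVneq z b.
      apply: (@holomorphic_at_near _ (fun=> 0)); last exact: holomorphic_at_cst.
      apply/near_cmodP; exists eta => // w wb; by rewrite /km k0// mul0r.
    apply: holomorphic_atM; first by apply: hk; exact: hkc.
    apply: (@holomorphic_atV _ (fun z => (z - b) ^+ m)).
      by rewrite expf_neq0// subr_eq0.
    apply: (@holomorphic_atX _ (fun z => z - b)); apply: holomorphic_atD.
      exact: holomorphic_at_id.
    exact: holomorphic_at_cst.
  have := @mean_cmod_le km c r (M / (r - d) ^+ m) r0 hkm.
  have H t : 0 <= t <= 2 * pi -> cmod (km (on_circle c r t)) <= M / (r - d) ^+ m.
    move=> tT; rewrite /km cmodM cmodV cmodX ler_pM ?cmod_ge0 ?invr_ge0 ?exprn_ge0 ?cmod_ge0//.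
      exact: HM.
    have far : r - d <= cmod (on_circle c r t - b).
      have := on_circleP c t r0.
      rewrite (_ : on_circle c r t - c = (on_circle c r t - b) + (b - c)); last by ring.
      move=> e1; have := cmodD (on_circle c r t - b) (b - c); rewrite e1 (cmodBC b) -/d; lra.
    rewrite lef_pV2 ?posrE ?exprn_gt0//; last by lra.
    by rewrite lerXn2r ?nnegrE// ?ltW//; lra.
  move=> /(_ H); rewrite /km cmodM cmodV cmodX -/d ler_pdivrMr ?exprn_gt0//.
  by rewrite expr_div_n; move/le_trans; apply; rewrite le_eqVlt; apply/orP; left; apply/eqP; ring.
apply/eqP; rewrite -cmod_eq0 eq_le cmod_ge0 andbT.
(* From [d < r / 4] the ratio [d / (r - d)] is less than 1, so its powers tend to 0. *)
have : (2 * M * (d / (r - d)) ^+ m) @[m --> \oo] --> (2 * M * 0 : R).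
  apply: cvgMr; apply: cvg_expr.
  by rewrite ger0_norm ?divr_ge0 ?ltW// ltr_pdivrMr// mul1r; lra.
rewrite mulr0 => cv.
rewrite -(cvg_lim _ cv)//; apply: limr_ge; first by apply/cvg_ex; exists 0.
by near=> m; exact: bound.
Unshelve. all: by end_near. Qed.

End identity_theorem.

(** * Identity theorem for meromorphic functions *)

Section meromorphic_identity.
Context {R : realType}.
Implicit Types (k h g : R[i] -> R[i]) (a b c z : R[i]).

Local Notation E := (expR 1 : R).
Let E2 : 2 <= E.
Proof. by rewrite /E (le_trans _ (expR_ge1Dx 1)). Qed.

Definition meromorphic_at h a := exists N g,
  (\forall z \near (a : R[i]^o), holomorphic_at g z) /\
  \forall z \near (a : R[i]^o)^', h z = g z / (z - a) ^+ N.

(** Around [p] the function is a holomorphic numerator [g] over a power. Vanishing near [q] kills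
    [g] on a small disc close to [q], [identity_near] spreads this over a whole disc about [p], and
    so to [q'], even if one of these points is a pole. *)
Lemma meromorphic_at_local_zero h p : meromorphic_at h p ->
  exists2 dl : R, 0 < dl & forall q q', cmod (q - p) < dl -> cmod (q' - p) < dl ->
    (\forall z \near (q : R[i]^o)^', h z = 0) ->
    \forall z \near (q' : R[i]^o)^', h z = 0.
Proof.
move=> [N [g [/near_cmodP[r1 r10 hg] /dnbhs_cmodP[r2 r20 eg]]]].
pose rho := Num.min r1 r2.
have rho0 : 0 < rho by rewrite lt_min r10.
have E0 : 0 < E by exact: expR_gt0.
(* Chosen for [identity_near] with radius rho / 2 about a point [b] within 2 * dl of [p]: it yields
   a disc of radius 4 * dl about [b], which contains the disc of radius dl about [p]. *)
pose dl := rho / (64 * E).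
have dl0 : 0 < dl by rewrite divr_gt0// mulr_gt0.
have dlrho : 64 * dl <= rho.
  have -> : rho = 64 * dl * E by rewrite /dl; field; rewrite gt_eqF.
  by rewrite ler_peMr //; [lra|apply: le_trans E2; lra].
exists dl; first exact: dl0.
move=> q q' qp q'p.
move=> hnear; have [s s0 hq] := (dnbhs_cmodP q (fun z => h z = 0)).1 hnear.
have [b [eta [eta0 bp gb]]] : exists b eta, [/\ (0 : R) < eta, cmod (b - p) < 2 * dl &
    forall z, cmod (z - b) < eta -> g z = 0].
  pose m := Num.min s dl.
  have m0 : 0 < m by rewrite lt_min s0.
  have ms : m <= s by rewrite ge_min lexx.
  have md : m <= dl by rewrite ge_min lexx orbT.
  have pick (u : R) : 0 < u -> u <= m / 2 -> q + u%:C%C != p ->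
      exists b eta, [/\ (0 : R) < eta, cmod (b - p) < 2 * dl &
        forall z, cmod (z - b) < eta -> g z = 0].
    move=> u0 um np; pose b := q + u%:C%C.
    have bq : cmod (b - q) = u by rewrite /b addrC addKr cmod_real gtr0_norm.
    have bp : cmod (b - p) < 2 * dl.
      rewrite (_ : b - p = (b - q) + (q - p)); last by ring.
      by rewrite (le_lt_trans (cmodD _ _))// bq; lra.
    have bp0 : 0 < cmod (b - p) by rewrite cmod_gt0 subr_eq0.
    exists b, (Num.min u (Num.min (cmod (b - p)) dl)); split => //.
      by rewrite !lt_min u0 bp0.
    move=> z; rewrite !lt_min => /and3P[zu zp zd].
    have zq : z != q.
      by apply: contraTneq zu => ->; rewrite cmodBC bq ltxx.
    have znp : z != p.
      by apply: contraTneq zp => ->; rewrite cmodBC ltxx.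
    have : cmod (z - q) < s.
      rewrite (_ : z - q = (z - b) + (b - q)); last by ring.
      by rewrite (le_lt_trans (cmodD _ _))// bq; lra.
    move=> /(hq z zq) hz.
    have : cmod (z - p) < r2.
      rewrite (_ : z - p = (z - b) + (b - p)); last by ring.
      have : rho <= r2 by rewrite ge_min lexx orbT.
      by move=> ?; rewrite (le_lt_trans (cmodD _ _))//; lra.
    move=> /(eg z znp); rewrite hz => /esym/eqP.
    by rewrite mulf_eq0 invr_eq0 expf_eq0 subr_eq0 (negPf znp) andbF orbF => /eqP.
  (* The centre must differ from [p], where [g] is not read off from [h]. Of the two candidates q +
     m / 2 and q + m / 3 at most one equals [p]. *)
  have [e1|n1] := eqVneq (q + (m / 2)%:C%C) p; last by apply: pick n1; lra.
  apply: (pick (m / 3)); [lra|lra|].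
  apply/negP => /eqP e2; have : m / 2 = m / 3 by apply: complexI; apply: (addrI q); rewrite e1 e2.
  by lra.
have gz z : cmod (z - p) < dl -> g z = 0.
  move=> zp; apply: (@identity_near R g b (rho / 2) eta eta0 _ gb).
    move=> w wb; apply: hg; rewrite (_ : w - p = (w - b) + (b - p)); last by ring.
    have : rho <= r1 by rewrite ge_min lexx.
    by move=> ?; rewrite (le_lt_trans (cmodD _ _))//; lra.
  have -> : rho / 2 / (8 * E) = 4 * dl by rewrite /dl; field; rewrite gt_eqF.
  rewrite (_ : z - b = (z - p) + (p - b)); last by ring.
  by rewrite (le_lt_trans (cmodD _ _))// (cmodBC p); lra.
apply/dnbhs_cmodP.
have hz z : z != p -> cmod (z - p) < dl -> h z = 0.
  move=> zp zd; rewrite eg// ?gz ?mul0r//.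
  have : rho <= r2 by rewrite ge_min lexx orbT.
  by lra.
(* The value of [h] at [p] itself is not controlled, so for [q'] other than [p] the neighbourhood is
   shrunk to miss [p]. *)
have [->|q'np] := eqVneq q' p; first by exists dl.
have q'p0 : 0 < cmod (q' - p) by rewrite cmod_gt0 subr_eq0.
exists (Num.min (cmod (q' - p)) (dl - cmod (q' - p))).
  by rewrite lt_min q'p0 subr_gt0.
move=> z _; rewrite lt_min => /andP[z1 z2]; apply: hz.
  by apply: contraTneq z1 => ->; rewrite cmodBC ltxx.
rewrite (_ : z - p = (z - q') + (q' - p)); last by ring.
by rewrite (le_lt_trans (cmodD _ _))//; lra.
Qed.

(** Connectedness along the ray a + t, t >= 0, which ends up in the half-plane of vanishing: the set
    of good parameters is pushed down past its infimum by [meromorphic_at_local_zero]. *)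
Lemma meromorphic_identity h (x0 : R) : (forall a, meromorphic_at h a) ->
  (forall z, x0 < complex.Re z -> h z = 0) ->
  forall a, \forall z \near (a : R[i]^o)^', h z = 0.
Proof.
move=> mh h0 a.
pose B (t : R) := \forall z \near ((a + t%:C%C : R[i]) : R[i]^o)^', h z = 0.
pose S := [set s : R | 0 <= s /\ forall t, s <= t -> B t].
suff [_ /(_ 0 (lexx _))] : S 0 by rewrite /B addr0.
have far t : x0 - complex.Re a < t -> B t.
  move=> xt; apply/dnbhs_cmodP; exists (complex.Re a + t - x0); first lra.
  move=> z _ zr; apply: h0.
  have := le_lt_trans (Re_le_cmod _) zr; rewrite raddfB raddfD /= => /ltr_normlP[]; lra.
have S1 : S (Num.max 0 (x0 - complex.Re a + 1)).
  split; first by rewrite le_max lexx.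
  by move=> t; rewrite ge_max => /andP[_ ?]; apply: far; lra.
have lbS : has_lbound S by exists 0 => s [].
have infS : has_inf S by split => //; eexists; exact: S1.
pose t0 := inf S.
have t00 : 0 <= t0 by apply: lb_le_inf; [eexists; exact: S1|move=> s []].
have [dl dl0 loc] := meromorphic_at_local_zero (mh (a + t0%:C%C)).
have [s Ss st0] := inf_adherent dl0 infS; rewrite -/t0 in st0.
have t0s : t0 <= s by apply: ge_inf.
have close t : cmod (a + t%:C%C - (a + t0%:C%C)) = `|t - t0|.
  by rewrite opprD addrACA subrr add0r -raddfB cmod_real.
have Bnear t : `|t - t0| < dl -> B t.
  move=> tt0; apply: (loc (a + s%:C%C)); rewrite ?close//.
    by rewrite ger0_norm ?subr_ge0//; lra.
  exact: Ss.2.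
(* If [t0] were positive this element of [S] would lie below the infimum; hence [t0 <= 0] and the
   maximum is 0. *)
have S2 : S (Num.max 0 (t0 - dl / 2)).
  split; first by rewrite le_max lexx.
  move=> t; rewrite ge_max => /andP[t0' tt].
  have [st|ts] := leP s t; first exact: Ss.2.
  by apply: Bnear; rewrite ltr_norml; apply/andP; split; lra.
have := ge_inf lbS S2; rewrite -/t0 le_max => /orP[t0le|]; last by lra.
by move: S2; rewrite (max_idPl _)//; lra.
Qed.

End meromorphic_identity.
(** * Integration by parts on R^n *)

Section integral_line.
Context {R : realType}.
Local Notation mu := (@lebesgue_measure R).

(** Nonnegativity of [h] permits monotone convergence over the intervals [-n, n], on each of which
    the fundamental theorem of calculus applies. *)
Lemma ge0_integral_derivative (H h : R -> R) (L : R) :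
  (forall x : R, is_derive x 1 H (h x)) -> continuous h -> (forall x, 0 <= h x) ->
  H n%:R - H (- n%:R) @[n --> \oo] --> L ->
  (\int[mu]_x (h x)%:E)%E = L%:E.
Proof.
move=> dH ch h0 HL.
have cH : continuous H.
  by move=> x; apply/differentiable_continuous/derivable1_diffP;
    exact: (@ex_derive _ _ _ _ _ _ _ (dH x)).
pose F (n : nat) := `[- n%:R, n%:R]%classic : set R.
have FT : \bigcup_n F n = setT.
  apply/seteqP; split => // x _; exists (Num.bound `|x|) => //.
  by have := archi_boundP (normr_ge0 x); rewrite /F /= in_itv /= -ler_norml => /ltW.
have FTC n : (\int[mu]_(x in F n) (h x)%:E)%E = (H n%:R - H (- n%:R))%:E.
  case: n => [|n].
    by rewrite /F oppr0 set_itv1 integral_set1 subrr.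
  rewrite EFinB; apply: continuous_FTC2.
  - by rewrite -subr_gt0 opprK -natrD ltr0n.
  - by apply: continuous_subspaceT => x; exact: ch.
  - split.
    + by move=> x _; exact: (@ex_derive _ _ _ _ _ _ _ (dH x)).
    + by apply: cvg_at_right_filter; exact: cH.
    + by apply: cvg_at_left_filter; exact: cH.
  - by move=> x _; rewrite derive1E; exact: (@derive_val _ _ _ _ _ _ _ (dH x)).
have : (\int[mu]_(x in F n) (h x)%:E)%E @[n --> \oo] -->
       (\int[mu]_(x in \bigcup_n F n) (h x)%:E)%E.
  apply: ge0_nondecreasing_set_cvg_integral.
  - move=> n m nm; apply/subsetPset => x; rewrite /F /= !in_itv /= => /andP[h1 h2].
    have nm' : n%:R <= m%:R :> R by rewrite ler_nat.
    by apply/andP; split; lra.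
  - by move=> n; exact: measurable_itv.
  - move=> n; apply/measurable_EFinP; apply: measurable_funTS.
    exact: continuous_measurable_fun.
  - by move=> n x _; rewrite lee_fin.
rewrite FT => cv.
apply: (cvg_unique _ cv) => //.
rewrite (_ : (fun n => _) = fun n => (H n%:R - H (- n%:R))%:E); last exact/funext.
by apply: cvg_EFin HL; near=> n.
Unshelve. all: by end_near. Qed.

Lemma cvg_atan_diff (K : R) :
  K * atan n%:R - K * atan (- n%:R) @[n --> \oo] --> K * pi.
Proof.
rewrite (_ : (fun n => _) = fun n : nat => (K + K) * atan n%:R); last first.
  by apply/funext => n; rewrite atanN; ring.
rewrite (_ : K * pi = (K + K) * (pi / 2)); last by field.
apply: cvgMr.
apply: (cvg_comp (fun n : nat => n%:R : R) atan); first exact: cvgr_idn.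
exact: cvgy_atan.
Qed.

Lemma integral_oneDsqrV (K : R) : 0 <= K ->
  (\int[mu]_x (K * (oneDsqr x)^-1)%:E)%E = (K * pi)%:E.
Proof.
move=> K0; apply: (ge0_integral_derivative (H := fun y => K * atan y)); last exact: cvg_atan_diff.
- by move=> x; apply: cvgMr; exact: continuous_oneDsqrV.
- by move=> x; rewrite mulr_ge0// invr_ge0 (le_trans ler01)// oneDsqr_ge1.
Qed.

Lemma integrable_oneDsqrV_bound (g : R -> R) (K : R) : measurable_fun setT g ->
  (forall x, `|g x| <= K * (oneDsqr x)^-1) -> mu.-integrable setT (EFin \o g).
Proof.
move=> mg gK.
have K0 : 0 <= K.
  have := gK 0; rewrite /oneDsqr expr0n addr0 invr1 mulr1.
  by apply: le_trans.
have mw : measurable_fun setT (fun x => K * (oneDsqr x)^-1).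
  apply: continuous_measurable_fun => x.
  by apply: cvgMr; exact: continuous_oneDsqrV.
have w0 x : 0 <= K * (oneDsqr x)^-1 :> R.
  by rewrite mulr_ge0// invr_ge0 (le_trans ler01)// oneDsqr_ge1.
apply: (@le_integrable _ _ _ mu setT measurableT _ (EFin \o (fun x => K * (oneDsqr x)^-1))).
- exact/measurable_EFinP.
- by move=> x _ /=; rewrite lee_fin (ger0_norm (w0 x)).
apply/integrableP; split; first exact/measurable_EFinP.
under eq_integral do rewrite gee0_abs ?lee_fin//.
by rewrite integral_oneDsqrV// ltry.
Qed.

(** Adding K / (1 + x^2) makes the integrand nonnegative with antiderivative f + K arctan, whose
    total increment is K pi because [f] tends to 0 at both ends; the added integral is then
    subtracted. *)
Lemma integral_derivative0 (f g : R -> R) (K : R) :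
  (forall x : R, is_derive x 1 f (g x)) -> continuous g ->
  (forall x, `|f x| <= K * (oneDsqr x)^-1) ->
  (forall x, `|g x| <= K * (oneDsqr x)^-1) ->
  (\int[mu]_x (g x)%:E)%E = 0%E.
Proof.
move=> df cg fK gK.
have K0 : 0 <= K.
  have := gK 0; rewrite /oneDsqr expr0n addr0 invr1 mulr1.
  by apply: le_trans.
have mg : measurable_fun setT g by apply: continuous_measurable_fun.
have ig := integrable_oneDsqrV_bound mg gK.
have cw : continuous (fun x : R => K * (oneDsqr x)^-1).
  by move=> x; apply: cvgMr; exact: continuous_oneDsqrV.
have w0 x : 0 <= K * (oneDsqr x)^-1 :> R.
  by rewrite mulr_ge0// invr_ge0 (le_trans ler01)// oneDsqr_ge1.
have iw : mu.-integrable setT (EFin \o (fun x => K * (oneDsqr x)^-1)).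
  apply: (@integrable_oneDsqrV_bound _ K); first exact: continuous_measurable_fun.
  by move=> x; rewrite ger0_norm.
have f0 (u : nat -> R) : (forall n, `|u n| = n%:R) -> f (u n) @[n --> \oo] --> (0 : R).
  move=> un; apply/cvgr0Pnorm_le => e e0; near=> n.
  rewrite (le_trans (fK _))// /oneDsqr -real_normK ?num_real// un.
  rewrite ler_pdivrMr ?ltr_wpDr ?exprn_ge0//.
  have Kn : K / e <= n%:R by near: n; exact: nbhs_infty_ger.
  rewrite ler_pdivrMr// mulrC in Kn.
  have : n%:R <= 1 + n%:R ^+ 2 :> R.
    have := sqr_ge0 (n%:R - 1 : R); rewrite sqrrB1.
    by have := ler0n R n; nra.
  by rewrite -(ler_pM2l e0); apply: le_trans.
have : (\int[mu]_x (g x + K * (oneDsqr x)^-1)%:E)%E = (K * pi)%:E.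
  apply: (@ge0_integral_derivative (fun x => f x + K * atan x)).
  - by move=> x; apply: cvgD; [exact: cg|exact: cw].
  - by move=> x; have := gK x; rewrite ler_norml => /andP[+ _]; rewrite lerNl -subr_ge0 opprK addrC.
  - rewrite (_ : (fun n : nat => _) = fun n : nat => 
        (f n%:R - f (- n%:R)) + (K * atan n%:R - K * atan (- n%:R))); last first.
      by apply/funext => n; ring.
    rewrite -[K * pi]add0r; apply: cvgD; last exact: cvg_atan_diff.
    rewrite -[0]subr0; apply: cvgB.
      by apply: (f0 (fun n => n%:R)) => n; rewrite normr_nat.
    by apply: (f0 (fun n => - n%:R)) => n; rewrite normrN normr_nat.
under eq_integral do rewrite EFinD.
rewrite integralD//= (integral_oneDsqrV K0).
have /fineK <- := integrable_fin_num measurableT ig.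
by rewrite -EFinD => -[] /eqP; rewrite -subr_eq0 addrK => /eqP ->.
Unshelve. all: by end_near. Qed.

End integral_line.

(** * An integrable product weight and Fubini on tuples *)

Section tuple_weight.
Context {R : realType}.
Local Notation RT := (measurableTypeR R).
Local Notation mu n := (lebesgue_tuple R n).
Local Notation leb := (@lebesgue_measure R).

(** A majorant that factors over the coordinates, so that a bound by it passes to slices with a new
    constant. *)
Definition tuple_weight n (t : n.-tuple RT) : R :=
  \prod_(i < n) (oneDsqr (tnth t i : R))^-1.

Lemma oneDsqr_gt0 (x : R) : 0 < oneDsqr x.
Proof. by rewrite (lt_le_trans ltr01)// oneDsqr_ge1. Qed.

Lemma tuple_weight_ge0 n (t : n.-tuple RT) : 0 <= tuple_weight t.
Proof. by apply: prodr_ge0 => i _; rewrite invr_ge0 ltW// oneDsqr_gt0. Qed.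

Lemma tuple_weight_cons n (x : RT) (t : n.-tuple RT) :
  tuple_weight (tuple_cons (x, t)) = (oneDsqr (x : R))^-1 * tuple_weight t.
Proof.
rewrite /tuple_weight big_ord_recl /tuple_cons tnth0; congr (_ * _).
by apply: eq_bigr => i _; rewrite tnthS.
Qed.

Lemma measurable_tuple_weight n : measurable_fun setT (@tuple_weight n).
Proof.
apply: measurable_prod => i _.
have mw : measurable_fun setT (fun x : R => (oneDsqr x)^-1).
  by apply: continuous_measurable_fun => x; exact: continuous_oneDsqrV.
exact: (measurableT_comp mw (measurable_tnth i)).
Qed.

Lemma measurable_tuple_consR n :
  measurable_fun [set: RT * n.-tuple RT] (@tuple_cons R n).
Proof. exact: measurable_tuple_cons. Qed.

Lemma ge0_integral_tuple_cons n (f : n.+1.-tuple RT -> \bar R) :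
  measurable_fun setT f -> (forall t, 0 <= f t)%E ->
  (\int[mu n.+1]_t f t = \int[(leb \x mu n)%E]_z f (tuple_cons z))%E.
Proof.
move=> mf f0.
have := @ge0_integral_pushforward _ _ _ _ R (@tuple_cons R n)
  (@measurable_tuple_consR n) (leb \x mu n)%E setT f measurableT mf (fun t _ => f0 t).
by rewrite preimage_setT.
Qed.

Lemma integral_tuple_weight_lty n : (\int[mu n]_t (tuple_weight t)%:E < +oo)%E.
Proof.
elim: n => [|n IH].
  rewrite /= integral_dirac//; last by apply/measurable_EFinP; exact: measurable_tuple_weight.
  by rewrite diracT mul1e ltry.
rewrite ge0_integral_tuple_cons; last 2 first.
  by apply/measurable_EFinP; exact: measurable_tuple_weight.
  by move=> t; rewrite lee_fin tuple_weight_ge0.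
have mz : measurable_fun setT (fun z : RT * n.-tuple RT => (tuple_weight (tuple_cons z))%:E).
  apply/measurable_EFinP; apply: measurableT_comp; first exact: measurable_tuple_weight.
  exact: measurable_tuple_consR.
rewrite fubini_tonelli1; [|exact: mz|by move=> z; rewrite lee_fin tuple_weight_ge0].
rewrite /fubini_F /=.
have w0 (x : R) : 0 <= (oneDsqr x)^-1 by rewrite invr_ge0 ltW// oneDsqr_gt0.
have E (x : R) : (\int[mu n]_y (tuple_weight (tuple_cons (x, y)))%:E =
    (oneDsqr x)^-1%:E * \int[mu n]_y (tuple_weight y)%:E)%E.
  under eq_integral do rewrite tuple_weight_cons EFinM.
  rewrite ge0_integralZl//; first by apply/measurable_EFinP; exact: measurable_tuple_weight.
  by move=> t _; rewrite lee_fin tuple_weight_ge0.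
under eq_integral do rewrite E.
have I0 : (0 <= \int[mu n]_y (tuple_weight y)%:E)%E.
  by apply: integral_ge0 => t _; rewrite lee_fin tuple_weight_ge0.
have /fineK <- : (\int[mu n]_y (tuple_weight y)%:E)%E \is a fin_num.
  by rewrite ge0_fin_numE.
set K := fine _.
have K0 : 0 <= K by exact: fine_ge0.
under eq_integral do rewrite -EFinM mulrC.
by rewrite integral_oneDsqrV// ltry.
Qed.

Lemma integrable_tuple_weight n (f : n.-tuple RT -> R) (K : R) : measurable_fun setT f ->
  (forall t, `|f t| <= K * tuple_weight t) -> (mu n).-integrable setT (EFin \o f).
Proof.
move=> mf fK.
have mw : measurable_fun setT (fun t : n.-tuple RT => `|K| * tuple_weight t).
  by apply: measurable_funM => //; exact: measurable_tuple_weight.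
apply: (@le_integrable _ _ _ (mu n) setT measurableT _ (EFin \o (fun t => `|K| * tuple_weight t))).
- exact/measurable_EFinP.
- move=> t _ /=; rewrite lee_fin (le_trans (fK t))//.
  by rewrite ger0_norm ?mulr_ge0 ?tuple_weight_ge0// ler_wpM2r ?tuple_weight_ge0// ler_norm.
apply: (@eq_integrable _ _ _ (mu n) setT measurableT
  (fun t => `|K|%:E * (tuple_weight t)%:E)%E) => //.
apply: integrableZl => //; apply/integrableP; split.
  by apply/measurable_EFinP; exact: measurable_tuple_weight.
under eq_integral do rewrite gee0_abs ?lee_fin ?tuple_weight_ge0//.
exact: integral_tuple_weight_lty.
Qed.

(** Both orders of integration serve in [integral_partial_eq0]: coordinate 0 outermost for the
    induction, innermost when the derivative is taken in that coordinate. *)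
Lemma integral_tuple_cons n (f : n.+1.-tuple RT -> R) (K : R) : measurable_fun setT f ->
  (forall t, `|f t| <= K * tuple_weight t) ->
  [/\ (leb \x mu n)%E.-integrable setT (fun z => (f (tuple_cons z))%:E),
    (\int[mu n.+1]_t (f t)%:E = \int[leb]_x \int[mu n]_t (f (tuple_cons (x, t)))%:E)%E &
    (\int[mu n.+1]_t (f t)%:E = \int[mu n]_t \int[leb]_x (f (tuple_cons (x, t)))%:E)%E].
Proof.
move=> mf fK.
have mfc : measurable_fun setT (fun z : RT * n.-tuple RT => (f (tuple_cons z))%:E).
  apply/measurable_EFinP; apply: measurableT_comp => //.
  exact: measurable_tuple_consR.
have If : (leb \x mu n)%E.-integrable setT (fun z => (f (tuple_cons z))%:E).
  apply/integrableP; split => //.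
  have := integrable_tuple_weight mf fK => /integrableP[_].
  rewrite ge0_integral_tuple_cons//.
  by apply: measurableT_comp => //; exact/measurable_EFinP.
have E1 : (\int[mu n.+1]_t (f t)%:E = \int[(leb \x mu n)%E]_z (f (tuple_cons z))%:E)%E.
  have := @integral_pushforward _ _ _ _ R (@tuple_cons R n)
    (@measurable_tuple_consR n) (leb \x mu n)%E setT (EFin \o f).
  by rewrite preimage_setT => -> //; exact/measurable_EFinP.
split => //.
- by rewrite E1 -integral12_prod_meas1.
- rewrite E1 -integral12_prod_meas1// (Fubini If)//.
Qed.

End tuple_weight.

(** * The integral of a partial derivative vanishes *)

Section tuple_divergence.
Context {R : realType}.
Local Notation RT := (measurableTypeR R).
Local Notation mu n := (lebesgue_tuple R n).
Local Notation leb := (@lebesgue_measure R).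

Definition tuple_upd n (k : 'I_n) (s : R) (t : n.-tuple RT) : n.-tuple RT :=
  [tuple if i == k then s else tnth t i | i < n].

Lemma tuple_upd0 n s (x : RT) (t : n.-tuple RT) :
  tuple_upd ord0 s (tuple_cons (x, t)) = tuple_cons (s : RT, t).
Proof.
apply: eq_from_tnth => i; rewrite tnth_mktuple.
case: (unliftP ord0 i) => [j ->|->]; last by rewrite eqxx tnth0.
by rewrite eq_sym (negPf (neq_lift _ _)) !tnthS.
Qed.

Lemma tuple_upd_lift n (k : 'I_n) s (x : RT) (t : n.-tuple RT) :
  tuple_upd (lift ord0 k) s (tuple_cons (x, t)) = tuple_cons (x, tuple_upd k s t).
Proof.
apply: eq_from_tnth => i; rewrite tnth_mktuple.
case: (unliftP ord0 i) => [j ->|->].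
  by rewrite (inj_eq lift_inj) !tnthS tnth_mktuple.
by rewrite (negPf (neq_lift _ _)) !tnth0.
Qed.

(** Induction on the dimension. For [k = 0] the inner integral over coordinate 0 vanishes by
    [integral_derivative0]; otherwise coordinate 0 is frozen at x and the induction hypothesis
    applies with constant K / (1 + x^2). *)
Lemma integral_partial_eq0 n (k : 'I_n) (F G : n.-tuple RT -> R) (K : R) :
  measurable_fun setT G ->
  (forall t, `|F t| <= K * tuple_weight t) ->
  (forall t, `|G t| <= K * tuple_weight t) ->
  (forall t (s : R), is_derive s 1 (fun s => F (tuple_upd k s t) : R) (G (tuple_upd k s t))) ->
  (forall t, continuous (fun s : R => G (tuple_upd k s t) : R)) ->
  (\int[mu n]_t (G t)%:E)%E = 0%E.
Proof.
elim: n k F G K => [[]//|n IH] k F G K mG FK GK dF cG.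
have [_ Exy Eyx] := integral_tuple_cons mG GK.
case: (unliftP ord0 k) => [k' Ek|Ek]; rewrite Ek in dF cG.
  rewrite Exy; apply: integral0_eq => x _.
  have bnd (H : n.+1.-tuple RT -> R) : (forall t, `|H t| <= K * tuple_weight t) ->
      forall t, `|H (tuple_cons (x, t))| <= K * (oneDsqr (x : R))^-1 * tuple_weight t.
    by move=> HK t; rewrite -mulrA -tuple_weight_cons.
  apply: (IH k' (fun t => F (tuple_cons (x, t))) (fun t => G (tuple_cons (x, t)))
    (K * (oneDsqr (x : R))^-1)).
  - apply: measurableT_comp => //.
    apply: (measurableT_comp (@measurable_tuple_consR _ _)).
    exact: measurable_pair1.
  - exact: bnd.
  - exact: bnd.
  - move=> t s; have := dF (tuple_cons (x, t)) s; rewrite tuple_upd_lift.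
    by under [X in is_derive _ _ X]eq_fun do rewrite tuple_upd_lift.
  - move=> t; have := cG (tuple_cons (x, t)).
    by under [X in continuous X]eq_fun do rewrite tuple_upd_lift.
rewrite Eyx; apply: integral0_eq => t _.
have bnd (H : n.+1.-tuple RT -> R) : (forall t, `|H t| <= K * tuple_weight t) ->
    forall x : R, `|H (tuple_cons (x : RT, t))| <= K * tuple_weight t * (oneDsqr x)^-1.
  by move=> HK x; rewrite (le_trans (HK _))// tuple_weight_cons mulrAC mulrA.
apply: (@integral_derivative0 _ (fun x : R => F (tuple_cons (x : RT, t)))
  (fun x : R => G (tuple_cons (x : RT, t))) (K * tuple_weight t)).
- move=> x; have := dF (tuple_cons (x : RT, t)) x; rewrite tuple_upd0.
  by under [X in is_derive _ _ X]eq_fun do rewrite tuple_upd0.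
- have := cG (tuple_cons (0 : RT, t)).
  by under [X in continuous X]eq_fun do rewrite tuple_upd0.
- exact: bnd.
- exact: bnd.
Qed.

End tuple_divergence.

(** * Measurability of continuous functions of the coordinates *)

Section row_measurable.
Context {R : realType}.
Local Notation RT := (measurableTypeR R).

Definition tuple_row n (t : n.-tuple RT) : 'rV[R]_n := \row_k tnth t k.

(** The function is the pointwise limit of its values at the grid points obtained by rounding each
    coordinate down to a multiple of 1 / (m + 1); such an approximation is constant on each of
    countably many boxes. *)
Lemma measurable_comp_tuple_row n (f : 'rV[R]_n -> R) : continuous f ->
  measurable_fun setT (fun t : n.-tuple RT => f (tuple_row t)).
Proof.
move=> cf.
pose dsc (m : nat) (z : n.-tuple int) : 'rV[R]_n := \row_k ((tnth z k)%:~R / m.+1%:R).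
pose fl (m : nat) (t : n.-tuple RT) : n.-tuple int :=
  [tuple Num.floor ((tnth t k : R) * m.+1%:R) | k < n].
apply: (@measurable_fun_cvg _ _ _ _ (fun m t => f (dsc m (fl m t)))).
  move=> m _ B mB; rewrite setTI.
  rewrite (_ : _ @^-1` _ = \bigcup_(z : n.-tuple int)
     (if f (dsc m z) \in B then [set t | fl m t = z] else set0)); last first.
    apply/seteqP; split => t /=.
      by move=> Bt; exists (fl m t) => //; rewrite mem_set.
    by move=> [z _]; case: ifPn => // /set_mem Bz /= ->.
  apply: countable_bigcupT_measurable; first exact: countableP.
  move=> z; case: ifP => // _.
  (* Prescribing all the floors cuts out a finite intersection of half-open slabs. *)
  rewrite (_ : [set t | _] = \bigcap_(k in [set: 'I_n])
    ((fun t : n.-tuple RT => (tnth t k : R) * m.+1%:R) @^-1`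
      `[(tnth z k)%:~R, (tnth z k + 1)%:~R[)); last first.
    apply/seteqP; split => t /=.
      by move=> <- k _ /=; rewrite tnth_mktuple in_itv /= floor_itv.
    move=> H; apply: eq_from_tnth => k; rewrite tnth_mktuple.
    by apply: floor_def; have := H k I; rewrite /= in_itv.
  apply: fin_bigcap_measurable => // k _.
  rewrite -[X in measurable X]setTI.
  have mk : measurable_fun setT (fun t : n.-tuple RT => (tnth t k : R) * m.+1%:R).
    by apply: measurable_funM => //; exact: measurable_tnth.
  by apply: mk => //; exact: measurable_itv.
move=> t _; apply: (cvg_comp (fun m => dsc m (fl m t)) f); last exact: cf.
apply/cvg_ballP => e e0; near=> m; split => // i j.
rewrite !mxE tnth_mktuple /ball /=.
have m0 : 0 < m.+1%:R :> R by rewrite ltr0n.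
have me : e^-1 < m.+1%:R.
  have : e^-1 <= m%:R by near: m; exact: nbhs_infty_ger.
  by move/le_lt_trans; apply; rewrite ltr_nat.
set x := (tnth t j : R); have /andP[h1 h2] := floor_itv (x * m.+1%:R).
rewrite intrD in h2.
rewrite (_ : x - _ = (x * m.+1%:R - (Num.floor (x * m.+1%:R))%:~R) / m.+1%:R); last first.
  by field; rewrite addrC natr1 pnatr_eq0.
rewrite normrM normfV (gtr0_norm m0) ltr_pdivrMr// ger0_norm ?subr_ge0//.
apply: (@lt_trans _ _ 1); first by rewrite ltrBlDl.
by rewrite -ltr_pdivrMl// mulr1.
Unshelve. all: by end_near. Qed.

End row_measurable.

(** * Complex integrals of dominated functions on R^n *)

Section row_integral.
Context {R : realType} {n : nat}.
Local Notation RT := (measurableTypeR R).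
Local Notation mu := (lebesgue_tuple R n).
Local Notation Rn := ('rV[R]_n).
Implicit Types (F G H : Rn -> R[i]) (k : 'I_n).

Definition row_weight (x : Rn) : R := \prod_(k < n) (oneDsqr (x ord0 k))^-1.

Lemma tuple_weightE (t : n.-tuple RT) : tuple_weight t = row_weight (tuple_row t).
Proof. by apply: eq_bigr => i _; rewrite mxE. Qed.

Lemma row_weight_ge0 (x : Rn) : 0 <= row_weight x.
Proof. by apply: prodr_ge0 => i _; rewrite invr_ge0 ltW// oneDsqr_gt0. Qed.

Lemma tuple_row_upd k (s : R) (t : n.-tuple RT) :
  tuple_row (tuple_upd k s t) = s *: basis_vec R k + tuple_row (tuple_upd k 0 t).
Proof.
apply/rowP => i; rewrite !mxE !tnth_mktuple eqxx /=.
by case: eqP => _; rewrite ?mulr1 ?addr0 ?mulr0 ?add0r.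
Qed.

Lemma is_derive_line (f : Rn -> R) (g : R) (y v : Rn) (s : R) :
  is_derive (s *: v + y) v f g -> is_derive s 1 (fun s => f (s *: v + y)) g.
Proof.
move=> [df <-].
have E : (fun h : R => h^-1 *: ((f \o shift (s *: v + y)) (h *: v) - f (s *: v + y))) =
  (fun h : R => h^-1 *: (((fun s => f (s *: v + y)) \o shift s) (h *: (1 : R)) - f (s *: v + y))).
  apply/funext => h; congr (_ *: (_ - _)) => /=; congr (f _).
  by rewrite addrA -scalerDl /GRing.scale /= mulr1.
split; first by rewrite /derivable -E.
by rewrite /derive -E.
Qed.

Lemma integrable_row (f : Rn -> R) (K : R) : continuous f ->
  (forall x, `|f x| <= K * row_weight x) ->
  mu.-integrable setT (fun t => (f (tuple_row t))%:E).
Proof.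
move=> cf fK; apply: (@integrable_tuple_weight _ _ (fun t => f (tuple_row t)) K).
  exact: measurable_comp_tuple_row.
by move=> t; rewrite tuple_weightE.
Qed.

Lemma integral_row_partial (f g : Rn -> R) k (K : R) : continuous g ->
  (forall x, `|f x| <= K * row_weight x) ->
  (forall x, `|g x| <= K * row_weight x) ->
  (forall x, is_derive x (basis_vec R k) f (g x)) ->
  \int[mu]_t g (tuple_row t) = 0.
Proof.
move=> cg fK gK df; rewrite /Rintegral.
have d1 (t : n.-tuple RT) (s : R) : is_derive s 1
    (fun s => f (tuple_row (tuple_upd k s t)) : R) (g (tuple_row (tuple_upd k s t))).
  rewrite tuple_row_upd.
  under [X in is_derive _ _ X]eq_fun do rewrite tuple_row_upd.
  exact: is_derive_line.
have c1 (t : n.-tuple RT) : continuous (fun s : R => g (tuple_row (tuple_upd k s t)) : R).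
  rewrite (_ : (fun s => _) =
    g \o (fun s : R => s *: basis_vec R k + tuple_row (tuple_upd k 0 t))); last first.
    by apply/funext => s; rewrite /= tuple_row_upd.
  move=> s; apply: continuous_comp; last exact: cg.
  by apply: cvgD; [apply: cvgZr_tmp; exact: cvg_id|exact: cvg_cst].
have b1 (h : Rn -> R) : (forall x, `|h x| <= K * row_weight x) ->
    forall t : n.-tuple RT, `|h (tuple_row t)| <= K * tuple_weight t.
  by move=> hK t; rewrite tuple_weightE.
have -> // : (\int[mu]_t (g (tuple_row t))%:E)%E = 0%E.
exact: (@integral_partial_eq0 _ _ k (fun t => f (tuple_row t)) (fun t => g (tuple_row t)) K
  (measurable_comp_tuple_row cg) (b1 _ fK) (b1 _ gK) d1 c1).
Qed.

Definition ccont F := continuous (fun x => complex.Re (F x)) /\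
  continuous (fun x => complex.Im (F x)).

(** A relation that asserts existence together with the value; the total function [partial] alone
    carries no information about existence. *)
Definition pderiv k F G := forall x,
  is_derive x (basis_vec R k) (fun y => complex.Re (F y) : R^o) (complex.Re (G x)) /\
  is_derive x (basis_vec R k) (fun y => complex.Im (F y) : R^o) (complex.Im (G x)).

Definition dominated F := exists K : R, forall x, cmod (F x) <= K * row_weight x.

Lemma cReM (z w : R[i]) : complex.Re (z * w) =
  complex.Re z * complex.Re w - complex.Im z * complex.Im w.
Proof. by case: z w => a b [c d]. Qed.

Lemma cImM (z w : R[i]) : complex.Im (z * w) =
  complex.Re z * complex.Im w + complex.Im z * complex.Re w.
Proof. by case: z w => a b [c d]. Qed.

Lemma cReD (z w : R[i]) : complex.Re (z + w) = complex.Re z + complex.Re w.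
Proof. by case: z w => a b [c d]. Qed.

Lemma cImD (z w : R[i]) : complex.Im (z + w) = complex.Im z + complex.Im w.
Proof. by case: z w => a b [c d]. Qed.

Lemma ccont_cst (c : R[i]) : ccont (fun=> c).
Proof.
split; first exact: (@cst_continuous _ _ (complex.Re c)).
exact: (@cst_continuous _ _ (complex.Im c)).
Qed.

Lemma ccontD F G : ccont F -> ccont G -> ccont (fun x => F x + G x).
Proof.
move=> [F1 F2] [G1 G2]; split.
- under [X in continuous X]eq_fun do rewrite cReD.
  exact: (fun x => cvgD (F1 x) (G1 x)).
- under [X in continuous X]eq_fun do rewrite cImD.
  exact: (fun x => cvgD (F2 x) (G2 x)).
Qed.

Lemma ccontM F G : ccont F -> ccont G -> ccont (fun x => F x * G x).
Proof.
move=> [F1 F2] [G1 G2]; split.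
- under [X in continuous X]eq_fun do rewrite cReM.
  exact: (fun x => cvgB (cvgM (F1 x) (G1 x)) (cvgM (F2 x) (G2 x))).
- under [X in continuous X]eq_fun do rewrite cImM.
  exact: (fun x => cvgD (cvgM (F1 x) (G2 x)) (cvgM (F2 x) (G1 x))).
Qed.

Lemma pderiv_cst k (c : R[i]) : pderiv k (fun=> c) (fun=> 0).
Proof. by move=> x; split; exact: is_derive_cst. Qed.

Lemma pderivD k F F' G G' : pderiv k F F' -> pderiv k G G' ->
  pderiv k (fun x => F x + G x) (fun x => F' x + G' x).
Proof.
move=> dF dG x; have [F1 F2] := dF x; have [G1 G2] := dG x; split.
- under [X in is_derive _ _ X]eq_fun do rewrite cReD.
  by rewrite cReD; exact: is_deriveD.
- under [X in is_derive _ _ X]eq_fun do rewrite cImD.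
  by rewrite cImD; exact: is_deriveD.
Qed.

Lemma pderivM k F F' G G' : pderiv k F F' -> pderiv k G G' ->
  pderiv k (fun x => F x * G x) (fun x => F' x * G x + F x * G' x).
Proof.
move=> dF dG x; have [F1 F2] := dF x; have [G1 G2] := dG x; split.
- under [X in is_derive _ _ X]eq_fun do rewrite cReM.
  apply: (is_derive_eq (is_deriveB (is_deriveM F1 G1) (is_deriveM F2 G2))).
  by rewrite cReD !cReM /GRing.scale /=; ring.
- under [X in is_derive _ _ X]eq_fun do rewrite cImM.
  apply: (is_derive_eq (is_deriveD (is_deriveM F1 G2) (is_deriveM F2 G1))).
  by rewrite cImD !cImM /GRing.scale /=; ring.
Qed.

Lemma dominatedD F G : dominated F -> dominated G -> dominated (fun x => F x + G x).
Proof.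
move=> [K HK] [L HL]; exists (K + L) => x.
by rewrite mulrDl (le_trans (cmodD _ _))// lerD.
Qed.

Lemma dominatedZ c F : dominated F -> dominated (fun x => c * F x).
Proof.
move=> [K HK]; exists (cmod c * K) => x.
by rewrite cmodM -mulrA ler_wpM2l// cmod_ge0.
Qed.

Lemma integrable_ReIm F : ccont F -> dominated F ->
  mu.-integrable setT (fun t => (complex.Re (F (tuple_row t)))%:E) /\
  mu.-integrable setT (fun t => (complex.Im (F (tuple_row t)))%:E).
Proof.
move=> [F1 F2] [K HK]; split.
- apply: (@integrable_row (fun x => complex.Re (F x)) K) => // x.
  exact: le_trans (Re_le_cmod _) (HK x).
- apply: (@integrable_row (fun x => complex.Im (F x)) K) => // x.
  exact: le_trans (Im_le_cmod _) (HK x).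
Qed.

Lemma cintegralD F G : ccont F -> dominated F -> ccont G -> dominated G ->
  cintegral (fun x => F x + G x) = cintegral F + cintegral G.
Proof.
move=> cF dF cG dG.
have [F1 F2] := integrable_ReIm cF dF; have [G1 G2] := integrable_ReIm cG dG.
rewrite /cintegral; apply/eqP; rewrite eq_complex /=; apply/andP; split; apply/eqP.
- rewrite -(RintegralD measurableT F1 G1).
  by apply: eq_Rintegral => t _; rewrite cReD.
- rewrite -(RintegralD measurableT F2 G2).
  by apply: eq_Rintegral => t _; rewrite cImD.
Qed.

Lemma cintegralZ c F : ccont F -> dominated F ->
  cintegral (fun x => c * F x) = c * cintegral F.
Proof.
move=> cF dF; have [F1 F2] := integrable_ReIm cF dF.
have ZI a (f : n.-tuple RT -> R) : mu.-integrable setT (EFin \o f) ->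
    mu.-integrable setT (EFin \o (fun t => a * f t)).
  by move=> If; under [X in _.-integrable _ X]eq_fun do rewrite /= EFinM; exact: integrableZl.
rewrite /cintegral; apply/eqP; rewrite eq_complex /=; apply/andP; split; apply/eqP.
- rewrite cReM /= -(RintegralZl _ measurableT F1) -(RintegralZl _ measurableT F2).
  rewrite -(RintegralB measurableT (ZI _ _ F1) (ZI _ _ F2)).
  by apply: eq_Rintegral => t _; rewrite cReM.
- rewrite cImM /= -(RintegralZl _ measurableT F2) -(RintegralZl _ measurableT F1).
  rewrite -(RintegralD measurableT (ZI _ _ F2) (ZI _ _ F1)).
  by apply: eq_Rintegral => t _; rewrite cImM.
Qed.

Lemma cintegral_pderiv k F G : pderiv k F G -> ccont G -> dominated F -> dominated G ->
  cintegral G = 0.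
Proof.
move=> dFG [G1 G2] [K HK] [L HL].
have bnd x : K * row_weight x <= (`|K| + `|L|) * row_weight x /\
    L * row_weight x <= (`|K| + `|L|) * row_weight x.
  have := ler_norm K; have := ler_norm L; have := normr_ge0 K; have := normr_ge0 L.
  by move=> *; split; rewrite ler_wpM2r ?row_weight_ge0//; lra.
pose N := `|K| + `|L|.
have HF x : cmod (F x) <= N * row_weight x by exact: le_trans (HK x) (bnd x).1.
have HG x : cmod (G x) <= N * row_weight x by exact: le_trans (HL x) (bnd x).2.
rewrite /cintegral.
have -> : \int[mu]_t complex.Re (G (tuple_row t)) = 0.
  exact: (@integral_row_partial (fun x => complex.Re (F x)) (fun x => complex.Re (G x)) k N
    G1 (fun x => le_trans (Re_le_cmod _) (HF x)) (fun x => le_trans (Re_le_cmod _) (HG x))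
    (fun x => (dFG x).1)).
have -> // : \int[mu]_t complex.Im (G (tuple_row t)) = 0.
exact: (@integral_row_partial (fun x => complex.Im (F x)) (fun x => complex.Im (G x)) k N
  G2 (fun x => le_trans (Im_le_cmod _) (HF x)) (fun x => le_trans (Im_le_cmod _) (HG x))
  (fun x => (dFG x).2)).
Qed.

End row_integral.

(** * Schwartz functions and integration by parts *)

Section schwartz_functions.
Context {R : realType} {n : nat}.
Local Notation Rn := ('rV[R]_n).
Implicit Types (f g : Rn -> R[i]) (F G W : Rn -> R[i]) (k : 'I_n).

Lemma pderiv_unique k F G : pderiv k F G -> partial k F = G.
Proof.
move=> dF; apply/funext => x; have [F1 F2] := dF x.
by apply/eqP; rewrite eq_complex /= !derive_val !eqxx.
Qed.

Lemma pderiv_partial k f :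
  (forall x, differentiable (fun y => complex.Re (f y) : R^o) x /\
             differentiable (fun y => complex.Im (f y) : R^o) x) ->
  pderiv k f (partial k f).
Proof.
move=> df x; have [f1 f2] := df x.
by split; apply: derivableP; apply: diff_derivable.
Qed.

Lemma partials_rcons s k f : partials s (partial k f) = partials (rcons s k) f.
Proof. by rewrite /partials foldr_rcons. Qed.

Lemma schwartz_partial k f : schwartz f -> schwartz (partial k f).
Proof.
move=> [sf wf]; split=> [s x|N s]; first by rewrite partials_rcons; exact: sf.
have [M HM] := wf N (rcons s k); exists M => x.
by rewrite /schwartz_weight partials_rcons; exact: HM.
Qed.

Lemma schwartz_ccont f : schwartz f -> ccont f.
Proof.
move=> [sf _]; split=> x; apply: differentiable_continuous; have [] := sf [::] x => //.
Qed.

Lemma schwartz_pderiv k f : schwartz f -> pderiv k f (partial k f).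
Proof. by move=> [sf _]; apply: pderiv_partial => x; exact: sf [::] x. Qed.

Lemma euclid_ge0 (x : Rn) : 0 <= euclid x.
Proof. exact: sqrtr_ge0. Qed.

Lemma schwartz_weightE N s f x : schwartz_weight N s f x =
  ((1 + euclid x) ^+ N * cmod (partials s f x))%:C%C.
Proof. by rewrite /schwartz_weight cmodE rmorphM. Qed.

Lemma schwartzP f : schwartz f <-> smooth f /\ forall N s, exists M : R,
  forall x, (1 + euclid x) ^+ N * cmod (partials s f x) <= M.
Proof.
split=> -[sf wf]; split => // N s; have [M HM] := wf N s.
  exists (complex.Re M) => x; have := HM x; rewrite schwartz_weightE lecE.
  by case/andP.
by exists M%:C%C => x; rewrite schwartz_weightE le_realC.
Qed.

Lemma partial0 k : partial k (fun _ : Rn => 0 : R[i]) = (fun=> 0).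
Proof. by apply: pderiv_unique; exact: pderiv_cst. Qed.

Lemma schwartz0 : schwartz (fun _ : Rn => 0 : R[i]).
Proof.
have p0 s : partials s (fun _ : Rn => 0 : R[i]) = (fun=> 0).
  by elim: s => [|k s /= ->] //; exact: partial0.
apply/schwartzP; split=> [s x|N s].
  by rewrite p0; split; exact: differentiable_cst.
by exists 0 => x; rewrite p0 cmod0 mulr0.
Qed.

Lemma partial_lin k (a : R[i]) f g :
  pderiv k f (partial k f) -> pderiv k g (partial k g) ->
  partial k (fun x => a * f x + g x) = (fun x => a * partial k f x + partial k g x).
Proof.
move=> df dg; apply: pderiv_unique.
have := pderivD (pderivM (pderiv_cst k a) df) dg.
by under [X in pderiv _ _ X -> _]eq_fun do rewrite mul0r add0r.
Qed.

Lemma schwartz_lin (a : R[i]) f g : schwartz f -> schwartz g ->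
  schwartz (fun x => a * f x + g x).
Proof.
move=> sf sg; have [smf wf] := (schwartzP f).1 sf; have [smg wg] := (schwartzP g).1 sg.
have E s : partials s (fun x => a * f x + g x) =
    (fun x => a * partials s f x + partials s g x).
  elim: s => [//|k s /= ->]; apply: partial_lin; apply: pderiv_partial => x.
    exact: smf. exact: smg.
apply/schwartzP; split=> [s x|N s].
  rewrite E; have [f1 f2] := smf s x; have [g1 g2] := smg s x; split.
    rewrite (_ : (fun _ => _) = fun y => complex.Re a *: (complex.Re (partials s f y) : R^o)
      - complex.Im a *: (complex.Im (partials s f y) : R^o) + (complex.Re (partials s g y) : R^o)).
      exact: (differentiableD (differentiableB (differentiableZ _ f1) (differentiableZ _ f2)) g1).
    by apply/funext => y; rewrite cReD cReM.
  rewrite (_ : (fun _ => _) = fun y => complex.Re a *: (complex.Im (partials s f y) : R^o)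
    + complex.Im a *: (complex.Re (partials s f y) : R^o) + (complex.Im (partials s g y) : R^o)).
    exact: (differentiableD (differentiableD (differentiableZ _ f2) (differentiableZ _ f1)) g2).
  by apply/funext => y; rewrite cImD cImM.
have [M1 H1] := wf N s; have [M2 H2] := wg N s; exists (cmod a * M1 + M2) => x.
have w0 : 0 <= (1 + euclid x) ^+ N by rewrite exprn_ge0// addr_ge0// euclid_ge0.
rewrite E (le_trans (ler_wpM2l w0 (cmodD _ _)))// mulrDr lerD//.
by rewrite cmodM mulrCA ler_wpM2l// cmod_ge0.
Qed.

Lemma schwartz_sum (I : Type) (r : seq I) (P : pred I) (c : I -> R[i]) (f : I -> Rn -> R[i]) :
  (forall i, schwartz (f i)) -> schwartz (fun x => \sum_(i <- r | P i) c i * f i x).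
Proof.
move=> sf; elim: r => [|i r IH].
  by under [X in schwartz X]eq_fun do rewrite big_nil; exact: schwartz0.
under [X in schwartz X]eq_fun do rewrite big_cons.
by case: (P i) => //; exact: schwartz_lin.
Qed.

Definition pgrowth W := exists (K : R) (N : nat),
  forall x, cmod (W x) <= K * (1 + euclid x) ^+ N.

Lemma pgrowth_cst c : pgrowth (fun=> c).
Proof. by exists (cmod c), 0%N => x; rewrite expr0 mulr1. Qed.

Let w1 (x : Rn) : 1 <= 1 + euclid x.
Proof. by rewrite lerDl euclid_ge0. Qed.

Lemma pgrowthM F G : pgrowth F -> pgrowth G -> pgrowth (fun x => F x * G x).
Proof.
move=> [K [N HK]] [L [M HL]]; exists (K * L), (N + M)%N => x.
by rewrite cmodM exprD mulrACA ler_pM// cmod_ge0.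
Qed.

Lemma pgrowthD F G : pgrowth F -> pgrowth G -> pgrowth (fun x => F x + G x).
Proof.
move=> [K [N HK]] [L [M HL]]; exists (`|K| + `|L|), (N + M)%N => x.
have [p1 p2] : (1 + euclid x) ^+ N <= (1 + euclid x) ^+ (N + M) /\
    (1 + euclid x) ^+ M <= (1 + euclid x) ^+ (N + M).
  by split; apply: ler_weXn2l => //; rewrite ?leq_addr ?leq_addl.
have q m : 0 <= (1 + euclid x) ^+ m by rewrite exprn_ge0// (le_trans ler01).
rewrite mulrDl (le_trans (cmodD _ _))// lerD//.
  by rewrite (le_trans (HK x))// (le_trans (ler_wpM2r (q N) (ler_norm K)))// ler_wpM2l.
by rewrite (le_trans (HL x))// (le_trans (ler_wpM2r (q M) (ler_norm L)))// ler_wpM2l.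
Qed.

Lemma sqr_euclid (x : Rn) : euclid x ^+ 2 = \sum_k x ord0 k ^+ 2.
Proof. by rewrite sqr_sqrtr// sumr_ge0// => i _; exact: sqr_ge0. Qed.

Lemma coord_le_euclid (x : Rn) k : `|x ord0 k| <= euclid x.
Proof.
rewrite -ler_sqr ?nnegrE ?euclid_ge0// sqr_euclid real_normK ?num_real//.
rewrite (bigD1 k)//= lerDl sumr_ge0// => i _; exact: sqr_ge0.
Qed.

(** Factor by factor, 1 + x_k^2 <= (1 + |x|)^2. *)
Lemma row_weight_growth (x : Rn) : 1 <= row_weight x * (1 + euclid x) ^+ (2 * n).
Proof.
rewrite exprM -[X in (1 + euclid x) ^+ 2 ^+ X]card_ord -prodr_const -big_split /=.
apply: (@le_trans _ _ (\prod_(k < n) (1 : R))); first by rewrite big1.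
apply: ler_prod => k _; rewrite ler01 /= mulrC ler_pdivlMr ?oneDsqr_gt0// mul1r /oneDsqr.
have := coord_le_euclid x k; have := normr_ge0 (x ord0 k); have := euclid_ge0 x.
rewrite -(real_normK (num_real (x ord0 k))); nra.
Qed.

(** Decay of order N + 2n is requested of [f]: N absorbs the growth of [W], and 2n pays for
    [row_weight]. *)
Lemma dominated_schwartzM f W : schwartz f -> pgrowth W -> dominated (fun x => f x * W x).
Proof.
move=> /schwartzP[_ wf] [K [N HK]]; have [M HM] := wf (N + 2 * n)%N [::].
exists (M * `|K|) => x.
have q m : 0 <= (1 + euclid x) ^+ m by rewrite exprn_ge0// (le_trans ler01).
have h1 : cmod (f x) <= M / (1 + euclid x) ^+ (N + 2 * n).
  by rewrite ler_pdivlMr ?exprn_gt0 ?(lt_le_trans ltr01)// mulrC; exact: HM.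
have h2 : cmod (W x) <= `|K| * (1 + euclid x) ^+ N.
  by rewrite (le_trans (HK x))// ler_wpM2r// ler_norm.
rewrite cmodM (le_trans (ler_pM (cmod_ge0 _) (cmod_ge0 _) h1 h2))//.
have M0 : 0 <= M by apply: le_trans (HM x); rewrite mulr_ge0// cmod_ge0.
rewrite exprD invfM; set a := _ ^+ N; set b := _ ^+ (2 * n)%N.
have a0 : a != 0 by rewrite expf_neq0// gt_eqF// (lt_le_trans ltr01).
have -> (u v c L : R) : M * (u * v) * (L * c) = (u * c) * (M * L * v) by ring.
rewrite mulVf// mul1r.
rewrite ler_wpM2l ?mulr_ge0//.
by rewrite -[leLHS]mul1r ler_pdivrMr ?row_weight_growth// exprn_gt0// (lt_le_trans ltr01).
Qed.

(** The integral of the derivative of f W vanishes by [cintegral_pderiv], and Leibniz splits it. *)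
Lemma schwartz_by_parts k f W W' : schwartz f -> pderiv k W W' ->
  ccont W -> ccont W' -> pgrowth W -> pgrowth W' ->
  cintegral (fun x => partial k f x * W x) = - cintegral (fun x => f x * W' x).
Proof.
move=> sf dW cW cW' gW gW'.
have spf := schwartz_partial k sf.
have cf := schwartz_ccont sf; have cpf := schwartz_ccont spf.
apply/eqP; rewrite -addr_eq0 -cintegralD; first apply/eqP.
- apply: (@cintegral_pderiv _ _ k (fun x => f x * W x)).
  + by apply: pderivM => //; exact: schwartz_pderiv.
  + by apply: ccontD; apply: ccontM.
  + exact: dominated_schwartzM.
  + by apply: dominatedD; exact: dominated_schwartzM.
- exact: ccontM.
- exact: dominated_schwartzM.
- exact: ccontM.
- exact: dominated_schwartzM.
Qed.

End schwartz_functions.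
(** * Complex powers of the radius *)

Section radial_power.
Context {R : realType}.
Implicit Types (z : R[i]) (q : R).

(* In terms of q = r^2 the power r^z with Re z >= 4 is differentiable on all of R
   (it is 0 for q <= 0), so the origin needs no separate treatment. *)
Definition sq_cpow z q : R[i] := rcpow (Num.sqrt q) z.

Lemma rcpow0 z : complex.Re z != 0 -> rcpow 0 z = 0.
Proof. by move=> z0; rewrite /rcpow powR0// rmorph0 mul0r. Qed.

Lemma cmod_rcpow (t : R) z : cmod (rcpow t z) = t `^ complex.Re z.
Proof.
rewrite /rcpow cmodM cmod_real ger0_norm ?powR_ge0// cmod_sqrt /=.
by rewrite cos2Dsin2 sqrtr1 mulr1.
Qed.

Lemma ln_sqrt q : 0 < q -> ln (Num.sqrt q) = ln q / 2.
Proof. by move=> q0; rewrite -powR12_sqrt ?ltW// ln_powR mulrC. Qed.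

Lemma sq_cpow_pos z q : 0 < q -> sq_cpow z q =
  ((expR (complex.Re z * (ln q / 2)) * cos (complex.Im z * (ln q / 2))) +i*
   (expR (complex.Re z * (ln q / 2)) * sin (complex.Im z * (ln q / 2))))%C.
Proof.
move=> q0; rewrite /sq_cpow /rcpow ln_sqrt// /powR gt_eqF ?sqrtr_gt0// ln_sqrt//.
by apply/eqP; rewrite eq_complex /= !mul0r subr0 addr0 !eqxx.
Qed.

Lemma sq_cpow_le0 z q : complex.Re z != 0 -> q <= 0 -> sq_cpow z q = 0.
Proof. by move=> z0 q0; rewrite /sq_cpow ler0_sqrtr// rcpow0. Qed.

Lemma Re2 : complex.Re (2 : R[i]) = 2. Proof. by []. Qed.

Lemma Im2 : complex.Im (2 : R[i]) = 0. Proof. by rewrite /= addr0. Qed.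

Lemma ReB2 z : complex.Re (z - 2) = complex.Re z - 2.
Proof. by rewrite raddfB; congr (_ - _); exact: Re2. Qed.

(** The conditions on the real part are for [q <= 0], where both powers must be 0; a zero base gives
    0 only for an exponent with nonzero real part. *)
Lemma sq_cpowD2 z q : complex.Re z != 0 -> complex.Re z + 2 != 0 ->
  sq_cpow (z + 2) q = q%:C%C * sq_cpow z q.
Proof.
move=> z0 z20.
have Rez : complex.Re (z + 2) = complex.Re z + 2 by rewrite cReD; congr (_ + _); exact: Re2.
have Imz : complex.Im (z + 2) = complex.Im z by rewrite cImD -[RHS]addr0; congr (_ + _); exact: Im2.
have [q0|q0] := ltP 0 q; last by rewrite !sq_cpow_le0 ?mulr0// Rez.
rewrite !sq_cpow_pos// Rez Imz mulrDl expRD (_ : 2 * (ln q / 2) = ln q); last by field.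
rewrite lnK//; apply/eqP; rewrite eq_complex /=; apply/andP; split; apply/eqP; ring.
Qed.

(** With [tr] equal to cos or sin this is the real or the imaginary part of q^(z/2) for z = a + i
    b. *)
Lemma is_derive_exp_ln (a b q : R) (tr dtr : R -> R) : 0 < q ->
  (forall y : R, is_derive y 1 tr (dtr y)) ->
  is_derive q 1 (fun q => expR (a * (ln q / 2)) * tr (b * (ln q / 2)))
   ((a * expR (a * (ln q / 2)) * tr (b * (ln q / 2)) +
     b * expR (a * (ln q / 2)) * dtr (b * (ln q / 2))) / (2 * q)).
Proof.
move=> q0 dt.
have dl c : is_derive q 1 (fun q => c * (ln q / 2)) (c / (2 * q)).
  have := @is_deriveZ _ _ _ (@ln R) (c / 2) q 1 _ (is_derive1_ln q0).
  rewrite (_ : (c / 2) \*: _ = (fun q => c * (ln q / 2))); last first.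
    by apply/funext => y /=; rewrite /GRing.scale /= mulrA mulrAC.
  by move=> H; apply: (is_derive_eq H); rewrite /GRing.scale /= invfM mulrA.
have d1 := @is_derive1_comp R expR (fun q => a * (ln q / 2)) q _ _
  (is_derive_expR (a * (ln q / 2))) (dl a).
have d2 := @is_derive1_comp R tr (fun q => b * (ln q / 2)) q _ _ (dt (b * (ln q / 2))) (dl b).
apply: (is_derive_eq (is_deriveM d1 d2)); rewrite /GRing.scale /=.
by field; rewrite gt_eqF.
Qed.

Lemma is_derive_at0 (f : R -> R) : f 0 = 0 ->
  (forall h, `|h| < 1 -> `|f h| <= `|h| ^+ 2) -> is_derive (0 : R) 1 f 0.
Proof.
move=> f0 Hf.
have cv : h^-1 *: ((f \o shift 0) (h *: 1) - f 0) @[h --> 0^'] --> (0 : R).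
  apply/cvgr0Pnorm_le => e e0; rewrite near_withinE.
  apply/nbhs_ballP; exists (Num.min 1 e) => /=; first by rewrite lt_min ltr01.
  move=> h; rewrite -ball_normE /= sub0r normrN lt_min => /andP[h1 he] h0.
  rewrite f0 subr0 addr0 /GRing.scale /= mulr1 normrM normfV.
  have hp : 0 < `|h| by rewrite normr_gt0.
  rewrite ler_pdivrMl// (le_trans (Hf h h1))// expr2 ler_pM2l// ltW//.
split; first by apply/cvg_ex; exists 0.
exact: cvg_lim cv.
Qed.

(** The threshold 4 yields |q^(z/2)| <= q^2 for 0 < q < 1, so the extension by 0 has derivative 0 at
    the origin. *)
Lemma is_derive_sq_cpow z q : 4 <= complex.Re z ->
  is_derive q 1 (fun q => complex.Re (sq_cpow z q)) (complex.Re (z / 2 * sq_cpow (z - 2) q)) /\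
  is_derive q 1 (fun q => complex.Im (sq_cpow z q)) (complex.Im (z / 2 * sq_cpow (z - 2) q)).
Proof.
move=> z4; have z0 : complex.Re z != 0 by rewrite gt_eqF//; lra.
have z20 : complex.Re (z - 2) != 0 by rewrite ReB2 gt_eqF//; lra.
have [q0|q0|q0] := ltgtP q 0.
- rewrite (sq_cpow_le0 z20 (ltW q0)) mulr0.
  have nr : \forall y \near q, (0 : R[i]) = sq_cpow z y.
    near=> y; rewrite sq_cpow_le0// ltW//.
    by near: y; exact: lt_nbhsl.
  split; apply: (@near_eq_is_derive _ _ _ (fun=> 0)) (is_derive_cst _ _ _); near=> y;
    by rewrite (_ : sq_cpow z y = 0)//; apply/esym; near: y.
- have E : q%:C%C * sq_cpow (z - 2) q = sq_cpow z q.
    by rewrite -sq_cpowD2 ?subrK//; rewrite ReB2 subrK.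
  have qc : q%:C%C != 0 :> R[i].
    by rewrite -(rmorph0 (real_complex R)) (inj_eq (@complexI R)) gt_eqF.
  have -> : z / 2 * sq_cpow (z - 2) q = ((2 * q)^-1)%:C%C * (z * sq_cpow z q).
    rewrite -E fmorphV rmorphM /= (_ : 2%:C%C = 2); last by rewrite rmorphMn.
    by field; rewrite qc.
  have nr (y : R) : q / 2 < y -> 0 < y by lra.
  rewrite (sq_cpow_pos z q0); split.
  + apply: (near_eq_is_derive (f := fun q =>
        expR (complex.Re z * (ln q / 2)) * cos (complex.Im z * (ln q / 2)))).
      near=> y; rewrite sq_cpow_pos//; near: y; exact: lt_nbhsr.
    apply: (is_derive_eq (is_derive_exp_ln (complex.Re z) (complex.Im z) q0 (@is_derive_cos R))).
    by rewrite !cReM /=; field; rewrite gt_eqF.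
  + apply: (near_eq_is_derive (f := fun q =>
        expR (complex.Re z * (ln q / 2)) * sin (complex.Im z * (ln q / 2)))).
      near=> y; rewrite sq_cpow_pos//; near: y; exact: lt_nbhsr.
    apply: (is_derive_eq (is_derive_exp_ln (complex.Re z) (complex.Im z) q0 (@is_derive_sin R))).
    by rewrite !(cImM, cReM) /=; field; rewrite gt_eqF.
- rewrite q0 (sq_cpow_le0 z20 (lexx _)) mulr0.
  have small h : `|h| < 1 -> cmod (sq_cpow z h) <= `|h| ^+ 2.
    move=> h1; have [hp|hn] := ltP 0 h; last by rewrite sq_cpow_le0// cmod0 exprn_ge0.
    rewrite /sq_cpow cmod_rcpow /powR gt_eqF ?sqrtr_gt0// ln_sqrt// gtr0_norm//.
    rewrite -[X in _ <= X ^+ 2]lnK// -expRM_natl ler_expR.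
    (* In logarithms the claim is Re z * (ln h / 2) <= 2 * ln h, which needs [ln h <= 0] and
       [4 <= Re z]. *)
    have : ln h <= 0 by apply: ln_le0; rewrite gtr0_norm// in h1; exact: ltW.
    by nra.
  split; apply: is_derive_at0; rewrite ?(sq_cpow_le0 z0)// => h h1.
    exact: le_trans (Re_le_cmod _) (small h h1).
  exact: le_trans (Im_le_cmod _) (small h h1).
Unshelve. all: by end_near. Qed.

End radial_power.

(** * Derivatives and growth of powers of the radius *)

Section row_radial_power.
Context {R : realType} {n : nat}.
Local Notation Rn := ('rV[R]_n).
Implicit Types (z : R[i]) (k i : 'I_n).

Definition rpow z (x : Rn) : R[i] := rcpow (euclid x) z.

Definition coordC i (x : Rn) : R[i] := (x ord0 i)%:C%C.

Definition sumsq (x : Rn) : R := \sum_i x ord0 i ^+ 2.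

Lemma rpow_sumsq z x : rpow z x = sq_cpow z (sumsq x).
Proof. by []. Qed.

Lemma cReZ (a : R) (w : R[i]) : complex.Re (a%:C%C * w) = a * complex.Re w.
Proof. by case: w => c d; rewrite /= mul0r subr0. Qed.

Lemma cImZ (a : R) (w : R[i]) : complex.Im (a%:C%C * w) = a * complex.Im w.
Proof. by case: w => c d; rewrite /= mul0r addr0. Qed.

Lemma is_derive_of_line (f : Rn -> R) (g : R) (x v : Rn) :
  is_derive (0 : R) 1 (fun s => f (s *: v + x)) g -> is_derive x v f g.
Proof.
move=> [df <-].
have E : (fun h : R => h^-1 *: ((f \o shift x) (h *: v) - f x)) =
  (fun h : R => h^-1 *: (((fun s => f (s *: v + x)) \o shift 0) (h *: (1 : R)) - f (0 *: v + x))).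
  apply/funext => h; rewrite scale0r add0r; congr (_ *: (_ - _)) => /=; congr (f _).
  by rewrite addr0 /GRing.scale /= mulr1.
split; first by rewrite /derivable E.
by rewrite /derive E.
Qed.

Lemma sumsq_line k (x : Rn) (s : R) :
  sumsq (s *: basis_vec R k + x) = sumsq x + 2 * x ord0 k * s + s * s.
Proof.
rewrite /sumsq (bigD1 k)//= [X in _ = X + _ + _](bigD1 k)//= !mxE !eqxx /= mulr1.
have -> : \sum_(i < n | i != k) (s *: basis_vec R k + x) ord0 i ^+ 2 =
    \sum_(i < n | i != k) x ord0 i ^+ 2.
  by apply: eq_bigr => i ik; rewrite !mxE (negPf ik) andbF mulr0 add0r.
by ring.
Qed.

Lemma is_derive_quadratic (a b : R) :
  is_derive (0 : R) 1 (fun s : R => a + b * s + s * s) b.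
Proof.
have d1 : is_derive (0 : R) 1 (fun s : R => b * s) b.
  apply: (is_derive_eq (@is_deriveZ _ _ _ id b (0 : R) 1 1 (is_derive_id _ _))).
  by rewrite /GRing.scale /= mulr1.
have d2 : is_derive (0 : R) 1 (fun s : R => s * s) 0.
  apply: (is_derive_eq (is_deriveM (is_derive_id (0 : R) 1) (is_derive_id (0 : R) 1))).
  by rewrite /GRing.scale /= !mul0r addr0.
apply: (is_derive_eq (is_deriveD (is_deriveD (is_derive_cst a (0 : R) 1) d1) d2)).
by rewrite add0r addr0.
Qed.

(** Along the line through x in direction e_k the squared radius is a quadratic polynomial with
    derivative 2 x_k at 0, so the one-variable chain rule is enough. *)
Lemma pderiv_rpow k z : 4 <= complex.Re z ->
  pderiv k (rpow z) (fun x => z * coordC k x * rpow (z - 2) x).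
Proof.
move=> z4 x; pose l (s : R) := sumsq x + 2 * x ord0 k * s + s * s.
have dl : is_derive (0 : R) 1 l (2 * x ord0 k) by exact: is_derive_quadratic.
have l0 : l 0 = sumsq x by rewrite /l !mulr0 !addr0.
have [d1 d2] := is_derive_sq_cpow (sumsq x) z4.
have E : z * coordC k x * rpow (z - 2) x =
    (2 * x ord0 k)%:C%C * (z / 2 * sq_cpow (z - 2) (sumsq x)).
  rewrite rpow_sumsq /coordC rmorphM /= (_ : 2%:C%C = 2); last by rewrite rmorphMn.
  by field.
rewrite E cReZ cImZ; split; apply: is_derive_of_line.
- rewrite (_ : (fun s => _) = (fun s => complex.Re (sq_cpow z (l s)))); last first.
    by apply/funext => s; rewrite /l -(sumsq_line k).
  rewrite -l0 in d1; apply: (is_derive_eq (@is_derive1_comp R _ l 0 _ _ d1 dl)).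
  by rewrite l0 [LHS]mulrC.
- rewrite (_ : (fun s => _) = (fun s => complex.Im (sq_cpow z (l s)))); last first.
    by apply/funext => s; rewrite /l -(sumsq_line k).
  rewrite -l0 in d2; apply: (is_derive_eq (@is_derive1_comp R _ l 0 _ _ d2 dl)).
  by rewrite l0 [LHS]mulrC.
Qed.

Lemma pderiv_coord k i : pderiv k (coordC i) (fun=> (i == k)%:R).
Proof.
move=> x; split; last first.
  by rewrite (_ : complex.Im _ = 0); [exact: is_derive_cst|case: (i == k)].
apply: is_derive_of_line.
rewrite (_ : (fun s => _) = (fun s : R => x ord0 i + (i == k)%:R * s)); last first.
  by apply/funext => s; rewrite /= !mxE eqxx /= addrC mulrC.
rewrite (_ : complex.Re _ = (i == k)%:R); last by case: (i == k).
have d1 : is_derive (0 : R) 1 (fun s : R => (i == k)%:R * s) (i == k)%:R.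
  apply: (is_derive_eq (@is_deriveZ _ _ _ id _ (0 : R) 1 1 (is_derive_id _ _))).
  by rewrite /GRing.scale /= mulr1.
apply: (is_derive_eq (is_deriveD (is_derive_cst (x ord0 i) (0 : R) 1) d1)).
by rewrite add0r.
Qed.

Lemma continuous_coord_row i : continuous (fun x : Rn => x ord0 i).
Proof.
by move=> x; apply: differentiable_continuous; exact: differentiable_coord.
Qed.

Lemma ccont_coord i : ccont (coordC i).
Proof.
split; first exact: continuous_coord_row.
exact: (@cst_continuous _ _ (0 : R)).
Qed.

Lemma continuous_sumsq : continuous sumsq.
Proof.
apply: continuous_big => [|i _ x]; first exact: add_continuous.
apply: (@continuous_comp _ _ _ (fun x : Rn => x ord0 i) (fun y : R => y ^+ 2)).
  exact: continuous_coord_row.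
exact: exprn_continuous.
Qed.

Lemma ccont_rpow z : 4 <= complex.Re z -> ccont (rpow z).
Proof.
move=> z4; split=> x.
- apply: (@continuous_comp _ _ _ sumsq (fun q => complex.Re (sq_cpow z q))).
    exact: continuous_sumsq.
  have [d1 _] := is_derive_sq_cpow (sumsq x) z4.
  exact/differentiable_continuous/derivable1_diffP/(@ex_derive _ _ _ _ _ _ _ d1).
- apply: (@continuous_comp _ _ _ sumsq (fun q => complex.Im (sq_cpow z q))).
    exact: continuous_sumsq.
  have [_ d2] := is_derive_sq_cpow (sumsq x) z4.
  exact/differentiable_continuous/derivable1_diffP/(@ex_derive _ _ _ _ _ _ _ d2).
Qed.

Lemma pgrowth_coord i : pgrowth (coordC i).
Proof.
exists 1, 1%N => x; rewrite mul1r expr1 cmod_real.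
by rewrite (le_trans (coord_le_euclid _ _))// lerDr.
Qed.

Lemma pgrowth_rpow z : 0 <= complex.Re z -> pgrowth (rpow z).
Proof.
move=> z0; exists 1, (Num.bound (complex.Re z)) => x; rewrite mul1r cmod_rcpow.
have e0 := euclid_ge0 x; have e1 : 0 <= 1 + euclid x by rewrite addr_ge0.
apply: (@le_trans _ _ ((1 + euclid x) `^ complex.Re z)).
  by apply: ge0_ler_powR => //; rewrite lerDr.
rewrite -powR_mulrn//; apply: ler_powR; first by rewrite lerDl.
by apply/ltW/archi_boundP.
Qed.

Lemma rpowD2 z x : complex.Re z != 0 -> complex.Re z + 2 != 0 ->
  rpow (z + 2) x = \sum_i coordC i x * coordC i x * rpow z x.
Proof.
move=> z0 z20; rewrite !rpow_sumsq sq_cpowD2// -mulr_suml; congr (_ * _).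
by rewrite /sumsq rmorph_sum; apply: eq_bigr => i _; rewrite -rmorphM expr2.
Qed.

End row_radial_power.
(** * Exterior and interior multiplication *)

Section exterior_algebra.
Context {R : realType} {n : nat}.
Local Notation form := (dform R n).
Implicit Types (w v : form) (k l : 'I_n) (I : {set 'I_n}).

Local Notation sg := (@basis_sign R n).

Lemma basis_signU k l I : l \notin I ->
  sg k (l |: I) = (-1) ^+ (l < k)%N * sg k I.
Proof.
move=> lI; rewrite /basis_sign -exprD; congr (_ ^+ _).
have [lk|lk] := boolP (l < k)%N.
  rewrite (_ : [set i in l |: I | _] = l |: [set i in I | (i < k)%N]).
    by rewrite cardsU1 inE (negPf lI).
  by apply/setP => i; rewrite !inE; case: eqP => [->|].
rewrite add0n; congr #|pred_of_set _|; apply/setP => i; rewrite !inE.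
by case: eqP => [->|]//; rewrite (negPf lk) !andbF.
Qed.

Lemma basis_signU1 k I : sg k (k |: I) = sg k I.
Proof.
have [kI|kI] := boolP (k \in I); last by rewrite basis_signU// ltnn mul1r.
by rewrite (finset.setUidPr _)// finset.sub1set.
Qed.

Lemma basis_signD1 k I : sg k (I :\ k) = sg k I.
Proof.
rewrite /basis_sign; congr (_ ^+ _); congr #|pred_of_set _|; apply/setP => i.
by rewrite !inE; case: eqP => [->|]//; rewrite ltnn !andbF.
Qed.

Lemma basis_signD k l I : l \in I ->
  sg k I = (-1) ^+ (l < k)%N * sg k (I :\ l).
Proof. by move=> lI; rewrite -{1}(finset.setD1K lI) basis_signU// !inE eqxx. Qed.

Lemma basis_sign_sqr k I : sg k I * sg k I = 1.
Proof. by rewrite /basis_sign -expr2 sqrr_sign. Qed.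

(** The source of all anticommutation below: of two distinct indices exactly one precedes the
    other. *)
Lemma sign_swap k l : k != l ->
  (-1) ^+ (l < k)%N = - (-1) ^+ (k < l)%N :> R[i].
Proof.
rewrite -(inj_eq val_inj) neq_ltn /= => /orP[h|h]; rewrite h.
  by rewrite ltnNge (ltnW h) /= expr0 expr1 opprK.
by rewrite ltnNge (ltnW h) /= expr0 expr1.
Qed.

Lemma wedge_eC k l w : wedge_e k (wedge_e l w) = - wedge_e l (wedge_e k w).
Proof.
apply/ffunP => I; rewrite !ffunE !inE.
have [<-|kl] := eqVneq k l; first by rewrite ?eqxx /=; case: ifP; rewrite ?mulr0 oppr0.
rewrite /=.
case: (boolP (k \in I)) => kI; case: (boolP (l \in I)) => lI; rewrite ?mulr0 ?oppr0//.
rewrite (basis_signD k lI) (basis_signD l kI) (sign_swap kl) !mulNr.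
rewrite (_ : I :\ k :\ l = I :\ l :\ k); last by apply/setP => i; rewrite !inE andbCA.
by move: (w _) (sg k _) (sg l _) => u a b; ring.
Qed.

Lemma contract_eC k l w :
  contract_e k (contract_e l w) = - contract_e l (contract_e k w).
Proof.
apply/ffunP => I; rewrite !ffunE !inE.
have [<-|kl] := eqVneq k l; first by rewrite ?eqxx /=; case: ifP; rewrite ?mulr0 oppr0.
rewrite /=.
case: (boolP (k \in I)) => kI; case: (boolP (l \in I)) => lI; rewrite /= ?mulr0 ?oppr0//.
rewrite (basis_signU l kI) (basis_signU k lI) (sign_swap kl).
have -> : l |: (k |: I) = k |: (l |: I) by rewrite finset.setUCA.
by move: (w _) (sg k I) (sg l I) => u a b; ring.
Qed.

(** The Clifford relation. For [k = l] exactly one of the two terms survives on each [I]; for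
    distinct indices both coefficients agree up to the sign from [sign_swap]. *)
Lemma contract_wedge k l w :
  contract_e k (wedge_e l w) + wedge_e l (contract_e k w) = (k == l)%:R *: w.
Proof.
apply/ffunP => I; rewrite !ffunE !inE /GRing.scale /=.
have [<-|kl] := eqVneq k l.
  rewrite ?eqxx /= mul1r; case: (boolP (k \in I)) => kI /=.
    by rewrite add0r basis_signD1 mulrA basis_sign_sqr mul1r finset.setD1K.
  rewrite addr0 basis_signU1 mulrA basis_sign_sqr mul1r finset.setU1K//.
rewrite /= mul0r.
case: (boolP (k \in I)) => kI; case: (boolP (l \in I)) => lI; rewrite /= ?mulr0 ?addr0//.
rewrite (basis_signU l kI) (basis_signD k lI) (sign_swap kl).
have -> : (k |: I) :\ l = k |: (I :\ l).
  by apply/setP => i; rewrite !inE; case: (eqVneq i k) => [->|//]; rewrite kl.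
have := sqrr_sign R[i] (k < l)%N; rewrite expr2.
move: (w _) (sg k _) (sg l _) ((-1) ^+ _) => u a b e e2.
rewrite [LHS](_ : _ = (1 - e * e) * (a * b * u)); last by ring.
by rewrite e2 subrr mul0r.
Qed.

Lemma wedge_eD k : {morph (@wedge_e R n k) : v w / v + w}.
Proof. by move=> v w; apply/ffunP => I; rewrite !ffunE; case: ifP; rewrite ?mulrDr ?addr0. Qed.

Lemma wedge_eZ k (a : R[i]) w : wedge_e k (a *: w) = a *: wedge_e k w.
Proof.
by apply/ffunP => I; rewrite !ffunE /GRing.scale /=; case: ifP; rewrite ?mulr0// mulrCA.
Qed.

Lemma contract_eD k : {morph (@contract_e R n k) : v w / v + w}.
Proof. by move=> v w; apply/ffunP => I; rewrite !ffunE; case: ifP; rewrite ?mulrDr ?addr0. Qed.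

Lemma contract_eZ k (a : R[i]) w : contract_e k (a *: w) = a *: contract_e k w.
Proof.
by apply/ffunP => I; rewrite !ffunE /GRing.scale /=; case: ifP; rewrite ?mulr0// mulrCA.
Qed.

Lemma wedge_e0 k : wedge_e k (0 : form) = 0.
Proof. by rewrite -(scale0r (0 : form)) wedge_eZ !scale0r. Qed.

Lemma contract_e0 k : contract_e k (0 : form) = 0.
Proof. by rewrite -(scale0r (0 : form)) contract_eZ !scale0r. Qed.

Lemma wedge_e_sum k (J : finType) (F : J -> form) :
  wedge_e k (\sum_j F j) = \sum_j wedge_e k (F j).
Proof. exact: (big_morph _ (wedge_eD k) (wedge_e0 k)). Qed.

Lemma contract_e_sum k (J : finType) (F : J -> form) :
  contract_e k (\sum_j F j) = \sum_j contract_e k (F j).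
Proof. exact: (big_morph _ (contract_eD k) (contract_e0 k)). Qed.

Lemma wedge_ee k w : wedge_e k (wedge_e k w) = 0.
Proof. by apply/ffunP => I; rewrite !ffunE !inE eqxx; case: ifP; rewrite ?mulr0. Qed.

Lemma contract_ee k w : contract_e k (contract_e k w) = 0.
Proof. by apply/ffunP => I; rewrite !ffunE !inE eqxx; case: ifP; rewrite ?mulr0. Qed.

(** Each k in [I] contributes [w I] once, because the two signs multiply to 1, and #|I| = p wherever
    [w] is nonzero. *)
Lemma sum_wedge_contract p w : pform p w ->
  \sum_k wedge_e k (contract_e k w) = p%:R *: w.
Proof.
move=> pw; apply/ffunP => I; rewrite sum_ffunE !ffunE /GRing.scale /=.
have [cI|cI] := eqVneq #|I| p; last first.
  rewrite (pw I cI) mulr0; apply: big1 => k _; rewrite !ffunE !inE.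
  by case: ifP => // kI; rewrite eqxx /= finset.setD1K// (pw I cI) !mulr0.
rewrite (bigID (mem I)) /= [X in _ + X]big1 ?addr0; last first.
  by move=> k kI; rewrite !ffunE (negPf kI).
rewrite (eq_bigr (fun=> w I)).
  by rewrite sumr_const mulr_natl -cI; congr (_ *+ _); apply: eq_card.
move=> k kI; rewrite !ffunE !inE kI eqxx /= finset.setD1K// basis_signD1 mulrA.
by rewrite basis_sign_sqr mul1r.
Qed.

Lemma sum_contract_wedge p w : pform p w ->
  \sum_k contract_e k (wedge_e k w) = (n%:R - p%:R) *: w.
Proof.
move=> pw; rewrite scalerBl -(sum_wedge_contract pw).
rewrite (eq_bigr (fun k => w - wedge_e k (contract_e k w))).
  by rewrite big_split /= sumr_const card_ord sumrN scaler_nat.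
move=> k _; have := contract_wedge k k w; rewrite eqxx scale1r => E.
by rewrite -{2}E addrK.
Qed.

Local Notation Rn := ('rV[R]_n).
Implicit Types x : Rn.

Lemma eps_vecD x : {morph (@eps_vec R n x) : v w / v + w}.
Proof.
move=> v w; rewrite /eps_vec -big_split /=.
by apply: eq_bigr => k _; rewrite wedge_eD scalerDr.
Qed.

Lemma iota_vecD x : {morph (@iota_vec R n x) : v w / v + w}.
Proof.
move=> v w; rewrite /iota_vec -big_split /=.
by apply: eq_bigr => k _; rewrite contract_eD scalerDr.
Qed.

Lemma wedge_eps k x w : wedge_e k (eps_vec x w) = - eps_vec x (wedge_e k w).
Proof.
rewrite /eps_vec wedge_e_sum -sumrN; apply: eq_bigr => l _.
by rewrite wedge_eZ wedge_eC scalerN.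
Qed.

Lemma contract_iota k x w : contract_e k (iota_vec x w) = - iota_vec x (contract_e k w).
Proof.
rewrite /iota_vec contract_e_sum -sumrN; apply: eq_bigr => l _.
by rewrite contract_eZ contract_eC scalerN.
Qed.

Lemma eq_opp_form w : w = - w -> w = 0.
Proof.
move=> /eqP; rewrite -addr_eq0 -mulr2n => /eqP w2; apply/ffunP => I.
have /eqP := congr1 (fun u : form => u I) w2.
by rewrite ffunMnE !ffunE mulrn_eq0 /= => /eqP.
Qed.

(** The coefficients x_k x_l are symmetric and the products of wedges antisymmetric, so the double
    sum equals its own opposite. *)
Lemma eps_eps x w : eps_vec x (eps_vec x w) = 0.
Proof.
have E : eps_vec x (eps_vec x w) =
    \sum_k \sum_l ((x ord0 k)%:C%C * (x ord0 l)%:C%C) *: wedge_e k (wedge_e l w).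
  rewrite [LHS]/eps_vec; apply: eq_bigr => k _; rewrite /eps_vec wedge_e_sum scaler_sumr.
  by apply: eq_bigr => l _; rewrite wedge_eZ scalerA.
apply: eq_opp_form; rewrite {1}E exchange_big E -sumrN.
apply: eq_bigr => k _; rewrite -sumrN; apply: eq_bigr => l _.
by rewrite wedge_eC scalerN mulrC.
Qed.

Lemma iota_iota x w : iota_vec x (iota_vec x w) = 0.
Proof.
have E : iota_vec x (iota_vec x w) =
    \sum_k \sum_l ((x ord0 k)%:C%C * (x ord0 l)%:C%C) *: contract_e k (contract_e l w).
  rewrite [LHS]/iota_vec; apply: eq_bigr => k _; rewrite /iota_vec contract_e_sum scaler_sumr.
  by apply: eq_bigr => l _; rewrite contract_eZ scalerA.
apply: eq_opp_form; rewrite {1}E exchange_big E -sumrN.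
apply: eq_bigr => k _; rewrite -sumrN; apply: eq_bigr => l _.
by rewrite contract_eC scalerN mulrC.
Qed.

Lemma iota_eps x w : iota_vec x (eps_vec x w) + eps_vec x (iota_vec x w) =
  (\sum_k (x ord0 k)%:C%C * (x ord0 k)%:C%C) *: w.
Proof.
have -> : eps_vec x (iota_vec x w) =
    \sum_k \sum_l ((x ord0 k)%:C%C * (x ord0 l)%:C%C) *: wedge_e l (contract_e k w).
  rewrite /eps_vec exchange_big; apply: eq_bigr => l _.
  rewrite /iota_vec wedge_e_sum scaler_sumr; apply: eq_bigr => k _.
  by rewrite wedge_eZ scalerA mulrC.
have -> : iota_vec x (eps_vec x w) =
    \sum_k \sum_l ((x ord0 k)%:C%C * (x ord0 l)%:C%C) *: contract_e k (wedge_e l w).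
  rewrite /iota_vec; apply: eq_bigr => k _.
  rewrite /eps_vec contract_e_sum scaler_sumr; apply: eq_bigr => l _.
  by rewrite contract_eZ scalerA.
rewrite -big_split scaler_suml; apply: eq_bigr => k _ /=.
rewrite -big_split (bigD1 k)//= -scalerDr contract_wedge eqxx scale1r big1 ?addr0// => l lk.
by rewrite -scalerDr contract_wedge eq_sym (negPf lk) scale0r scaler0.
Qed.

End exterior_algebra.
(** * Distributions given by form-valued densities *)

Section form_valued.
Context {R : realType} {n : nat}.
Local Notation Rn := ('rV[R]_n).
Local Notation form := (dform R n).
Implicit Types (W V : Rn -> form) (F G : Rn -> R[i]) (k l : 'I_n) (f : Rn -> R[i])
  (I J : {set 'I_n}).

(** The class of densities that may be integrated against a Schwartz function; closed under sums and
    products. *)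
Definition nice F := ccont F /\ pgrowth F.

Lemma nice_cst c : nice (fun=> c).
Proof. by split; [exact: ccont_cst|exact: pgrowth_cst]. Qed.

Lemma niceD F G : nice F -> nice G -> nice (fun x => F x + G x).
Proof. by move=> [F1 F2] [G1 G2]; split; [exact: ccontD|exact: pgrowthD]. Qed.

Lemma niceM F G : nice F -> nice G -> nice (fun x => F x * G x).
Proof. by move=> [F1 F2] [G1 G2]; split; [exact: ccontM|exact: pgrowthM]. Qed.

Lemma nice_coord k : nice (coordC k).
Proof. by split; [exact: ccont_coord|exact: pgrowth_coord]. Qed.

Lemma nice_rpow (z : R[i]) : 4 <= complex.Re z -> nice (rpow z : Rn -> R[i]).
Proof.
by move=> z4; split; [exact: ccont_rpow|apply: pgrowth_rpow; apply: le_trans z4].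
Qed.

Definition fnice W := forall I, nice (fun x => W x I).

Definition fderiv k W V := forall I, pderiv k (fun x => W x I) (fun x => V x I).

Lemma fnice_ext W V : W =1 V -> fnice W -> fnice V.
Proof. by move=> WV; rewrite (funext WV). Qed.

Lemma fderiv_ext k W V W' V' : W =1 W' -> V =1 V' -> fderiv k W V -> fderiv k W' V'.
Proof. by move=> E1 E2; rewrite (funext E1) (funext E2). Qed.

Lemma pderiv_ext k F G F' G' : F =1 F' -> G =1 G' -> pderiv k F G -> pderiv k F' G'.
Proof. by move=> E1 E2; rewrite (funext E1) (funext E2). Qed.

Lemma fnice_cst w : fnice (fun=> w).
Proof. by move=> I; exact: nice_cst. Qed.

Lemma fniceD W V : fnice W -> fnice V -> fnice (fun x => W x + V x).
Proof.
move=> nW nV I; under [X in nice X]eq_fun do rewrite ffunE; exact: niceD.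
Qed.

Lemma fniceZ F W : nice F -> fnice W -> fnice (fun x => F x *: W x).
Proof.
move=> nF nW I; under [X in nice X]eq_fun do rewrite ffunE; exact: niceM.
Qed.

Lemma fnice_sum (T : Type) (r : seq T) (Vs : T -> Rn -> form) :
  (forall t, fnice (Vs t)) -> fnice (fun x => \sum_(t <- r) Vs t x).
Proof.
move=> nV; elim: r => [|t r IH].
  by apply: (@fnice_ext (fun=> 0)); [move=> x; rewrite big_nil|exact: fnice_cst].
apply: (@fnice_ext (fun x => Vs t x + \sum_(t <- r) Vs t x)).
  by move=> x; rewrite big_cons.
exact: fniceD.
Qed.

Lemma fnice_wedge k W : fnice W -> fnice (fun x => wedge_e k (W x)).
Proof.
move=> nW I; under [X in nice X]eq_fun do rewrite ffunE.
by case: (_ \in I) => /=; [apply: niceM => //; exact: nice_cst|exact: nice_cst].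
Qed.

Lemma fnice_contract k W : fnice W -> fnice (fun x => contract_e k (W x)).
Proof.
move=> nW I; under [X in nice X]eq_fun do rewrite ffunE.
by case: (_ \in I) => /=; [exact: nice_cst|apply: niceM => //; exact: nice_cst].
Qed.

Lemma fnice_eps W : fnice W -> fnice (fun x => eps_vec x (W x)).
Proof.
move=> nW; apply: fnice_sum => l; apply: fniceZ; first exact: nice_coord.
exact: fnice_wedge.
Qed.

Lemma fnice_iota W : fnice W -> fnice (fun x => iota_vec x (W x)).
Proof.
move=> nW; apply: fnice_sum => l; apply: fniceZ; first exact: nice_coord.
exact: fnice_contract.
Qed.

Lemma fderiv_cst k w : fderiv k (fun=> w) (fun=> 0).
Proof.
move=> I; under [X in pderiv _ _ X]eq_fun do rewrite ffunE; exact: pderiv_cst.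
Qed.

Lemma fderivD k W W' V V' : fderiv k W W' -> fderiv k V V' ->
  fderiv k (fun x => W x + V x) (fun x => W' x + V' x).
Proof.
by move=> dW dV I; apply: pderiv_ext (pderivD (dW I) (dV I)) => x; rewrite ffunE.
Qed.

Lemma fderivZ k F F' W W' : pderiv k F F' -> fderiv k W W' ->
  fderiv k (fun x => F x *: W x) (fun x => F' x *: W x + F x *: W' x).
Proof.
by move=> dF dW I; apply: pderiv_ext (pderivM dF (dW I)) => x; rewrite !ffunE.
Qed.

Lemma fderiv_sum k (T : Type) (r : seq T) (Ws Vs : T -> Rn -> form) :
  (forall t, fderiv k (Ws t) (Vs t)) ->
  fderiv k (fun x => \sum_(t <- r) Ws t x) (fun x => \sum_(t <- r) Vs t x).
Proof.
move=> dV; elim: r => [|t r IH].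
  by apply: (@fderiv_ext _ (fun=> 0) (fun=> 0)) (fderiv_cst _ _) => x; rewrite big_nil.
by apply: fderiv_ext (fderivD (dV t) IH) => x; rewrite big_cons.
Qed.

Lemma fderiv_wedge k l W V : fderiv k W V ->
  fderiv k (fun x => wedge_e l (W x)) (fun x => wedge_e l (V x)).
Proof.
move=> dW I.
apply: pderiv_ext (pderivM (pderiv_cst k (if l \in I then basis_sign R l I else 0))
  (dW (I :\ l))) => x.
  by rewrite ffunE; case: ifP; rewrite ?mul0r.
by rewrite ffunE mul0r add0r; case: ifP; rewrite ?mul0r.
Qed.

Lemma fderiv_contract k l W V : fderiv k W V ->
  fderiv k (fun x => contract_e l (W x)) (fun x => contract_e l (V x)).
Proof.
move=> dW I.
apply: pderiv_ext (pderivM (pderiv_cst k (if l \notin I then basis_sign R l I else 0))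
  (dW (l |: I))) => x.
  by rewrite ffunE; case: ifP; rewrite ?mul0r.
by rewrite ffunE mul0r add0r; case: ifP; rewrite ?mul0r.
Qed.

Lemma sum_delta_form k (v : 'I_n -> form) : \sum_l (l == k)%:R *: v l = v k.
Proof.
rewrite (bigD1 k)//= eqxx scale1r big1 ?addr0// => l lk.
by rewrite (negPf lk) scale0r.
Qed.

Lemma fderiv_eps k W V : fderiv k W V ->
  fderiv k (fun x => eps_vec x (W x)) (fun x => wedge_e k (W x) + eps_vec x (V x)).
Proof.
move=> dW; have dl l := fderivZ (pderiv_coord k l) (fderiv_wedge l dW).
apply: fderiv_ext (fderiv_sum (index_enum 'I_n) dl) => x //.
by rewrite big_split /= sum_delta_form.
Qed.

Lemma fderiv_iota k W V : fderiv k W V ->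
  fderiv k (fun x => iota_vec x (W x)) (fun x => contract_e k (W x) + iota_vec x (V x)).
Proof.
move=> dW; have dl l := fderivZ (pderiv_coord k l) (fderiv_contract l dW).
apply: fderiv_ext (fderiv_sum (index_enum 'I_n) dl) => x //.
by rewrite big_split /= sum_delta_form.
Qed.

Definition density_distr W : fdistr R n := fun f =>
  [ffun I => cintegral (fun x => f x * W x I)].

Lemma density_distrE W f I : density_distr W f I = cintegral (fun x => f x * W x I).
Proof. by rewrite ffunE. Qed.

Lemma cintegral_schwartzD f F G : schwartz f -> nice F -> nice G ->
  cintegral (fun x => f x * (F x + G x)) =
  cintegral (fun x => f x * F x) + cintegral (fun x => f x * G x).
Proof.
move=> sf [F1 F2] [G1 G2]; under [X in cintegral X = _]eq_fun do rewrite mulrDr.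
have cf := schwartz_ccont sf.
by apply: cintegralD; (exact: ccontM || exact: dominated_schwartzM).
Qed.

Lemma cintegral_schwartzZ f c F : schwartz f -> nice F ->
  cintegral (fun x => f x * (c * F x)) = c * cintegral (fun x => f x * F x).
Proof.
move=> sf [F1 F2]; under [X in cintegral X = _]eq_fun do rewrite mulrCA.
have cf := schwartz_ccont sf.
by apply: cintegralZ; (exact: ccontM || exact: dominated_schwartzM).
Qed.

Lemma cintegral_schwartz0 f : schwartz f -> cintegral (fun x => f x * 0) = 0.
Proof.
move=> sf; have := cintegral_schwartzZ 0 sf (nice_cst 0).
rewrite [RHS]mul0r => {2}<-; congr cintegral; apply/funext => x.
by rewrite mul0r.
Qed.

Lemma density_distrD W V f : schwartz f -> fnice W -> fnice V ->
  density_distr (fun x => W x + V x) f = density_distr W f + density_distr V f.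
Proof.
move=> sf nW nV; apply/ffunP => I; rewrite !ffunE.
under [X in cintegral X = _]eq_fun do rewrite ffunE.
exact: cintegral_schwartzD.
Qed.

Lemma density_distrZ c W f : schwartz f -> fnice W ->
  density_distr (fun x => c *: W x) f = c *: density_distr W f.
Proof.
move=> sf nW; apply/ffunP => I; rewrite !ffunE.
under [X in cintegral X = _]eq_fun do rewrite ffunE.
exact: cintegral_schwartzZ.
Qed.

Lemma density_distr_sum (Vs : 'I_n -> Rn -> form) f : schwartz f ->
  (forall l, fnice (Vs l)) ->
  density_distr (fun x => \sum_l Vs l x) f = \sum_l density_distr (Vs l) f.
Proof.
move=> sf nV; elim: (index_enum _) => [|l r IH].
  rewrite big_nil; apply/ffunP => I; rewrite !ffunE.
  under [X in cintegral X = _]eq_fun do rewrite big_nil ffunE.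
  exact: cintegral_schwartz0.
rewrite big_cons -IH -density_distrD//; last exact: fnice_sum.
by congr density_distr; apply/funext => x; rewrite big_cons.
Qed.

Lemma density_distr_wedge k W f : schwartz f -> fnice W ->
  density_distr (fun x => wedge_e k (W x)) f = wedge_e k (density_distr W f).
Proof.
move=> sf nW; apply/ffunP => I; rewrite !ffunE.
under [X in cintegral X = _]eq_fun do rewrite ffunE.
by case: (_ \in I) => /=; [exact: cintegral_schwartzZ|exact: cintegral_schwartz0].
Qed.

Lemma density_distr_contract k W f : schwartz f -> fnice W ->
  density_distr (fun x => contract_e k (W x)) f = contract_e k (density_distr W f).
Proof.
move=> sf nW; apply/ffunP => I; rewrite !ffunE.
under [X in cintegral X = _]eq_fun do rewrite ffunE.
by case: (_ \in I) => /=; [exact: cintegral_schwartz0|exact: cintegral_schwartzZ].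
Qed.

Lemma density_distr_partial k W V f : schwartz f -> fderiv k W V ->
  fnice W -> fnice V ->
  density_distr W (partial k f) = - density_distr V f.
Proof.
move=> sf dW nW nV; apply/ffunP => I; rewrite !ffunE.
by have [w1 w2] := nW I; have [v1 v2] := nV I; apply: (schwartz_by_parts sf (dW I)).
Qed.

(** Restricted to Schwartz functions, the only arguments at which a distribution is meaningful. *)
Definition has_density (T : fdistr R n) W := forall f, schwartz f -> T f = density_distr W f.

(** The sign in [dpartial] cancels the one from integration by parts, so d acts pointwise on the
    density. *)
Lemma has_density_ext_d T W (V : 'I_n -> Rn -> form) : has_density T W -> fnice W ->
  (forall k, fderiv k W (V k)) -> (forall k, fnice (V k)) ->
  has_density (ext_d T) (fun x => \sum_k wedge_e k (V k x)).
Proof.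
move=> TW nW dW nV f sf; rewrite density_distr_sum//; last first.
  by move=> k; exact: fnice_wedge.
apply: eq_bigr => k _; rewrite density_distr_wedge//; congr wedge_e.
rewrite /dpartial TW; last exact: schwartz_partial.
by rewrite (density_distr_partial sf (dW k))// opprK.
Qed.

Lemma ext_d_form_at I f J x : ext_d_form (form_at I f) x J =
  \sum_k (if (k \in J) && (J :\ k == I) then basis_sign R k J else 0) * partial k f x.
Proof.
rewrite /ext_d_form sum_ffunE; apply: eq_bigr => k _; rewrite !ffunE.
case: (k \in J) => /=; last by rewrite mul0r.
case: (eqVneq (J :\ k) I) => [E|E].
  congr (_ * _); congr (partial _ _ _); apply/funext => y.
  by rewrite /form_at ffunE E eqxx.
rewrite mul0r (_ : (fun y => _) = fun=> 0) ?partial0 ?mulr0//.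
by apply/funext => y; rewrite /form_at ffunE (negPf E).
Qed.

(** In the pairing with d (f e_I) only the components J = I with one index k added survive, which
    turns the wedge into a contraction; integration by parts leaves the factor -1. *)
Lemma has_density_codiff T W (V : 'I_n -> Rn -> form) : has_density T W -> fnice W ->
  (forall k, fderiv k W (V k)) -> (forall k, fnice (V k)) ->
  has_density (codiff T) (fun x => \sum_k (-1) *: contract_e k (V k x)).
Proof.
move=> TW nW dW nV f sf; apply/ffunP => I; rewrite ffunE /pairing.
pose c k (J : {set 'I_n}) := if (k \in J) && (J :\ k == I) then basis_sign R k J else 0.
have wE J : (fun x => ext_d_form (form_at I f) x J) = (fun x => \sum_k c k J * partial k f x).
  by apply/funext => x; rewrite ext_d_form_at.
have swJ J : schwartz (fun x => \sum_k c k J * partial k f x).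
  by apply: schwartz_sum => k; exact: schwartz_partial.
have cint0 : cintegral (fun _ : Rn => 0) = 0.
  by rewrite -[RHS](cintegral_schwartz0 sf); congr cintegral; apply/funext => x; rewrite mulr0.
have TJ J : T (fun x => ext_d_form (form_at I f) x J) J =
    \sum_k c k J * - density_distr (V k) f J.
  rewrite wE TW// ffunE.
  (* Stated for an arbitrary list so that additivity of the integral can be applied by induction. *)
  have step (r : seq 'I_n) : cintegral (fun x => (\sum_(k <- r) c k J * partial k f x) * W x J) =
      \sum_(k <- r) c k J * - density_distr (V k) f J.
    have [W1 W2] := nW J.
    elim: r => [|k r IH].
      by under [X in cintegral X = _]eq_fun do rewrite big_nil mul0r; rewrite big_nil.
    under [X in cintegral X = _]eq_fun do rewrite big_cons mulrDl -mulrA.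
    have sr : schwartz (fun x => \sum_(k <- r) c k J * partial k f x).
      by apply: schwartz_sum => l; exact: schwartz_partial.
    have spk := schwartz_partial k sf.
    have cpk := schwartz_ccont spk; have cr := schwartz_ccont sr.
    rewrite big_cons -IH cintegralD; first last.
    - exact: dominated_schwartzM.
    - exact: ccontM.
    - by apply: dominatedZ; exact: dominated_schwartzM.
    - by apply: ccontM; [exact: ccont_cst|exact: ccontM].
    congr (_ + _); rewrite cintegralZ; [|exact: ccontM|exact: dominated_schwartzM].
    congr (_ * _); have := congr1 (fun u : form => u J) (density_distr_partial sf (dW k) nW (nV k)).
    by rewrite !ffunE.
  exact: step.
rewrite (eq_bigr _ (fun J _ => TJ J)) exchange_big /=.
have nC k : fnice (fun x => (-1) *: contract_e k (V k x)).
  by apply: fniceZ; [exact: nice_cst|exact: fnice_contract].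
rewrite density_distr_sum// sum_ffunE; apply: eq_bigr => k _.
rewrite density_distrZ; [|exact: sf|exact: fnice_contract].
rewrite density_distr_contract//.
set u := density_distr (V k) f; rewrite !ffunE /GRing.scale /= mulN1r.
(* If k is in [I], no J satisfies J minus k = I and both sides vanish; otherwise J is [I] with k
   added. *)
have [kI|kI] /= := boolP (k \in I).
  rewrite oppr0; apply: big1 => J _; rewrite /c; case: ifP; rewrite ?mul0r//.
  by move=> /andP[_ /eqP E]; move: kI; rewrite -E !inE eqxx.
rewrite (bigD1 (k |: I))//= big1 ?addr0; last first.
  move=> J JI; rewrite /c; case: ifP; rewrite ?mul0r// => /andP[kJ /eqP E].
  by move: JI; rewrite -E finset.setD1K// eqxx.
by rewrite /c finset.setU1K// !inE !eqxx /= basis_signU1 mulrN /u ffunE.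
Qed.

End form_valued.

(** * Linear algebra for combining the two components of the density *)

Section module_identities.
Context {K : comNzRingType} {V : lmodType K}.
Implicit Types (r s a b c d : K) (u v w : V).

(** Meant for u = i_x eps_x beta, v = eps_x i_x beta, r a power of the radius and w = r |x|^2 beta:
    one of the two components is traded for a radial multiple of beta. *)
Lemma scale_two_term r a b u v w : w = r *: u + r *: v ->
  r *: (a *: u + b *: v) = a *: w + (b - a) *: (r *: v).
Proof.
move=> ->; rewrite scalerBl !scalerDr !scalerA !(mulrC r) -addrA; congr (_ + _).
by rewrite addrC subrK.
Qed.

Lemma scale_two_term_left r a b u v w : w = r *: u + r *: v ->
  r *: (a *: u + b *: v) = b *: w + (a - b) *: (r *: u).
Proof. by move=> E; rewrite addrC (@scale_two_term _ _ _ v u w)// addrC. Qed.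

(** Eliminates w = beta from delta d and d delta of the density and compares the coefficients of i_x
    eps_x beta and eps_x i_x beta, which gives the two scalar conditions. *)
Lemma scale_collect c1 d1 c2 d2 l q p r s k a b u v w :
  s *: w = r *: u + r *: v ->
  c1 * d1 * (l + q) + c2 * d2 * p = k * a ->
  c1 * d1 * q + c2 * d2 * (l + p) = k * b ->
  c1 *: (d1 *: ((l * r) *: u + (q * s) *: w)) +
    c2 *: (d2 *: ((l * r) *: v + (p * s) *: w)) =
  k *: (r *: (a *: u + b *: v)).
Proof.
move=> E H1 H2; rewrite -(scalerA q s) -(scalerA p s) E !scalerDr !scalerA.
have -> : k * r * a = c1 * d1 * (l * r) + c1 * d1 * q * r + c2 * d2 * p * r.
  by rewrite mulrAC -H1; ring.
have -> : k * r * b = c1 * d1 * q * r + c2 * d2 * (l * r) + c2 * d2 * p * r.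
  by rewrite mulrAC -H2; ring.
have AC (x1 x2 y1 y2 x3 y3 : V) :
    x1 + (x2 + y1) + (y2 + (x3 + y3)) = x1 + x2 + x3 + (y1 + y2 + y3).
  by rewrite (addrA x1) (addrCA y2) addrACA (addrA y1).
by rewrite !scalerDl AC.
Qed.

End module_identities.

(** * The Bernstein-Sato type identity in a half-plane *)

Section riesz_calculus.
Context {R : realType} {n : nat}.
Local Notation Rn := ('rV[R]_n).
Local Notation form := (dform R n).
Implicit Types (w : form) (k : 'I_n) (z : R[i]) (x : Rn).

Lemma eps_vec0 x : eps_vec x (0 : form) = 0.
Proof. by rewrite /eps_vec big1// => k _; rewrite wedge_e0 scaler0. Qed.

Lemma iota_vec0 x : iota_vec x (0 : form) = 0.
Proof. by rewrite /iota_vec big1// => k _; rewrite contract_e0 scaler0. Qed.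

Lemma eps_vec_sum x (F : 'I_n -> form) : eps_vec x (\sum_k F k) = \sum_k eps_vec x (F k).
Proof. exact: (big_morph _ (eps_vecD x) (eps_vec0 x)). Qed.

Lemma iota_vec_sum x (F : 'I_n -> form) : iota_vec x (\sum_k F k) = \sum_k iota_vec x (F k).
Proof. exact: (big_morph _ (iota_vecD x) (iota_vec0 x)). Qed.

Lemma eps_vecZ x (c : R[i]) w : eps_vec x (c *: w) = c *: eps_vec x w.
Proof.
rewrite /eps_vec scaler_sumr; apply: eq_bigr => k _.
by rewrite wedge_eZ !scalerA mulrC.
Qed.

Lemma iota_vecZ x (c : R[i]) w : iota_vec x (c *: w) = c *: iota_vec x w.
Proof.
rewrite /iota_vec scaler_sumr; apply: eq_bigr => k _.
by rewrite contract_eZ !scalerA mulrC.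
Qed.

(** The k-th derivative of a power of the radius is proportional to x_k, and summing over k
    reassembles eps_x. *)
Lemma sum_wedge_coord x (c d : R[i]) w :
  \sum_k wedge_e k ((c * coordC k x * d) *: w) = (c * d) *: eps_vec x w.
Proof.
rewrite /eps_vec scaler_sumr; apply: eq_bigr => k _.
by rewrite wedge_eZ scalerA mulrAC.
Qed.

Lemma sum_contract_coord x (c d : R[i]) w :
  \sum_k contract_e k ((c * coordC k x * d) *: w) = (c * d) *: iota_vec x w.
Proof.
rewrite /iota_vec scaler_sumr; apply: eq_bigr => k _.
by rewrite contract_eZ scalerA mulrAC.
Qed.

Definition rpow_form z (W : Rn -> form) x : form := rpow z x *: W x.

Lemma fderiv_rpow k z W V : 4 <= complex.Re z -> fderiv k W V ->
  fderiv k (rpow_form z W)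
    (fun x => (z * coordC k x * rpow (z - 2) x) *: W x + rpow z x *: V x).
Proof. by move=> z4 dW; exact: fderivZ (pderiv_rpow k z4) dW. Qed.

Lemma fnice_rpow_form z W : 4 <= complex.Re z -> fnice W -> fnice (rpow_form z W).
Proof. by move=> z4 nW; apply: fniceZ => //; exact: nice_rpow. Qed.

Lemma fnice_fderiv_rpow k z W V : 6 <= complex.Re z -> fnice W -> fnice V ->
  fnice (fun x => (z * coordC k x * rpow (z - 2) x) *: W x + rpow z x *: V x).
Proof.
move=> z6 nW nV; apply: fniceD; apply: fniceZ => //; last first.
  by apply: nice_rpow; apply: le_trans z6; rewrite ler_nat.
apply: niceM; last by apply: nice_rpow; rewrite ReB2; lra.
by apply: niceM; [exact: nice_cst|exact: nice_coord].
Qed.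

Lemma fderivZl k (c : R[i]) W V : fderiv k W V ->
  fderiv k (fun x => c *: W x) (fun x => c *: V x).
Proof.
move=> dW; apply: fderiv_ext (fderivZ (pderiv_cst k c) dW) => x //.
by rewrite scale0r add0r.
Qed.

Lemma fniceZl (c : R[i]) W : fnice W -> fnice (fun x => c *: W x).
Proof. by move=> nW; apply: fniceZ => //; exact: nice_cst. Qed.

Variables (p : nat) (beta : form) (pbeta : pform p beta).

Lemma fderiv_iota_cst k : fderiv k (fun x => iota_vec x beta) (fun=> contract_e k beta).
Proof.
apply: fderiv_ext (fderiv_iota (fderiv_cst k beta)) => x //.
by rewrite iota_vec0 addr0.
Qed.

Lemma fderiv_eps_cst k : fderiv k (fun x => eps_vec x beta) (fun=> wedge_e k beta).
Proof.
apply: fderiv_ext (fderiv_eps (fderiv_cst k beta)) => x //.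
by rewrite eps_vec0 addr0.
Qed.

Lemma fderiv_eps_iota k : fderiv k (fun x => eps_vec x (iota_vec x beta))
  (fun x => wedge_e k (iota_vec x beta) + eps_vec x (contract_e k beta)).
Proof. exact: fderiv_eps (fderiv_iota_cst k). Qed.

Lemma fderiv_iota_eps k : fderiv k (fun x => iota_vec x (eps_vec x beta))
  (fun x => contract_e k (eps_vec x beta) + iota_vec x (wedge_e k beta)).
Proof. exact: fderiv_iota (fderiv_eps_cst k). Qed.

Lemma fnice_iota_cst : fnice (fun x => iota_vec x beta).
Proof. exact: fnice_iota (fnice_cst _). Qed.

Lemma fnice_eps_cst : fnice (fun x => eps_vec x beta).
Proof. exact: fnice_eps (fnice_cst _). Qed.

(** The first summand dies since e_k /\ e_k = 0; moving e_k past eps_x in the second gives a sign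
    and the degree-counting sum. *)
Lemma sum_wedge_eps_iota x :
  \sum_k wedge_e k (wedge_e k (iota_vec x beta) + eps_vec x (contract_e k beta)) =
  - p%:R *: eps_vec x beta.
Proof.
rewrite (eq_bigr (fun k => - eps_vec x (wedge_e k (contract_e k beta)))).
  by rewrite sumrN -eps_vec_sum (sum_wedge_contract pbeta) eps_vecZ scaleNr.
by move=> k _; rewrite wedge_eD wedge_ee add0r wedge_eps.
Qed.

Lemma sum_contract_iota_eps x :
  \sum_k contract_e k (contract_e k (eps_vec x beta) + iota_vec x (wedge_e k beta)) =
  - (n%:R - p%:R) *: iota_vec x beta.
Proof.
rewrite (eq_bigr (fun k => - iota_vec x (contract_e k (wedge_e k beta)))).
  by rewrite sumrN -iota_vec_sum (sum_contract_wedge pbeta) iota_vecZ scaleNr.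
by move=> k _; rewrite contract_eD contract_ee add0r contract_iota.
Qed.

(** Differentiating r^lam leaves r^(lam-2), and powers are only treated for real part at least 4;
    the bound 10 leaves a margin and still gives a half-plane. *)
Variables (A B : R[i] -> R[i]) (lam : R[i]) (lam10 : 10 <= complex.Re lam).

Let a := A (lam + 2).
Let b := B (lam + 2).
Let C' := Ccoef p A B (lam + 2).
Let D' := Dcoef n p A B (lam + 2).

Let Relam2 : complex.Re (lam + 2) = complex.Re lam + 2.
Proof. by rewrite cReD; congr (_ + _); exact: Re2. Qed.

Let lam4 : 4 <= complex.Re lam. Proof. by have := lam10; lra. Qed.
Let lam6 : 6 <= complex.Re lam. Proof. by have := lam10; lra. Qed.
Let lam24 : 4 <= complex.Re (lam + 2). Proof. by have := lam10; rewrite Relam2; lra. Qed.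
Let lam26 : 6 <= complex.Re (lam + 2). Proof. by have := lam10; rewrite Relam2; lra. Qed.

Let rpow_iota_eps z x : 4 <= complex.Re z ->
  rpow z x *: iota_vec x (eps_vec x beta) + rpow z x *: eps_vec x (iota_vec x beta) =
  rpow (z + 2) x *: beta.
Proof.
move=> z4; have z0 : complex.Re z != 0 by rewrite gt_eqF//; lra.
have z2 : complex.Re z + 2 != 0 by rewrite gt_eqF//; lra.
by rewrite -scalerDr iota_eps scalerA (rpowD2 _ z0 z2) mulrC mulr_suml.
Qed.

Let W0 x := riesz_density A B (lam + 2) x beta.

Let W0E x : W0 x =
  rpow lam x *: (a *: iota_vec x (eps_vec x beta) + b *: eps_vec x (iota_vec x beta)).
Proof. by rewrite /W0 /riesz_density addrK. Qed.

(** Prepared for d: the gradient of the power in front of eps_x i_x beta contributes nothing,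
    because eps_x eps_x = 0. The form [W0_delta] plays the same role for delta, through i_x i_x =
    0. *)
Let W0_d x : W0 x = a *: rpow_form (lam + 2) (fun=> beta) x +
  (b - a) *: rpow_form lam (fun x => eps_vec x (iota_vec x beta)) x.
Proof.
rewrite W0E; apply: scale_two_term; apply/esym; exact: rpow_iota_eps.
Qed.

Let W0_delta x : W0 x = b *: rpow_form (lam + 2) (fun=> beta) x +
  (a - b) *: rpow_form lam (fun x => iota_vec x (eps_vec x beta)) x.
Proof.
rewrite W0E; apply: scale_two_term_left; apply/esym; exact: rpow_iota_eps.
Qed.

Let fnice_W0 : fnice W0.
Proof.
apply: (fnice_ext (fun x => esym (W0_d x))); apply: fniceD; apply: fniceZl.
  by apply: fnice_rpow_form => //; exact: fnice_cst.
by apply: fnice_rpow_form => //; apply: fnice_eps; exact: fnice_iota_cst.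
Qed.

(** The two terms of [W0_d] contribute a (lam + 2) and -p (b - a), whose sum is [C']. *)
Lemma has_density_d_riesz T : has_density T W0 ->
  has_density (ext_d T) (fun x => C' *: rpow_form lam (fun x => eps_vec x beta) x).
Proof.
move=> TW.
pose V k x := a *: (((lam + 2) * coordC k x * rpow (lam + 2 - 2) x) *: beta + rpow (lam + 2) x *: 0)
 + (b - a) *: ((lam * coordC k x * rpow (lam - 2) x) *: eps_vec x (iota_vec x beta) +
     rpow lam x *: (wedge_e k (iota_vec x beta) + eps_vec x (contract_e k beta))).
have dV k : fderiv k W0 (V k).
  apply: (fderiv_ext (fun x => esym (W0_d x)) (fun=> erefl)).
  by apply: fderivD; apply: fderivZl; apply: fderiv_rpow => //;
    [exact: fderiv_cst|exact: fderiv_eps_iota].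
have nV k : fnice (V k).
  apply: fniceD; apply: fniceZl; apply: fnice_fderiv_rpow => //.
  - exact: fnice_cst.
  - exact: fnice_cst.
  - by apply: fnice_eps; exact: fnice_iota_cst.
  - apply: fniceD; [|by apply: fnice_eps; exact: fnice_cst].
    by apply: fnice_wedge; exact: fnice_iota_cst.
have := has_density_ext_d TW fnice_W0 dV nV.
rewrite (_ : (fun x => \sum_k wedge_e k (V k x)) =
  (fun x => C' *: rpow_form lam (fun x => eps_vec x beta) x))//.
apply/funext => x; rewrite /V /rpow_form.
under eq_bigr do rewrite scaler0 addr0 wedge_eD wedge_eZ [X in _ + X]wedge_eZ wedge_eD
  [X in _ + _ *: (_ + X)]wedge_eZ.
rewrite big_split /= -!scaler_sumr big_split /= -scaler_sumr !sum_wedge_coord.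
rewrite sum_wedge_eps_iota eps_eps scaler0 add0r addrK !scalerA -scalerDl.
by congr (_ *: _); rewrite /C' /Ccoef -/a -/b; ring.
Qed.

(** The two terms of [W0_delta] contribute b (lam + 2) and -(n - p) (a - b), whose sum is [D']; the
    sign is that of the codifferential. *)
Lemma has_density_delta_riesz T : has_density T W0 ->
  has_density (codiff T) (fun x => (- D') *: rpow_form lam (fun x => iota_vec x beta) x).
Proof.
move=> TW.
pose V k x := b *: (((lam + 2) * coordC k x * rpow (lam + 2 - 2) x) *: beta + rpow (lam + 2) x *: 0)
 + (a - b) *: ((lam * coordC k x * rpow (lam - 2) x) *: iota_vec x (eps_vec x beta) +
     rpow lam x *: (contract_e k (eps_vec x beta) + iota_vec x (wedge_e k beta))).
have dV k : fderiv k W0 (V k).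
  apply: (fderiv_ext (fun x => esym (W0_delta x)) (fun=> erefl)).
  by apply: fderivD; apply: fderivZl; apply: fderiv_rpow => //;
    [exact: fderiv_cst|exact: fderiv_iota_eps].
have nV k : fnice (V k).
  apply: fniceD; apply: fniceZl; apply: fnice_fderiv_rpow => //.
  - exact: fnice_cst.
  - exact: fnice_cst.
  - by apply: fnice_iota; exact: fnice_eps_cst.
  - apply: fniceD; [|by apply: fnice_iota; exact: fnice_cst].
    by apply: fnice_contract; exact: fnice_eps_cst.
have := has_density_codiff TW fnice_W0 dV nV.
rewrite (_ : (fun x => \sum_k (-1) *: contract_e k (V k x)) =
  (fun x => (- D') *: rpow_form lam (fun x => iota_vec x beta) x))//.
apply/funext => x; rewrite /V /rpow_form -scaler_sumr.
under eq_bigr do rewrite scaler0 addr0 contract_eD contract_eZ [X in _ + X]contract_eZ contract_eD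
  [X in _ + _ *: (_ + X)]contract_eZ.
rewrite big_split /= -!scaler_sumr big_split /= -scaler_sumr !sum_contract_coord.
rewrite sum_contract_iota_eps iota_iota scaler0 add0r addrK !scalerA -scalerDl scalerA.
by congr (_ *: _); rewrite /D' /Dcoef -/a -/b; ring.
Qed.

Lemma has_density_delta_eps (c : R[i]) T :
  has_density T (fun x => c *: rpow_form lam (fun x => eps_vec x beta) x) ->
  has_density (codiff T) (fun x => (- c) *:
    ((lam * rpow (lam - 2) x) *: iota_vec x (eps_vec x beta) +
     ((n%:R - p%:R) * rpow lam x) *: beta)).
Proof.
move=> TW.
pose V k x := c *: ((lam * coordC k x * rpow (lam - 2) x) *: eps_vec x beta +
     rpow lam x *: wedge_e k beta).
have dV k : fderiv k (fun x => c *: rpow_form lam (fun x => eps_vec x beta) x) (V k).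
  by apply: fderivZl; apply: fderiv_rpow => //; exact: fderiv_eps_cst.
have nW : fnice (fun x => c *: rpow_form lam (fun x => eps_vec x beta) x).
  by apply: fniceZl; apply: fnice_rpow_form => //; exact: fnice_eps_cst.
have nV k : fnice (V k).
  by apply: fniceZl; apply: fnice_fderiv_rpow => //; [exact: fnice_eps_cst|exact: fnice_cst].
have := has_density_codiff TW nW dV nV.
set X := (fun x => \sum_k _ *: _); set Y := (fun x => - c *: _).
rewrite (_ : X = Y)//; apply/funext => x; rewrite /X /Y /V -scaler_sumr.
under eq_bigr do rewrite contract_eZ contract_eD [X in _ + X]contract_eZ.
rewrite -scaler_sumr big_split /= -scaler_sumr sum_contract_coord.
by rewrite (sum_contract_wedge pbeta) !scalerA mulN1r (mulrC (rpow lam x)).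
Qed.

Lemma has_density_d_iota (c : R[i]) T :
  has_density T (fun x => c *: rpow_form lam (fun x => iota_vec x beta) x) ->
  has_density (ext_d T) (fun x => c *:
    ((lam * rpow (lam - 2) x) *: eps_vec x (iota_vec x beta) +
     (p%:R * rpow lam x) *: beta)).
Proof.
move=> TW.
pose V k x := c *: ((lam * coordC k x * rpow (lam - 2) x) *: iota_vec x beta +
     rpow lam x *: contract_e k beta).
have dV k : fderiv k (fun x => c *: rpow_form lam (fun x => iota_vec x beta) x) (V k).
  by apply: fderivZl; apply: fderiv_rpow => //; exact: fderiv_iota_cst.
have nW : fnice (fun x => c *: rpow_form lam (fun x => iota_vec x beta) x).
  by apply: fniceZl; apply: fnice_rpow_form => //; exact: fnice_iota_cst.
have nV k : fnice (V k).
  by apply: fniceZl; apply: fnice_fderiv_rpow => //; [exact: fnice_iota_cst|exact: fnice_cst].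
have := has_density_ext_d TW nW dV nV.
set X := (fun x => \sum_k _); set Y := (fun x => c *: _).
rewrite (_ : X = Y)//; apply/funext => x; rewrite /X /Y /V.
under eq_bigr do rewrite wedge_eZ wedge_eD [X in _ + X]wedge_eZ.
rewrite -scaler_sumr big_split /= -scaler_sumr sum_wedge_coord.
by rewrite (sum_wedge_contract pbeta) !scalerA (mulrC (rpow lam x)).
Qed.

Lemma D2_riesz (T : fdistr R n) f : schwartz f -> has_density T W0 ->
  D2 p A B lam T f = (- lam * (lam + n%:R) * C' * D') *:
    density_distr (fun x => riesz_density A B lam x beta) f.
Proof.
move=> sf TW.
pose U1 x := (- C') *: ((lam * rpow (lam - 2) x) *: iota_vec x (eps_vec x beta) +
     ((n%:R - p%:R) * rpow lam x) *: beta).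
pose U2 x := (- D') *: ((lam * rpow (lam - 2) x) *: eps_vec x (iota_vec x beta) +
     (p%:R * rpow lam x) *: beta).
have T1 : codiff (ext_d T) f = density_distr U1 f.
  exact: (has_density_delta_eps (has_density_d_riesz TW)).
have T2 : ext_d (codiff T) f = density_distr U2 f.
  exact: (has_density_d_iota (has_density_delta_riesz TW)).
have nr z (c : R[i]) : 4 <= complex.Re z -> nice (fun x : Rn => c * rpow z x).
  by move=> z4; apply: niceM; [exact: nice_cst|exact: nice_rpow].
have lamB4 : 4 <= complex.Re (lam - 2) by have := lam10; rewrite ReB2; lra.
have nEJ : fnice (fun x => eps_vec x (iota_vec x beta)).
  by apply: fnice_eps; exact: fnice_iota_cst.
have nJE : fnice (fun x => iota_vec x (eps_vec x beta)).
  by apply: fnice_iota; exact: fnice_eps_cst.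
have nb : fnice (fun=> beta) by exact: fnice_cst.
have nU1 : fnice U1.
  by apply: fniceZl; apply: fniceD; apply: fniceZ => //; exact: nr.
have nU2 : fnice U2.
  by apply: fniceZl; apply: fniceD; apply: fniceZ => //; exact: nr.
have nR : fnice (fun x => riesz_density A B lam x beta).
  apply: fniceZ; first exact: nice_rpow.
  by apply: fniceD; exact: fniceZl.
rewrite /D2 T1 T2.
have e1 := density_distrZ (Ccoef p A B lam * Dcoef n p A B (lam + 2)) sf nU1.
have e2 := density_distrZ (Dcoef n p A B lam * Ccoef p A B (lam + 2)) sf nU2.
have e3 := density_distrD sf (fniceZl (Ccoef p A B lam * Dcoef n p A B (lam + 2)) nU1)
  (fniceZl (Dcoef n p A B lam * Ccoef p A B (lam + 2)) nU2).
have e4 := density_distrZ (- lam * (lam + n%:R) * C' * D') sf nR.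
rewrite -e1 -e2 -e3 -e4; congr (density_distr _ f); apply/funext => x.
rewrite /U1 /U2 /riesz_density.
have E := rpow_iota_eps x lamB4; rewrite subrK in E.
(* After removing the common factor -C' D', the two conditions read (lam+n-p) C + p D = lam (lam+n)
   A and (n-p) C + (lam+p) D = lam (lam+n) B: the adjugate of the matrix sending (A, B) to (C, D),
   applied to (C, D), gives the determinant times (A, B). *)
apply: scale_collect (esym E) _ _; rewrite /C' /D' /Ccoef /Dcoef; ring.
Qed.

End riesz_calculus.
(** * Meromorphic continuation *)

Section meromorphic_calculus.
Context {R : realType}.
Implicit Types (h g : R[i] -> R[i]) (a c z : R[i]) (Q : Prop).

(* [Q] says that [a] is not a pole: at the end it gives continuity of the
   difference of the two sides at the point where the identity is claimed. *)
Definition meromorphic_unless Q h a :=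
  meromorphic_at h a /\ (Q -> holomorphic_at h a).

Lemma holomorphic_meromorphic Q h a : (\forall z \near (a : R[i]^o), holomorphic_at h z) ->
  meromorphic_unless Q h a.
Proof.
move=> /near_cmodP[r r0 hh]; split; last first.
  by move=> _; apply: hh; rewrite subrr cmod0.
exists 0%N, h; split; first by apply/near_cmodP; exists r.
by apply/dnbhs_cmodP; exists 1 => // z _ _; rewrite expr0 divr1.
Qed.

Lemma meromorphic_unless_cst Q c a : meromorphic_unless Q (fun=> c) a.
Proof.
apply: holomorphic_meromorphic; apply/near_cmodP; exists 1 => // z _.
exact: holomorphic_at_cst.
Qed.

Let holomorphic_power N a z : holomorphic_at (fun w => (w - a) ^+ N) z.
Proof.
apply: (@holomorphic_atX _ (fun w => w - a)).
exact: (holomorphic_atD (@holomorphic_at_id R z) (@holomorphic_at_cst R (- a) z)).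
Qed.

Lemma meromorphic_unlessD Q h g a : meromorphic_unless Q h a -> meromorphic_unless Q g a ->
  meromorphic_unless Q (fun z => h z + g z) a.
Proof.
move=> [[N [u [/near_cmodP[r1 r10 hu] /dnbhs_cmodP[r2 r20 eu]]]] Hh].
move=> [[M [v [/near_cmodP[s1 s10 hv] /dnbhs_cmodP[s2 s20 ev]]]] Hg].
split; last by move=> q; exact: (holomorphic_atD (Hh q) (Hg q)).
exists (N + M)%N, (fun z => u z * (z - a) ^+ M + v z * (z - a) ^+ N); split.
  apply/near_cmodP; exists (Num.min r1 s1); first by rewrite lt_min r10.
  move=> z; rewrite lt_min => /andP[z1 z2].
  by apply: holomorphic_atD; apply: holomorphic_atM => //; [exact: hu|exact: hv].
apply/dnbhs_cmodP; exists (Num.min r2 s2); first by rewrite lt_min r20.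
move=> z za; rewrite lt_min => /andP[z1 z2]; rewrite eu// ev// exprD.
have n0 m : (z - a) ^+ m != 0 by rewrite expf_neq0// subr_eq0.
move: (n0 N) (n0 M); move: (_ ^+ N) (_ ^+ M) => s t s0 t0.
by rewrite mulrDl invfM mulrA mulrAC mulfK// mulrA mulfK.
Qed.

Lemma meromorphic_unlessM Q h g a : meromorphic_unless Q h a -> meromorphic_unless Q g a ->
  meromorphic_unless Q (fun z => h z * g z) a.
Proof.
move=> [[N [u [/near_cmodP[r1 r10 hu] /dnbhs_cmodP[r2 r20 eu]]]] Hh].
move=> [[M [v [/near_cmodP[s1 s10 hv] /dnbhs_cmodP[s2 s20 ev]]]] Hg].
split; last by move=> q; exact: (holomorphic_atM (Hh q) (Hg q)).
exists (N + M)%N, (fun z => u z * v z); split.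
  apply/near_cmodP; exists (Num.min r1 s1); first by rewrite lt_min r10.
  move=> z; rewrite lt_min => /andP[z1 z2].
  by apply: holomorphic_atM; [exact: hu|exact: hv].
apply/dnbhs_cmodP; exists (Num.min r2 s2); first by rewrite lt_min r20.
move=> z za; rewrite lt_min => /andP[z1 z2]; rewrite eu// ev// exprD.
by rewrite invfM mulrACA.
Qed.

Lemma meromorphic_unless_sum Q (T : Type) (r : seq T) (h : T -> R[i] -> R[i]) a :
  (forall t, meromorphic_unless Q (h t) a) ->
  meromorphic_unless Q (fun z => \sum_(t <- r) h t z) a.
Proof.
move=> mh; elim: r => [|t r IH].
  rewrite (_ : (fun z => _) = fun=> 0); first exact: meromorphic_unless_cst.
  by apply/funext => z; rewrite big_nil.
rewrite (_ : (fun z => _) = fun z => h t z + \sum_(t <- r) h t z).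
  exact: (meromorphic_unlessD (mh t) IH).
by apply/funext => z; rewrite big_cons.
Qed.

Lemma meromorphic_unless_shift Q h c a : meromorphic_unless Q h (a + c) ->
  meromorphic_unless Q (fun z => h (z + c)) a.
Proof.
move=> [[N [u [/near_cmodP[r1 r10 hu] /dnbhs_cmodP[r2 r20 eu]]]] Hh].
split; last by move=> q; apply: holomorphic_at_shift; exact: Hh.
have E z : z + c - (a + c) = z - a by ring.
exists N, (fun z => u (z + c)); split.
  apply/near_cmodP; exists r1 => // z z1; apply: holomorphic_at_shift.
  by apply: hu; rewrite E.
apply/dnbhs_cmodP; exists r2 => // z za z2; rewrite eu ?E//.
by apply: contra za => /eqP/addIr ->.
Qed.

(** Continuity, made explicit by comparing [h a] with the zero value at [a + t] for a small real
    [t]. *)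
Lemma holomorphic_at_near0 h a : holomorphic_at h a ->
  (\forall z \near (a : R[i]^o)^', h z = 0) -> h a = 0.
Proof.
move=> /holomorphic_atP[k' Hk] /dnbhs_cmodP[r r0 h0].
have [s s0 Hs] := Hk 1 ltr01.
apply/eqP; rewrite -cmod_eq0 eq_le cmod_ge0 andbT leNgt; apply/negP => m0.
set m := cmod (h a) in m0.
have k0 : 0 < cmod k' + 1 by rewrite ltr_wpDl// cmod_ge0.
(* The last entry makes (|k'| + 1) t <= |h a| / 2, against |h a| <= (1 + |k'|) t from the derivative
   estimate. *)
pose t := Num.min (r / 2) (Num.min (s / 2) (m / (cmod k' + 1) / 2)).
have t0 : 0 < t by rewrite !lt_min !divr_gt0.
have tr : t <= r / 2 by rewrite ge_min lexx.
have ts : t <= s / 2 by rewrite !ge_min lexx orbT.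
have tm : t <= m / (cmod k' + 1) / 2 by rewrite !ge_min lexx !orbT.
have ct : cmod t%:C%C = t by rewrite cmod_real gtr0_norm.
have ts' : cmod t%:C%C < s by rewrite ct; lra.
have := Hs _ ts'; rewrite h0; first last.
- by rewrite addrC addKr ct; lra.
- by rewrite -subr_eq0 addrC addKr -cmod_eq0 ct gt_eqF.
rewrite sub0r mul1r ct => le1.
have : m <= t + cmod k' * t.
  rewrite /m -cmodN -(subrK (k' * t%:C%C) (- h a)) (le_trans (cmodD _ _))//.
  by rewrite lerD// cmodM ct.
have : (cmod k' + 1) * t <= m / 2.
  have -> : m / 2 = (cmod k' + 1) * (m / (cmod k' + 1) / 2) by field; rewrite gt_eqF.
  by rewrite ler_pM2l.
by lra.
Qed.

End meromorphic_calculus.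

(** * Meromorphy is preserved by d and delta *)

Section riesz_meromorphic.
Context {R : realType} {n : nat}.
Local Notation Rn := ('rV[R]_n).
Implicit Types (f : Rn -> R[i]) (U : R[i] -> fdistr R n) (Q : Prop) (a : R[i]).

Definition fdistr_meromorphic Q a U := forall f I, schwartz f ->
  meromorphic_unless Q (fun z => U z f I) a.

(** Each coefficient is a finite combination, with constants independent of z, of coefficients of
    [U z] tested against partial derivatives of f. *)
Lemma fdistr_meromorphic_ext_d Q a U : fdistr_meromorphic Q a U ->
  fdistr_meromorphic Q a (fun z => ext_d (U z)).
Proof.
move=> mU f I sf.
rewrite (_ : (fun z => _) = fun z => \sum_k
  (if k \in I then - basis_sign R k I else 0) * U z (partial k f) (I :\ k)).
  apply: meromorphic_unless_sum => k; apply: meromorphic_unlessM.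
    exact: meromorphic_unless_cst.
  by apply: mU; exact: schwartz_partial.
apply/funext => z; rewrite /ext_d sum_ffunE; apply: eq_bigr => k _.
rewrite /dpartial !ffunE; case: (k \in I); last by rewrite mul0r.
by rewrite mulrN mulNr.
Qed.

Lemma fdistr_meromorphic_codiff Q a U : fdistr_meromorphic Q a U ->
  fdistr_meromorphic Q a (fun z => codiff (U z)).
Proof.
move=> mU f I sf.
rewrite (_ : (fun z => _) = fun z => \sum_J U z (fun x => ext_d_form (form_at I f) x J) J).
  apply: meromorphic_unless_sum => J; apply: mU.
  rewrite (_ : (fun x => _) = (fun x => \sum_k
    (if (k \in J) && (J :\ k == I) then basis_sign R k J else 0) * partial k f x)).
    by apply: schwartz_sum => k; exact: schwartz_partial.
  by apply/funext => x; exact: ext_d_form_at.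
by apply/funext => z; rewrite ffunE.
Qed.

(** At a point of [P] the pole clause applies. At any other point a full neighbourhood avoids [P],
    since [P] does not accumulate, and the family is holomorphic there. *)
Lemma meromorphic_family_at p P (T : R[i] -> edistr R n) : meromorphic_family p P T ->
  forall Q f w I a, (Q -> ~ P a) -> schwartz f -> pform p w ->
  meromorphic_unless Q (fun z => T z f w I) a.
Proof.
move=> [isoP _ hol pol] Q f w I a QP sf pw.
have [Pa|nPa] := pselect (P a).
  split; last by move=> q; case: (QP q).
  have [N HN] := pol a Pa; have [g [hg eg]] := HN f w I sf pw.
  by exists N, g.
apply: holomorphic_meromorphic.
have /dnbhs_cmodP[r r0 Hr] := isoP a.
apply/near_cmodP; exists r => // z zr; apply: hol => //.
by have [->//|za] := eqVneq z a; exact: Hr.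
Qed.

End riesz_meromorphic.

(** * Holomorphy of the scalar coefficients *)

Section coefficients.
Context {R : realType}.
Variables (n p : nat) (A B : R[i] -> R[i]) (eA : entire A) (eB : entire B).

Lemma entire_Ccoef : entire (Ccoef p A B).
Proof.
move=> z; apply: holomorphic_atD.
  apply: holomorphic_atM; last exact: eA.
  exact: (holomorphic_atD (@holomorphic_at_id R z) (@holomorphic_at_cst R _ z)).
rewrite (_ : (fun w => _) = fun w => - p%:R * B w); last first.
  by apply/funext => w; rewrite mulNr.
by apply: holomorphic_atM; [exact: holomorphic_at_cst|exact: eB].
Qed.

Lemma entire_Dcoef : entire (Dcoef n p A B).
Proof.
move=> z; have h1 := holomorphic_atM (@holomorphic_at_cst R (- (n%:R - p%:R)) z) (@eA z).
have h2 := holomorphic_atD (@holomorphic_at_id R z) (@holomorphic_at_cst R n%:R z).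
have h3 := holomorphic_atD h2 (@holomorphic_at_cst R (- p%:R) z).
exact: (holomorphic_atD h1 (holomorphic_atM h3 (@eB z))).
Qed.

Lemma meromorphic_entire Q (g : R[i] -> R[i]) a : entire g -> meromorphic_unless Q g a.
Proof.
move=> eg; apply: holomorphic_meromorphic; apply/near_cmodP.
by exists 1 => // z _; exact: eg.
Qed.

Lemma entire_shift (g : R[i] -> R[i]) (c : R[i]) : entire g -> entire (fun z => g (z + c)).
Proof. by move=> eg z; apply: holomorphic_at_shift; exact: eg. Qed.

Lemma entireM (f g : R[i] -> R[i]) : entire f -> entire g -> entire (fun z => f z * g z).
Proof. by move=> ef eg z; apply: holomorphic_atM; [exact: ef|exact: eg]. Qed.

Lemma entire_prefactor : entire (fun z : R[i] => - z * (z + n%:R)).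
Proof.
have -> : (fun z : R[i] => - z * (z + n%:R)) = fun z => -1 * z * (z + n%:R).
  by apply/funext => z; rewrite mulN1r.
move=> z; apply: holomorphic_atM.
  exact: (holomorphic_atM (@holomorphic_at_cst R (-1) z) (@holomorphic_at_id R z)).
exact: (holomorphic_atD (@holomorphic_at_id R z) (@holomorphic_at_cst R _ z)).
Qed.

End coefficients.

Theorem theorem3p3 (R : realType) (n p : nat) (A B : R[i] -> R[i])
    (P : set R[i]) (Riesz : R[i] -> edistr R n) :
  (p <= n)%N -> entire A -> entire B ->
  riesz_distribution p A B P Riesz ->
  forall lam : R[i], ~ P lam -> ~ P (lam + 2) ->
  forall (beta : dform R n) (f : 'rV[R]_n -> R[i]),
    pform p beta -> schwartz f ->
    D2 p A B lam (apply_form (Riesz (lam + 2)) beta) f =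
    (- lam * (lam + n%:R) * Ccoef p A B (lam + 2) * Dcoef n p A B (lam + 2))
      *: apply_form (Riesz lam) beta f.
Proof.
move=> _ eA eB [mero dens] lam nPlam nPlam2 beta f pbeta sf.
have eC := @entire_Ccoef R p A B eA eB; have eD := @entire_Dcoef R n p A B eA eB.
have eC2 := @entire_shift R _ 2 eC; have eD2 := @entire_shift R _ 2 eD.
apply/ffunP => I; apply/eqP; rewrite -subr_eq0; apply/eqP.
pose T z : fdistr R n := apply_form (Riesz (z + 2)) beta.
pose K z := - z * (z + n%:R) * Ccoef p A B (z + 2) * Dcoef n p A B (z + 2).
(* Difference of the two sides, one coefficient at a time and for a fixed test function, as a scalar
   function of z. *)
pose h z := (D2 p A B z (T z) f I : R[i]) - (K z *: apply_form (Riesz z) beta f) I.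
change (h lam = 0).
have eK : entire K := @entireM R _ _ (@entireM R _ _ (@entire_prefactor R n) eC2) eD2.
have eNK := @entireM R _ _ (fun z => @holomorphic_at_cst R (-1) z) eK.
have eCD := @entireM R _ _ eC eD2; have eDC := @entireM R _ _ eD eC2.
(* Proved once for two uses: [Q := False] gives meromorphy at every point, poles included, and
   [Q := True] gives holomorphy at [lam], where neither [lam] nor [lam + 2] lies in [P]. *)
have mh Q a : (Q -> ~ P a) -> (Q -> ~ P (a + 2)) -> meromorphic_unless Q h a.
  move=> QP QP2.
  have mT : fdistr_meromorphic Q a T.
    move=> g J sg; apply: (@meromorphic_unless_shift _ _ (fun z => Riesz z g beta J)).
    exact: (meromorphic_family_at mero J QP2 sg pbeta).
  rewrite (_ : h = fun z => (Ccoef p A B z * Dcoef n p A B (z + 2)) * codiff (ext_d (T z)) f I +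
    (Dcoef n p A B z * Ccoef p A B (z + 2)) * ext_d (codiff (T z)) f I
    + (-1 * K z) * Riesz z f beta I); last first.
    by apply/funext => z; rewrite /h /D2 !ffunE mulN1r mulNr.
  have m1 := fdistr_meromorphic_codiff (fdistr_meromorphic_ext_d mT) I sf.
  have m2 := fdistr_meromorphic_ext_d (fdistr_meromorphic_codiff mT) I sf.
  have m3 := meromorphic_family_at mero I QP sf pbeta.
  have n1 := meromorphic_unlessM (meromorphic_entire Q a eCD) m1.
  have n2 := meromorphic_unlessM (meromorphic_entire Q a eDC) m2.
  have n3 := meromorphic_unlessM (meromorphic_entire Q a eNK) m3.
  exact: (meromorphic_unlessD (meromorphic_unlessD n1 n2) n3).
(* Here both [z] and [z + 2] are in the half-plane where the family is given by its density. *)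
have h0 z : 10 < complex.Re z -> h z = 0.
  move=> z10; have n0 : 0 <= n%:R :> R by exact: ler0n.
  have densT w : 0 < complex.Re w -> forall g, schwartz g ->
      Riesz w g beta = density_distr (fun x => riesz_density A B w x beta) g.
    move=> w0 g sg; apply/ffunP => J; rewrite density_distrE.
    have [|_ H] := dens w; first by lra.
    exact: H.
  have z2 : 0 < complex.Re (z + 2).
    by rewrite cReD (_ : complex.Re 2 = 2)//; lra.
  rewrite /h (D2_riesz pbeta (ltW z10) sf (fun g sg => densT _ z2 g sg)).
  rewrite /apply_form densT//; last by lra.
  by rewrite subrr.
have near0 := meromorphic_identity (fun a => (mh False a (False_ind _) (False_ind _)).1) h0 lam.
(* The identity theorem only yields vanishing near [lam] and not at it; holomorphy at [lam] closes
   the gap. *)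
by apply: holomorphic_at_near0 near0; apply: (mh True lam _ _).2.
Qed.
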